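(* Assume Assumptions (LS), (UT), (LT) and (LB) below hold, with $\alpha>0$ the common exponent in (UT) and (LT). Then there exist constants $c>0$, $\eta>0$, $\theta_0$ and $r_0$ (depending on $\alpha$) such that for all $r>r_0$ and $\theta_0<\theta<\eta r^{2/3}$, $$\mathbb{P}\left(X_r-\mathbb{E}[X_r]\le-\theta r^{1/3}\right)\ge\exp\left(-c\theta^3\right).$$
   Context: Let $\{\xi_v:v\in\mathbb{Z}^2\}$ be i.i.d. random variables with a common law $\nu$ supported on $[0,\infty)$. A directed path is an up-right nearest-neighbour path in $\mathbb{Z}^2$, and its weight is $\ell(\gamma)=\sum_{u\in\gamma}\xi_u$. For $u\preceq v$ coordinatewise, $X_{u,v}=\max_{\gamma:u\to v}\ell(\gamma)$ over directed paths from $u$ to $v$ ($-\infty$ if none). For $r\in\mathbb{N}$, $z\in\mathbb{Z}$, $X_r^z=X_{(1,1),(r-z,r+z)}$ and $X_r=X_r^0$. It is assumed that $\mu=\lim_{r\to\infty}r^{-1}\mathbb{E}[X_r]<\infty$. Assumption (LS): there exist positive finite constants $\rho,G,H,g_1,g_2$ such that for all large enough $r$ and all $z\in[-\rho r,\rho r]$, $\mathbb{E}[X_r^z]\in \mu r-G\frac{z^2}{r}+\left[-H\frac{z^4}{r^3},0\right]+\left[-g_1r^{1/3},-g_2r^{1/3}\right]$. Assumptions (UT) and (LT): there exists $\alpha>0$ such that for every $\varepsilon>0$ there exist positive finite $c,\theta_0,r_0$ (depending only on $\varepsilon$) such that for all $r>r_0$, $\theta>\theta_0$ and $|z|\le(1-\varepsilon)r$: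 (UT) $\mathbb{P}(X_r^z-\mathbb{E}[X_r^z]>\theta r^{1/3})\le\exp(-c\theta^\alpha)$ and (LT) $\mathbb{P}(X_r^z-\mathbb{E}[X_r^z]<-\theta r^{1/3})\le\exp(-c\theta^\alpha)$. Assumption (LB): there exist constants $\delta>0$, $C>0$, $r_0$ such that for all $r>r_0$, $\mathbb{P}(X_r-\mu r<-Cr^{1/3})\ge\delta$. *)

(* Defs.v *)
From HB Require Import structures.
From mathcomp Require Import all_boot all_order all_algebra.
From mathcomp Require Import all_classical all_reals all_analysis.
Set Implicit Arguments. Unset Strict Implicit. Unset Printing Implicit Defensive.
Import Order.TTheory GRing.Theory Num.Theory.
Import numFieldNormedType.Exports.
Local Open Scope classical_set_scope.
Local Open Scope ring_scope.

Section LPP.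
Context {R : realType} {d : measure_display} {Omega : measurableType d}.

Definition env := (int * int)%type -> Omega -> R.

Definition mutually_independent (P : probability Omega R) (xi : env) : Prop :=
  forall (s : seq (int * int)) (B : (int * int)%type -> set R),
    uniq s -> (forall i, measurable (B i)) ->
    P (\big[setI/setT]_(i <- s) (xi i @^-1` B i)) =
    (\prod_(i <- s) P (xi i @^-1` B i))%E.

Definition iid_law (P : probability Omega R) (xi : env) (nu : probability R R) : Prop :=
  [/\ forall i, measurable_fun setT (xi i),
      forall i (B : set R), measurable B -> P (xi i @^-1` B) = nu B,
      nu [set x : R | 0 <= x] = 1%E &
      mutually_independent P xi].

(* An up-right path from u with n steps is encoded by s : n.-tuple bool
   (true = step (+1,0), false = step (0,+1)); its k-th vertex: *)
Definition vert (u : int * int) (n : nat) (s : n.-tuple bool) (k : nat) : int * int :=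
  (u.1 + (count id (take k s))%:Z, u.2 + (count negb (take k s))%:Z).

Definition weight (xi : env) (u : int * int) (n : nat) (s : n.-tuple bool)
  (w : Omega) : R :=
  \sum_(k < n.+1) xi (vert u s k) w.

(* X_{u, u + (dx,dy)}: maximum over all directed paths from u to u+(dx,dy)
   (those with exactly dx right-steps among dx+dy steps).  The default
   element of the big max is the weight of one such path, so this is the
   exact maximum over a nonempty finite set. *)
Definition lpp (xi : env) (u : int * int) (dx dy : nat) (w : Omega) : R :=
  \big[Num.max/weight xi u (cat_tuple (nseq_tuple dx true) (nseq_tuple dy false)) w]_(s : (dx + dy).-tuple bool | count id s == dx)
     weight xi u s w.

(* X_r^z = X_{(1,1),(r-z,r+z)}; meaningful (finite) when |z| < r,
   which is the case in all uses below. *)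
Definition Xrz (xi : env) (r : nat) (z : int) : Omega -> R :=
  lpp xi (1, 1) (absz (r%:Z - z - 1)%R) (absz (r%:Z + z - 1)%R).

Definition EX (P : probability Omega R) (xi : env) (r : nat) (z : int) : \bar R :=
  (\int[P]_w (Xrz xi r z w)%:E)%E.

End LPP.

Definition cube_root {R : realType} (x : R) : R := x `^ (3^-1).

(* Main.v *)
(* Cut the square from (1,1) to (r,r) into about theta^(3/2) antidiagonal slabs of
   height s ~ r / theta^(3/2), and each antidiagonal into cells of width ~ s^(2/3).
   A path staying within distance ~ theta^(1/2) r^(2/3) of the diagonal meets only
   O(theta^3) cells.  For each such cell, with probability bounded below, every passage
   time started in it and crossing one slab with displacement z is at most
   mu s - c s^(1/3) - c z^2 / s; these events are decreasing, so by Harris' inequality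
   they hold together with probability at least exp(- c theta^3).  On their intersection
   a path inside the strip loses theta^(3/2) s^(1/3) ~ theta r^(1/3), and a path leaving
   the strip loses as much because of the quadratic terms.

   The one-slab estimate is obtained by backing up: a passage time between two cells is
   compared with a point-to-point passage time whose endpoints lie slightly behind the
   cells, the connecting passage times being independent of the middle part.  A
   point-to-point passage time is below its mean plus a s^(1/3) with probability bounded
   below because it is centred with an integrable lower tail, and (LS) puts the mean below
   mu s by order s^(1/3). *)

Require Import Defs.
From HB Require Import structures.
From mathcomp Require Import all_boot all_order all_algebra.
From mathcomp Require Import all_classical all_reals all_analysis.
From mathcomp Require Import measurable_realfun.
From mathcomp Require Import zify ring lra.
Import Order.TTheory GRing.Theory Num.Theory.
Import numFieldNormedType.Exports.
Local Open Scope classical_set_scope.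
Local Open Scope ring_scope.
Set Implicit Arguments.
Unset Strict Implicit.
Unset Printing Implicit Defensive.

(** * Harris' inequality and independence for finite product laws *)

(** Three difficulties shape the proof. First, a cell contains about s^(2/3) points, so a union
    bound over pairs of endpoints would destroy a probability that is merely bounded below;
    decoupling from the pair that realizes a large passage time leaves only a union over cells.
    Second, the one-slab bound with a negative constant is available only with some small
    probability. It is imposed separately on boundedly many displacements, while all larger
    displacements are controlled at once by a union bound with a convergent sum. That sum needs
    tails of order t^(-2) only, so the stretched exponentials are weakened to this order at the
    outset. Third, displacements near the axes lie outside the range of (LS); such a path is
    prolonged until its slope is small. Harris' inequality and independence are applied to events
    that some passage time is strictly larger than a level, or to their complements: rounding the
    weights down to a finite grid reduces both statements to finite sums. *)

Section FiniteProduct.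
Context {R : realType} {I : eqType} {N : nat}.
Variables (p v : 'I_N -> R).
Implicit Types (x y : I -> R) (F G : (I -> R) -> R) (s t : seq I).

Definition upd x i a : I -> R := fun j => if j == i then a else x j.

Definition avg1 i F x : R := \sum_a p a * F (upd x i (v a)).

(** Expectation under a finite product law, written as iterated one-site averages with the sites
    outside [s] frozen at the argument. Harris' inequality and the product formula then become
    inductions on [s]. *)
Definition avg s F := foldr avg1 F s.

Definition envle x y := forall i, x i <= y i.

Definition mono F := forall x y, envle x y -> F x <= F y.

Definition agree s x y := forall i, i \in s -> x i = y i.

Definition dep (T : Type) s (F : (I -> R) -> T) := forall x y, agree s x y -> F x = F y.

Hypothesis p_ge0 : forall a, 0 <= p a.
Hypothesis p_sum1 : \sum_a p a = 1.

(** Symmetrization with an independent copy: the double sum of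
    [p a * p b * (f a - f b) * (g a - g b)] has nonnegative terms, and expanding it gives twice the
    covariance. *)
Lemma chebyshev_sum (f g : 'I_N -> R) :
  (forall a b, 0 <= (f a - f b) * (g a - g b)) ->
  (\sum_a p a * f a) * (\sum_a p a * g a) <= \sum_a p a * (f a * g a).
Proof.
move=> fg.
have : 0 <= \sum_a \sum_b (p a * p b) * ((f a - f b) * (g a - g b)).
  by do 2 (apply: sumr_ge0 => ? _); apply: mulr_ge0; [apply: mulr_ge0|apply: fg].
have -> : \sum_a \sum_b (p a * p b) * ((f a - f b) * (g a - g b)) =
    (\sum_a p a * (f a * g a)) * (\sum_b p b)
    - (\sum_a p a * f a) * (\sum_b p b * g b)
    - (\sum_a p a * g a) * (\sum_b p b * f b)
    + (\sum_a p a) * (\sum_b p b * (f b * g b)).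
  rewrite !mulr_suml -!sumrB -big_split /=; apply: eq_bigr => a _.
  rewrite !mulr_sumr -!sumrB -big_split /=; apply: eq_bigr => b _.
  by ring.
by rewrite p_sum1; lra.
Qed.

Lemma upd_le x y i a : envle x y -> envle (upd x i a) (upd y i a).
Proof. by move=> xy j; rewrite /upd; case: eqP. Qed.

Lemma upd_le2 x i a b : a <= b -> envle (upd x i a) (upd x i b).
Proof. by move=> ab j; rewrite /upd; case: eqP. Qed.

Lemma avg1_le i F G x : (forall y, F y <= G y) -> avg1 i F x <= avg1 i G x.
Proof. by move=> FG; apply: ler_sum => a _; rewrite ler_wpM2l. Qed.

Lemma avg1_mono i F : mono F -> mono (avg1 i F).
Proof.
move=> mF x y xy; apply: ler_sum => a _; rewrite ler_wpM2l//.
exact/mF/upd_le.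
Qed.

Lemma avg_mono s F : mono F -> mono (avg s F).
Proof. by move=> mF; elim: s => //= i s; apply: avg1_mono. Qed.

Lemma avg1_harris i F G x : mono F -> mono G ->
  avg1 i F x * avg1 i G x <= avg1 i (fun y => F y * G y) x.
Proof.
move=> mF mG; apply: chebyshev_sum => a b.
have [ab|/ltW ba] := leP (v a) (v b).
- have := mF _ _ (upd_le2 x i ab); have := mG _ _ (upd_le2 x i ab).
  by move=> h1 h2; rewrite -mulrNN mulr_ge0 ?opprB ?subr_ge0.
- have := mF _ _ (upd_le2 x i ba); have := mG _ _ (upd_le2 x i ba).
  by move=> h1 h2; rewrite mulr_ge0 ?subr_ge0.
Qed.

(** Averaging preserves monotonicity, so Chebyshev's inequality applies to the inner averages one
    site at a time. *)
Lemma avg_harris s F G x : mono F -> mono G ->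
  avg s F x * avg s G x <= avg s (fun y => F y * G y) x.
Proof.
move=> mF mG; elim: s x => //= i s IH x.
apply: (le_trans (avg1_harris i x (avg_mono s mF) (avg_mono s mG))).
exact: avg1_le.
Qed.

Lemma eq_avg s F G x : F =1 G -> avg s F x = avg s G x.
Proof.
move=> FG; elim: s x => [|i s IH] x /=; first exact: FG.
by apply: eq_bigr => a _; rewrite IH.
Qed.

Lemma avg_cat s t F : avg (s ++ t) F = avg s (avg t F).
Proof. by rewrite /avg foldr_cat. Qed.

Lemma avg_mulr s F c x : avg s (fun y => F y * c) x = avg s F x * c.
Proof.
elim: s x => //= i s IH x; rewrite /avg1 mulr_suml.
by apply: eq_bigr => a _; rewrite IH mulrA.
Qed.

Lemma avg_mull s t F G x : dep t F -> {in s, forall i, i \notin t} ->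
  avg s (fun y => F y * G y) x = F x * avg s G x.
Proof.
move=> dF; elim: s x => //= i s IH x st.
rewrite /avg1 mulr_sumr; apply: eq_bigr => a _.
rewrite IH; last by move=> j js; apply: st; rewrite inE js orbT.
rewrite mulrCA; congr (_ * (_ * _)); apply: dF => j jt.
by rewrite /upd; case: eqP => // ji; move: (st i (mem_head _ _)); rewrite -ji jt.
Qed.

Lemma avg_dep s t F : dep (s ++ t) F -> dep t (avg s F).
Proof.
elim: s t F => //= i s IH t F dF x y xy.
apply: eq_bigr => a _; congr (_ * _).
have: dep (i :: t) (avg s F).
  apply: IH => x' y' xy'; apply: dF => j; rewrite in_cons mem_cat => js; apply: xy'.
  by rewrite mem_cat in_cons orbCA.
apply=> j; rewrite in_cons /upd; case: eqP => //= _; exact: xy.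
Qed.

(** The average over [t] does not see [F], the lists being disjoint, and turns [G] into a function
    of no site at all, hence a constant that leaves the average over [s]. *)
Lemma avg_indep s t F G x : uniq (s ++ t) -> dep s F -> dep t G ->
  avg (s ++ t) (fun y => F y * G y) x = avg s F x * avg t G x.
Proof.
rewrite cat_uniq => /and3P[_ /hasPn st _] dF dG; rewrite avg_cat.
rewrite -avg_mulr; apply: eq_avg => y; rewrite (avg_mull _ _ dF)//.
congr (_ * _).
have dt : dep [::] (avg t G) by apply: avg_dep; rewrite cats0.
exact: dt.
Qed.

End FiniteProduct.

(** * Quantization *)

Section Quantizer.
Context {R : realType}.
Implicit Types (x : R) (m : nat).

(** Rounding down to the mesh [2 ^- m]; the cap [m * 2 ^ m] bounds the rounded value by [m], so that
    only finitely many values occur. Mesh and cap are refined together, and [quant m x] increases to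
    [x] for [0 <= x]. *)
Definition qnat m x : nat := minn (Num.truncn (2 ^+ m * x)) (m * 2 ^ m).

Definition qidx m x : 'I_(m * 2 ^ m).+1 := inord (qnat m x).

Definition qval m (a : 'I_(m * 2 ^ m).+1) : R := (nat_of_ord a)%:R / 2 ^+ m.

Definition quant m x : R := qval (qidx m x).

Lemma quantE m x : quant m x = (qnat m x)%:R / 2 ^+ m.
Proof. by rewrite /quant /qval inordK// ltnS geq_minr. Qed.

Lemma le_qnat m : {homo qnat m : x y / x <= y >-> (x <= y)%N}.
Proof.
move=> x y xy; rewrite /qnat leq_min geq_minr andbT geq_min le_truncn//.
by rewrite ler_pM2l ?exprn_gt0.
Qed.

Lemma measurable_qidx m (a : 'I_(m * 2 ^ m).+1) :
  measurable [set x : R | qidx m x = a].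
Proof.
have mq : measurable_fun setT (fun x : R => (qnat m x)%:R : R).
  by apply: nondecreasing_measurable => // x y xy; rewrite ler_nat le_qnat.
rewrite (_ : [set _ | _] = setT `&` (fun x : R => (qnat m x)%:R : R) @^-1` [set a%:R]).
  by apply: mq => //; exact: measurable_set1.
apply/seteqP; split=> x /=.
  by move=> <-; split => //; rewrite inordK// ltnS geq_minr.
move=> [_ /eqP]; rewrite eqr_nat => /eqP xa.
by apply/val_inj; rewrite /= inordK// ltnS geq_minr.
Qed.

Lemma quant_le m x : 0 <= x -> quant m x <= x.
Proof.
move=> x0; rewrite quantE ler_pdivrMr ?exprn_gt0// mulrC.
apply: (@le_trans _ _ (Num.truncn (2 ^+ m * x))%:R); first by rewrite ler_nat geq_minl.
by rewrite truncn_le mulr_ge0.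
Qed.

Lemma quant_nondecreasing x : 0 <= x -> {homo quant^~ x : m n / (m <= n)%N >-> m <= n}.
Proof.
move=> x0; apply: homo_leq => [?|? ? ?|m]; [exact: lexx|exact: le_trans|].
rewrite !quantE ler_pdivrMr ?exprn_gt0// mulrAC ler_pdivlMr ?exprn_gt0//.
rewrite exprS mulrA ler_pM2r ?exprn_gt0// -natrM ler_nat /qnat leq_min.
rewrite mulnC minnMr; apply/andP; split.
  apply: (leq_trans (geq_minl _ _)).
  rewrite truncn_ge_nat; last by rewrite mulr_ge0 ?exprn_ge0.
  rewrite natrM exprS -[leRHS]mulrA ler_pM2l ?ltr0n// truncn_le.
  by rewrite mulr_ge0 ?exprn_ge0.
apply: (leq_trans (geq_minr _ _)).
by rewrite expnS mulnCA leq_mul2r leqnSn orbT.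
Qed.

Lemma quant_gt x y : y < x -> 0 <= x -> exists m, y < quant m x.
Proof.
move=> yx x0.
(* The first bound puts [x] below the cap [m], the second makes the mesh finer than [x - y]. *)
pose m := maxn (Num.truncn x).+1 (Num.truncn (x - y)^-1).+1.
exists m; rewrite quantE ltr_pdivlMr ?exprn_gt0//.
have p2 : (0 : R) < 2 ^+ m by rewrite exprn_gt0.
have xm : x < m%:R.
  by apply: (lt_le_trans (truncnS_gt _)); rewrite ler_nat leq_maxl.
have dm : (x - y)^-1 < 2 ^+ m.
  apply: (lt_trans (truncnS_gt _)); rewrite -natrX ltr_nat.
  by apply: (leq_ltn_trans (leq_maxr (Num.truncn x).+1 _)); apply: ltn_expl.
have d1 : 1 < 2 ^+ m * (x - y) by rewrite -ltr_pdivrMr ?subr_gt0// mul1r.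
rewrite /qnat minnC /minn; case: ifPn => [_|_].
  rewrite natrM natrX ltr_pM2r//; exact: lt_trans yx xm.
have := truncnS_gt (2 ^+ m * x); rewrite -natr1; lra.
Qed.

End Quantizer.

(** * Joint law of finitely many rounded weights *)

Section FiniteLaw.
Context {R : realType} {d : measure_display} {Omega : measurableType d}.
Variables (P : probability Omega R) (xi : (int * int) -> Omega -> R).
Variable nu : probability R R.
Hypothesis iid : iid_law P xi nu.

Definition qmass m (a : 'I_(m * 2 ^ m).+1) : R := fine (nu [set x | qidx m x = a]).

Lemma qmassE m (a : 'I_(m * 2 ^ m).+1) : nu [set x | qidx m x = a] = (qmass a)%:E.
Proof. by rewrite fineK// fin_num_measure//; exact: measurable_qidx. Qed.

Lemma qmass_ge0 m (a : 'I_(m * 2 ^ m).+1) : 0 <= qmass a.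
Proof. exact: fine_ge0. Qed.

Lemma qmass_sum1 m : \sum_(a : 'I_(m * 2 ^ m).+1) qmass a = 1.
Proof.
apply: EFin_inj; rewrite -sumEFin.
rewrite -(@probability_setT _ _ _ nu).
rewrite (_ : setT = \big[setU/set0]_(a < (m * 2 ^ m).+1) [set x | qidx m x = a]).
  rewrite measure_bigsetU_ord//.
  - by apply: eq_bigr => a _; apply/esym; exact: qmassE.
  - by move=> a; exact: measurable_qidx.
  - by move=> a b _ _ [x [/= <- <-]].
apply/esym; rewrite -subTset => x _; rewrite -bigcup_seq; exists (qidx m x) => //=.
by rewrite mem_index_enum.
Qed.

Definition quantize (s : seq (int * int)) (x : int * int -> R) m w : (int * int) -> R :=
  fun j => if j \in s then quant m (xi j w) else x j.

Definition cylinder (t : seq (int * int)) (B : int * int -> set R) : set Omega :=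
  \big[setI/setT]_(i <- t) (xi i @^-1` B i).

Lemma measurable_cylinder t B : (forall i, measurable (B i)) -> measurable (cylinder t B).
Proof.
move=> mB; apply: bigsetI_measurable => i _; rewrite -[X in measurable X]setTI.
by case: iid => mxi _ _ _; exact: mxi.
Qed.

Lemma cylinder_cons i t B : cylinder (i :: t) B = (xi i @^-1` B i) `&` cylinder t B.
Proof. by rewrite /cylinder big_cons. Qed.

(** The cylinder over [t] is there for the induction on [s]: splitting according to the grid value
    of the first site moves this site from [s] to [t], and mutual independence factors the enlarged
    cylinder. Measurability is carried along because nothing is assumed about [F]. *)
Lemma quantized_law m s t B (F : (int * int -> R) -> bool) x :
  uniq (s ++ t) -> (forall i, measurable (B i)) ->
  measurable ([set w | F (quantize s x m w)] `&` cylinder t B) /\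
  P ([set w | F (quantize s x m w)] `&` cylinder t B) =
  ((avg (@qmass m) (@qval R m) s (fun y => (F y)%:R) x)%:E * P (cylinder t B))%E.
Proof.
elim: s t B x => [|i s IH] t B x.
  move=> _ mB; have -> : [set w | F (quantize [::] x m w)] = if F x then setT else set0.
    have E w : quantize [::] x m w = x by apply/funext.
    by apply/seteqP; split => w /=; rewrite E; case: (F x).
  rewrite /=; case: (F x) => /=; rewrite ?mulr1n ?mulr0n ?setTI ?set0I ?mul1e ?mul0e ?measure0;
    split=> //.
  exact: measurable_cylinder.
rewrite cat_cons cons_uniq => /andP[ist ust] mB.
pose B' (a : 'I_(m * 2 ^ m).+1) := fun j => if j == i then [set x | qidx m x = a] else B j.
have mB' a j : measurable (B' a j).
  by rewrite /B'; case: ifP => // _; exact: measurable_qidx.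
have ust' : uniq (s ++ (i :: t)) by rewrite -[i :: t]cat1s uniq_catCA /= ist ust.
have cB a : cylinder (i :: t) (B' a) = (xi i @^-1` [set x | qidx m x = a]) `&` cylinder t B.
  rewrite cylinder_cons /B' eqxx; congr (_ `&` _).
  rewrite /cylinder !big_seq; apply: eq_bigr => j jt; case: eqP => // ji.
  by move: ist; rewrite mem_cat -ji jt orbT.
have splitE : [set w | F (quantize (i :: s) x m w)] `&` cylinder t B =
    \big[setU/set0]_(a < (m * 2 ^ m).+1)
      ([set w | F (quantize s (upd x i (qval a)) m w)] `&` cylinder (i :: t) (B' a)).
  have qE a w : qidx m (xi i w) = a ->
      quantize (i :: s) x m w = quantize s (upd x i (qval a)) m w.
    move=> <-; apply/funext => j; rewrite /quantize in_cons /upd.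
    by case: eqP => [->|_] //=; case: ifPn.
  apply/seteqP; split => w.
    move=> [/= Fw tw]; rewrite -bigcup_seq; exists (qidx m (xi i w)) => /=.
      by rewrite mem_index_enum.
    by rewrite cB; split => //=; rewrite -qE.
  rewrite -bigcup_seq => -[a _] [/= Fw]; rewrite cB => -[/= qa tw].
  by split => //=; rewrite (qE a).
rewrite splitE; split.
  by apply: bigsetU_measurable => a _; apply: (IH _ _ _ ust' (mB' a)).1.
rewrite measure_bigsetU_ord; last 2 first.
- by move=> a; apply: (IH _ _ _ ust' (mB' a)).1.
- by move=> a b _ _ [w [[_ ]]]; rewrite !cB => -[/= <- _] [_ [/= <- _]].
have Pc : P (cylinder t B) = (fine (P (cylinder t B)))%:E.
  by rewrite fineK// fin_num_measure//; exact: measurable_cylinder.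
rewrite Pc /= /avg1 -EFinM mulr_suml -sumEFin.
apply: eq_bigr => a _.
rewrite (IH _ _ _ ust' (mB' a)).2.
have [mxi lawE _ indep] := iid.
rewrite (_ : cylinder (i :: t) (B' a) = \big[setI/setT]_(j <- i :: t) (xi j @^-1` B' a j))//.
rewrite indep//=; last by move: ust'; rewrite cat_uniq => /and3P[].
rewrite big_cons {1}/B' eqxx lawE; last exact: measurable_qidx.
rewrite qmassE !EFinM -Pc -muleA muleCA; congr (_ * (_ * _))%E.
rewrite [LHS](_ : _ = \prod_(j <- t) P (xi j @^-1` B j))%E.
  by rewrite -indep//; move: ust; rewrite cat_uniq => /and3P[].
rewrite !big_seq; apply: eq_bigr => j jt; rewrite /B'; case: eqP => // ji.
by move: ist; rewrite mem_cat -ji jt orbT.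
Qed.

End FiniteLaw.

(** * Increasing events of finitely many weights, and the limit of fine rounding *)

Section Events.
Context {R : realType} {d : measure_display} {Omega : measurableType d}.
Variables (P : probability Omega R) (xi : (int * int) -> Omega -> R).
Implicit Types (F G : (int * int -> R) -> bool) (S : seq (int * int)).

Definition evset F : set Omega := [set w | F (fun i => xi i w)].

Definition pr F : R := fine (P (evset F)).

Definition measurable_event F := measurable (evset F).

Definition nneg_env (x : int * int -> R) := forall i, 0 <= x i.

(* Increasing events of finitely many weights which, when they occur, still occur after a
   fine enough rounding down of the weights: the inequalities for finite product laws pass
   to the limit on this class. *)
Definition open_event_on S F := [/\ dep S F,
  forall x y, envle x y -> F x -> F y &
  forall x, nneg_env x -> F x -> exists m, F (fun i => quant m (x i))].

Lemma prE F : measurable_event F -> P (evset F) = (pr F)%:E.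
Proof. by move=> mF; rewrite fineK// fin_num_measure. Qed.

Lemma pr_ge0 F : 0 <= pr F.
Proof. exact: fine_ge0. Qed.

Lemma evset_neg F : evset (fun x => ~~ F x) = ~` evset F.
Proof. by apply/seteqP; split => w /= /negP. Qed.

Lemma evset_and F G : evset (fun x => F x && G x) = evset F `&` evset G.
Proof. by apply/seteqP; split => w /= /andP. Qed.

Lemma evset_or F G : evset (fun x => F x || G x) = evset F `|` evset G.
Proof. by apply/seteqP; split => w /= /orP. Qed.

Lemma mev_neg F : measurable_event F -> measurable_event (fun x => ~~ F x).
Proof. by move=> mF; rewrite /measurable_event evset_neg; exact: measurableC. Qed.

Lemma mev_and F G :
  measurable_event F -> measurable_event G -> measurable_event (fun x => F x && G x).
Proof. by move=> mF mG; rewrite /measurable_event evset_and; exact: measurableI. Qed.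

Lemma mev_or F G :
  measurable_event F -> measurable_event G -> measurable_event (fun x => F x || G x).
Proof. by move=> mF mG; rewrite /measurable_event evset_or; exact: measurableU. Qed.

Lemma pr_neg F : measurable_event F -> pr (fun x => ~~ F x) = 1 - pr F.
Proof.
by move=> mF; rewrite /pr evset_neg probability_setC// prE.
Qed.

Lemma eq_pr F G : (forall w, F (fun i => xi i w) = G (fun i => xi i w)) -> pr F = pr G.
Proof.
by move=> FG; rewrite /pr; congr (fine (P _)); apply/seteqP; split => w; rewrite /evset /= FG.
Qed.

Lemma pr_or_disjoint F G :
  measurable_event F -> measurable_event G -> (forall x, F x -> ~~ G x) ->
  pr (fun x => F x || G x) = pr F + pr G.
Proof.
move=> mF mG FG; rewrite /pr evset_or measureU//; last first.
  by apply/seteqP; split => w //= -[Fw Gw]; move: (FG _ Fw); rewrite Gw.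
rewrite fineD ?fin_num_measure//.
Qed.

Hypothesis xi0 : forall i w, 0 <= xi i w.

Lemma le_pr F G :
  measurable_event F -> measurable_event G -> (forall x, nneg_env x -> F x -> G x) -> pr F <= pr G.
Proof.
move=> mF mG FG; rewrite -lee_fin -!prE//; apply: le_measure; rewrite ?inE//.
by move=> w; apply: FG => i.
Qed.

Lemma pr_or_le F G :
  measurable_event F -> measurable_event G -> pr (fun x => F x || G x) <= pr F + pr G.
Proof.
move=> mF mG.
have -> : pr (fun x => F x || G x) = pr (fun x => F x || (~~ F x && G x)).
  by apply: eq_pr => w; case: (F _).
have mFG := mev_and (mev_neg mF) mG.
rewrite pr_or_disjoint//; last by move=> x ->.
by rewrite lerD2l; apply: le_pr => // x _ /andP[].
Qed.

Lemma mev_has (T : Type) (s : seq T) (F : T -> (int * int -> R) -> bool) :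
  (forall a, measurable_event (F a)) -> measurable_event (fun x => has (F^~ x) s).
Proof.
move=> mF; elim: s => [|a s IH] /=; last exact: mev_or.
by rewrite /measurable_event (_ : evset _ = set0)//; apply/seteqP; split.
Qed.

Lemma pr_has_le (T : Type) (s : seq T) (F : T -> (int * int -> R) -> bool) :
  (forall a, measurable_event (F a)) -> pr (fun x => has (F^~ x) s) <= \sum_(a <- s) pr (F a).
Proof.
move=> mF; elim: s => [|a s IH] /=.
  rewrite big_nil /pr (_ : evset _ = set0) ?measure0//; apply/seteqP; split => //.
rewrite big_cons; apply: (le_trans (pr_or_le (mF a) (mev_has s mF))).
by rewrite lerD2l.
Qed.

Lemma dep_sub (T : Type) S S' (F : (int * int -> R) -> T) :
  {subset S <= S'} -> dep S F -> dep S' F.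
Proof. by move=> SS' dF x y xy; apply: dF => i iS; apply: xy; exact: SS'. Qed.

Lemma open_ev_sub S S' F : {subset S <= S'} -> open_event_on S F -> open_event_on S' F.
Proof. by move=> SS' [dF iF oF]; split => //; exact: dep_sub dF. Qed.

Lemma quant_env_mono x m n : nneg_env x -> (m <= n)%N ->
  envle (fun i => quant m (x i)) (fun i => quant n (x i)).
Proof. by move=> x0 mn i; exact: quant_nondecreasing. Qed.

Lemma open_ev_and S F G :
  open_event_on S F -> open_event_on S G -> open_event_on S (fun x => F x && G x).
Proof.
move=> [dF iF oF] [dG iG oG]; split.
- by move=> x y xy; rewrite (dF _ _ xy) (dG _ _ xy).
- by move=> x y xy /andP[/(iF _ _ xy) -> /(iG _ _ xy) ->].
- move=> x x0 /andP[/(oF _ x0)[m Fm] /(oG _ x0)[n Gn]]; exists (maxn m n).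
  apply/andP; split.
    by apply: iF Fm; apply: quant_env_mono => //; exact: leq_maxl.
  by apply: iG Gn; apply: quant_env_mono => //; exact: leq_maxr.
Qed.

Lemma open_ev_or S F G :
  open_event_on S F -> open_event_on S G -> open_event_on S (fun x => F x || G x).
Proof.
move=> [dF iF oF] [dG iG oG]; split.
- by move=> x y xy; rewrite (dF _ _ xy) (dG _ _ xy).
- by move=> x y xy /orP[/(iF _ _ xy) ->//|/(iG _ _ xy) ->]; rewrite orbT.
- move=> x x0 /orP[/(oF _ x0)[m Fm]|/(oG _ x0)[n Gn]]; [exists m|exists n].
    by rewrite Fm.
  by rewrite Gn orbT.
Qed.

Lemma open_ev_false S : open_event_on S (fun=> false).
Proof. by split. Qed.

Lemma open_ev_has S (T : eqType) (s : seq T) (F : T -> (int * int -> R) -> bool) :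
  {in s, forall a, open_event_on S (F a)} -> open_event_on S (fun x => has (F^~ x) s).
Proof.
elim: s => [|a s IH] oF /=; first exact: open_ev_false.
apply: open_ev_or; first by apply: oF; rewrite mem_head.
by apply: IH => b bs; apply: oF; rewrite in_cons bs orbT.
Qed.

Section Law.
Variable nu : probability R R.
Hypothesis iid : iid_law P xi nu.

Lemma quantized_pr m S F : uniq S -> dep S F ->
  measurable [set w | F (fun i => quant m (xi i w))] /\
  P [set w | F (fun i => quant m (xi i w))] =
  (avg (@qmass _ nu m) (@qval R m) S (fun y => (F y)%:R) (fun=> 0))%:E.
Proof.
move=> uS dF.
have [] := @quantized_law _ _ _ _ _ _ iid m S [::] (fun=> setT) F (fun=> 0).
- by rewrite cats0.
- by [].
rewrite /cylinder big_nil setIT probability_setT mule1.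
have E w : F (quantize xi S (fun=> 0) m w) = F (fun i => quant m (xi i w)).
  by apply: dF => i iS; rewrite /quantize iS.
rewrite (_ : [set w | F (quantize xi _ _ _ w)] = [set w | F (fun i => quant m (xi i w))])//.
by apply/seteqP; split => w /=; rewrite E.
Qed.

(** Rounding down can only destroy an increasing event, and the last clause of [open_event_on] says
    that a fine enough rounding keeps it. Measurability and continuity from below both come out of
    this union. *)
Lemma evset_bigcup S F : open_event_on S F ->
  evset F = \bigcup_m [set w | F (fun i => quant m (xi i w))].
Proof.
move=> [_ iF oF]; apply/seteqP; split => w.
  by move=> /= /oF[|m Fm]; [move=> i; exact: xi0|exists m].
by move=> [m _] /=; apply: iF => i; exact: quant_le.
Qed.

Lemma mev_open S F : open_event_on S F -> measurable_event F.
Proof.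
move=> oF; rewrite /measurable_event (evset_bigcup oF); apply: bigcupT_measurable => m.
have [//|dF _ _] := open_ev_sub (S' := undup S) _ oF; first by move=> i; rewrite mem_undup.
by have [] := quantized_pr m (undup_uniq S) dF.
Qed.

Lemma pr_cvg S F : uniq S -> open_event_on S F ->
  avg (@qmass _ nu m) (@qval R m) S (fun y => (F y)%:R) (fun=> 0) @[m --> \oo] --> pr F.
Proof.
move=> uS oF; have [dF iF _] := oF.
have h m := quantized_pr m uS dF.
have cv : P \o (fun m => [set w | F (fun i => quant m (xi i w))]) @ \oo --> P (evset F).
  rewrite (evset_bigcup oF); apply: nondecreasing_cvg_mu.
  - by move=> m; exact: (h m).1.
  - by apply: bigcupT_measurable => m; exact: (h m).1.
  move=> m n mn; apply/subsetPset => w /=; apply: iF.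
  by apply: quant_env_mono => // i; exact: xi0.
rewrite prE in cv; last exact: mev_open oF.
apply: cvg_trans (fine_cvg cv); apply: near_eq_cvg; near=> m => /=.
by rewrite (h m).2.
Unshelve. all: by end_near. Qed.

Lemma pr_harris S F G :
  open_event_on S F -> open_event_on S G ->
  pr F * pr G <= pr (fun x => F x && G x).
Proof.
move=> oF oG; wlog uS : S oF oG / uniq S.
  move=> /(_ (undup S)); apply; last exact: undup_uniq.
    by apply: open_ev_sub oF => i; rewrite mem_undup.
  by apply: open_ev_sub oG => i; rewrite mem_undup.
have cFG := pr_cvg uS (open_ev_and oF oG).
apply: (ler_cvg_to (cvgM (pr_cvg uS oF) (pr_cvg uS oG)) cFG); near=> m => /=.
have [_ iF _] := oF; have [_ iG _] := oG.
apply: le_trans (avg_harris (@qval R m) (qmass_ge0 nu (m := m)) (qmass_sum1 nu m) S _ _ _) _.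
- by move=> x y xy; rewrite ler_nat; case Fx: (F x) => //; rewrite (iF _ _ xy Fx).
- by move=> x y xy; rewrite ler_nat; case Gx: (G x) => //; rewrite (iG _ _ xy Gx).
rewrite le_eqVlt; apply/orP; left; apply/eqP.
by apply: eq_avg => y; case: (F y); case: (G y); rewrite ?mulr0 ?mulr1.
Unshelve. all: by end_near. Qed.

(** By inclusion-exclusion both sides differ from the increasing case by the same amount,
    [1 - pr F - pr G]. *)
Lemma pr_harris_neg S F G :
  open_event_on S F -> open_event_on S G ->
  pr (fun x => ~~ F x) * pr (fun x => ~~ G x) <= pr (fun x => ~~ F x && ~~ G x).
Proof.
move=> oF oG; have h := pr_harris oF oG.
have mF := mev_open oF; have mG := mev_open oG.
have mFG := mev_and mF mG.
rewrite (@eq_pr (fun x => ~~ F x && ~~ G x) (fun x => ~~ (F x || G x))); last first.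
  by move=> w; rewrite negb_or.
have E : pr (fun x => F x || G x) = pr F + (pr G - pr (fun x => F x && G x)).
  have -> : pr (fun x => F x || G x) = pr (fun x => F x || (~~ F x && G x)).
    by apply: eq_pr => w; case: (F _).
  rewrite pr_or_disjoint//; [|exact/mev_and/mG/mev_neg|by move=> x ->].
  congr (_ + _); apply/eqP; rewrite eq_sym subr_eq; apply/eqP.
  rewrite -pr_or_disjoint//; [|exact/mev_and/mG/mev_neg|by move=> x /andP[/negbTE ->]].
  by apply: eq_pr => w; case: (F _); rewrite ?orbF.
by rewrite !pr_neg ?E//; [lra|exact: mev_or].
Qed.

Lemma pr_harris_all S (T : eqType) (s : seq T) (F : T -> (int * int -> R) -> bool) :
  {in s, forall a, open_event_on S (F a)} ->
  \prod_(a <- s) pr (fun x => ~~ F a x) <= pr (fun x => ~~ has (F^~ x) s).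
Proof.
elim: s => [|a s IH] oF.
  rewrite big_nil /pr (_ : evset _ = setT) ?probability_setT//.
  by apply/seteqP; split.
have oFa : open_event_on S (F a) by apply: oF; rewrite mem_head.
have oFs : {in s, forall b, open_event_on S (F b)}.
  by move=> b bs; apply: oF; rewrite in_cons bs orbT.
rewrite big_cons; apply: (@le_trans _ _ (pr (fun x => ~~ F a x) * pr (fun x => ~~ has (F^~ x) s))).
  by rewrite ler_wpM2l ?pr_ge0// IH.
apply: (le_trans (pr_harris_neg oFa (open_ev_has oFs))).
by rewrite le_eqVlt; apply/orP; left; apply/eqP/eq_pr => w; rewrite /= negb_or.
Qed.

Lemma pr_indep S S' F G : open_event_on S F -> open_event_on S' G ->
  {in S, forall i, i \notin S'} -> pr (fun x => F x && G x) = pr F * pr G.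
Proof.
move=> oF oG SS'; wlog [uS uS'] : S S' oF oG SS' / uniq S /\ uniq S'.
  move=> /(_ (undup S) (undup S')); apply; try by split; exact: undup_uniq.
  - by apply: open_ev_sub oF => i; rewrite mem_undup.
  - by apply: open_ev_sub oG => i; rewrite mem_undup.
  - by move=> i; rewrite !mem_undup => /SS'.
have uSS' : uniq (S ++ S').
  by rewrite cat_uniq uS uS' andbT; apply/hasPn => i iS'; apply/negP => /SS'; rewrite iS'.
have oF' : open_event_on (S ++ S') F by apply: open_ev_sub oF => i; rewrite mem_cat => ->.
have oG' : open_event_on (S ++ S') G.
  by apply: open_ev_sub oG => i; rewrite mem_cat => ->; rewrite orbT.
have cFG := pr_cvg uSS' (open_ev_and oF' oG').
have cM := cvgM (pr_cvg uS oF) (pr_cvg uS' oG).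
have [dF _ _] := oF; have [dG _ _] := oG.
have E : (fun m => avg (@qmass _ nu m) (@qval R m) (S ++ S') (fun y => (F y && G y)%:R)
      (fun=> 0)) =
    (fun m => avg (@qmass _ nu m) (@qval R m) S (fun y => (F y)%:R) (fun=> 0) *
      avg (@qmass _ nu m) (@qval R m) S' (fun y => (G y)%:R) (fun=> 0)).
  apply/funext => m; rewrite -[RHS](avg_indep (@qmass _ nu m) (@qval R m)) //.
  - by apply: eq_avg => y; case: (F y); case: (G y); rewrite ?mulr0 ?mulr1.
  - by move=> x y xy; rewrite (dF _ _ xy).
  - by move=> x y xy; rewrite (dG _ _ xy).
rewrite E in cFG; exact: (cvg_unique (@norm_hausdorff _ _) cFG (cM _)).
Qed.

End Law.
End Events.

(** Both probabilities are limits of the same finite averages, which involve [nu] alone. Translation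
    invariance of passage times is obtained by comparing the weights with their shifts. *)
Lemma pr_law (R : realType) d d' (Omega : measurableType d) (Omega' : measurableType d')
    (P : probability Omega R) (P' : probability Omega' R) xi xi' nu S F :
  iid_law P xi nu -> iid_law P' xi' nu ->
  (forall i w, 0 <= xi i w) -> (forall i w, 0 <= xi' i w) ->
  open_event_on S F -> pr P xi F = pr P' xi' F.
Proof.
move=> iid iid' xi0 xi0' oF.
have oF' : open_event_on (undup S) F.
  by apply: (open_ev_sub _ oF) => i; rewrite mem_undup.
have c := pr_cvg xi0 iid (undup_uniq S) oF'.
have c' := pr_cvg xi0' iid' (undup_uniq S) oF'.
exact: (cvg_unique (@norm_hausdorff _ _) c c').
Qed.

(** * Directed paths *)

Section Paths.
Context {R : realType}.
Implicit Types (x : int * int -> R) (u v : int * int) (s : seq bool) (a b : R).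

Definition next u (b : bool) : int * int := if b then (u.1 + 1, u.2) else (u.1, u.2 + 1).

Definition endp u s := foldl next u s.

Fixpoint verts u s := u :: if s is b :: s' then verts (next u b) s' else [::].

Definition pw x u s : R := \sum_(i <- verts u s) x i.

Definition lev u : int := u.1 + u.2.

Definition paths u v :=
  [seq s <- [seq tval t | t <- enum {: (absz (lev v - lev u)).-tuple bool}] | endp u s == v].

(** The event that the passage time from [u] to [v] exceeds [a]. If [v] cannot be reached the list
    is empty and the event is false, in accordance with the value minus infinity. The inequality is
    strict so that the event survives a fine rounding down of the weights. *)
Definition above x u v a := has (fun s => a < pw x u s) (paths u v).

Definition psites u v := flatten [seq verts u s | s <- paths u v].

Lemma pw_cons x u (b : bool) s : pw x u (b :: s) = x u + pw x (next u b) s.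
Proof. by rewrite /pw /= big_cons. Qed.

Lemma pw_nil x u : pw x u [::] = x u.
Proof. by rewrite /pw /= big_seq1. Qed.

Lemma endpE u s : endp u s = (u.1 + (count id s)%:Z, u.2 + (count negb s)%:Z).
Proof.
elim: s u => [|b s IH] u /=; first by rewrite !addr0; case: u.
by rewrite IH; congr pair; case: b => /=; lia.
Qed.

Lemma lev_next u (b : bool) : lev (next u b) = lev u + 1.
Proof. by rewrite /lev /next; case: b => /=; lia. Qed.

Lemma lev_endp u s : lev (endp u s) = lev u + (size s)%:Z.
Proof.
elim: s u => [|b s IH] u /=; first by rewrite addr0.
by rewrite IH lev_next; lia.
Qed.

Lemma endp_cat u s t : endp u (s ++ t) = endp (endp u s) t.
Proof. exact: foldl_cat. Qed.

Lemma mem_paths u v s : (s \in paths u v) = (endp u s == v).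
Proof.
rewrite mem_filter; case: eqP => //= <-.
have sz : size s == absz (lev (endp u s) - lev u) by rewrite lev_endp; lia.
by apply/mapP; exists (Tuple sz); rewrite ?mem_enum.
Qed.

Lemma gtP x u v a : reflect (exists2 s, endp u s = v & a < pw x u s) (above x u v a).
Proof.
apply: (iffP hasP) => -[s].
  by rewrite mem_paths => /eqP sv ?; exists s.
by move=> sv ?; exists s => //; rewrite mem_paths; apply/eqP.
Qed.

Lemma le_gt x u v a b : b <= a -> above x u v a -> above x u v b.
Proof. by move=> ba /gtP[s sv us]; apply/gtP; exists s => //; exact: le_lt_trans us. Qed.

Lemma verts_lev u s i : i \in verts u s -> lev u <= lev i <= lev u + (size s)%:Z.
Proof.
elim: s u => [|b s IH] u /=; first by rewrite inE => /eqP ->; lia.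
rewrite in_cons => /orP[/eqP ->|/IH]; first by lia.
by rewrite lev_next; lia.
Qed.

Lemma size_verts u s : size (verts u s) = (size s).+1.
Proof. by elim: s u => //= b s IH u; rewrite IH. Qed.

Lemma nth_verts u0 u s k : (k <= size s)%N -> nth u0 (verts u s) k = endp u (take k s).
Proof. by elim: s u k => [|b s IH] u [|k] //= ks; rewrite IH. Qed.

Lemma psites_lev u v i : i \in psites u v -> lev u <= lev i <= lev v.
Proof.
move=> /flattenP[l /mapP[s]]; rewrite mem_paths => /eqP <- -> /verts_lev.
by rewrite lev_endp.
Qed.

Lemma open_gt u v a : open_event_on (psites u v) (fun x => above x u v a).
Proof.
split.
- move=> x y xy; apply: eq_in_has => s suv; congr (_ < _).
  rewrite /pw !big_seq; apply: eq_bigr => i si; apply: xy.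
  by apply/flattenP; exists (verts u s) => //; apply: map_f.
- move=> x y xy /gtP[s sv us]; apply/gtP; exists s => //.
  by apply: (lt_le_trans us); apply: ler_sum => i _; exact: xy.
- move=> x x0 /gtP[s sv us].
  suff [m um] : exists m, a < pw (fun i => quant m (x i)) u s.
    by exists m; apply/gtP; exists s.
  rewrite /pw in us *; elim: (verts u s) a us => [|i l IH] b.
    by rewrite big_nil => ?; exists 0; rewrite big_nil.
  rewrite big_cons => bil.
  (* Half of the slack is spent on the first weight and half on the remaining ones; the finer of the
     two roundings serves both. *)
  pose e := (x i + \sum_(j <- l) x j - b) / 2.
  have e0 : 0 < e by rewrite /e; lra.
  have [m hm] := quant_gt (y := x i - e) (x := x i) ltac:(lra) (x0 i).
  have [n hn] := IH (\sum_(j <- l) x j - e) ltac:(lra).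
  exists (maxn m n); rewrite big_cons.
  have h1 : quant m (x i) <= quant (maxn m n) (x i).
    by apply: quant_nondecreasing => //; exact: leq_maxl.
  have h2 : \sum_(j <- l) quant n (x j) <= \sum_(j <- l) quant (maxn m n) (x j).
    by apply: ler_sum => j _; apply: quant_nondecreasing => //; exact: leq_maxr.
  rewrite /e in hm hn; lra.
Qed.

Lemma pw_cat x u s (b : bool) t : pw x u (s ++ b :: t) = pw x u s + pw x (next (endp u s) b) t.
Proof.
elim: s u => [|c s IH] u; first by rewrite /= pw_cons pw_nil.
by rewrite cat_cons !pw_cons IH addrA.
Qed.

Lemma pw_cat_le x u s t : nneg_env x -> pw x u (s ++ t) <= pw x u s + pw x (endp u s) t.
Proof.
move=> x0; case: t => [|b t].
  by rewrite cats0 lerDl pw_nil.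
by rewrite pw_cat pw_cons lerD2l lerDr.
Qed.

(** The second path starts diagonally after the end of the first, so the two pieces live on disjoint
    levels and can be independent. The step right and step up that join them visit one extra vertex,
    whose weight is nonnegative. *)
Lemma gt_concat x u v v' w a b : nneg_env x -> v' = (v.1 + 1, v.2 + 1) ->
  above x u v a -> above x v' w b -> above x u w (a + b).
Proof.
move=> x0 -> /gtP[s sv us] /gtP[t tw vt]; apply/gtP.
exists (s ++ true :: false :: t).
  by rewrite endp_cat sv /= /next.
rewrite pw_cat pw_cons sv /next /=; have := x0 (v.1 + 1, v.2).
by move=> h; rewrite /next /= in h *; lra.
Qed.

(** The cutting vertex is counted in both pieces, which nonnegativity allows. The first piece is
    kept as an explicit path [s] so that a bound on it can be supplied once its endpoint is
    known. *)
Lemma gt_split x u v a : nneg_env x -> above x u v a ->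
  forall n : nat, n%:Z <= lev v - lev u ->
  exists w s, [/\ lev w = lev u + n%:Z, endp u s = w &
    forall b, pw x u s <= b -> above x w v (a - b)].
Proof.
move=> x0 /gtP[s sv us] n nuv; exists (endp u (take n s)), (take n s).
have sz : (n <= size s)%N by move: nuv; rewrite -sv lev_endp; lia.
split => //; first by rewrite lev_endp size_take_min (minn_idPl sz).
move=> b ub; apply/gtP; exists (drop n s).
  by rewrite -endp_cat cat_take_drop.
have := pw_cat_le u (take n s) (drop n s) x0; rewrite cat_take_drop; lra.
Qed.

Definition shift (c : int * int) x : int * int -> R := fun i => x (i.1 + c.1, i.2 + c.2).

Lemma gt_shift x (c u v : int * int) a :
  above x (u.1 + c.1, u.2 + c.2) (v.1 + c.1, v.2 + c.2) a = above (shift c x) u v a.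
Proof.
have endS s w : endp (w.1 + c.1, w.2 + c.2) s = ((endp w s).1 + c.1, (endp w s).2 + c.2).
  by rewrite !endpE /=; congr pair; lia.
have pwS s w : pw x (w.1 + c.1, w.2 + c.2) s = pw (shift c x) w s.
  elim: s w => [|b s IH] w; first by rewrite !pw_nil.
  by rewrite !pw_cons -IH; congr (_ + pw _ _ _); case: b => /=; congr pair; lia.
apply/gtP/gtP => -[s sv us]; exists s => //.
- by move: sv; rewrite endS => -[]/addIr e1 /addIr e2; apply/eqP; rewrite -pair_eqE /= e1 e2 !eqxx.
- by rewrite -pwS.
- by rewrite endS sv.
- by rewrite pwS.
Qed.

End Paths.

(** * Identification of [above] with the maximum over tuples *)

Section LppLink.
Context {R : realType} {d : measure_display} {Omega : measurableType d}.
Variables (xi : (int * int) -> Omega -> R).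

Lemma weightE u n (s : n.-tuple bool) w : weight xi u s w = pw (fun i => xi i w) u s.
Proof.
rewrite /weight /pw (big_nth (0, 0)) size_verts size_tuple big_mkord.
apply: eq_bigr => k _; rewrite nth_verts ?endpE// size_tuple -ltnS.
exact: ltn_ord.
Qed.

Lemma lpp_gt u dx dy w a :
  (a < lpp xi u dx dy w) = above (fun i => xi i w) u (u.1 + dx%:Z, u.2 + dy%:Z) a.
Proof.
set s0 := cat_tuple (nseq_tuple dx true) (nseq_tuple dy false).
have cs0 : count id s0 == dx.
  by rewrite /= count_cat !count_nseq mul1n mul0n addn0.
have lppE : lpp xi u dx dy w =
    \big[Num.max/weight xi u s0 w]_(s <- enum [pred s : (dx + dy).-tuple bool | count id s == dx])
      weight xi u s w.
  by rewrite /lpp big_enum.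
have ltmax (I : Type) (r : seq I) (f : I -> R) c :
    (a < \big[Num.max/c]_(i <- r) f i) = (a < c) || has (fun i => a < f i) r.
  elim: r => [|i r IH]; first by rewrite big_nil orbF.
  by rewrite big_cons lt_max IH /= orbCA.
rewrite lppE ltmax; apply/idP/gtP.
  move=> h.
  have [t ct at_] : exists2 t : (dx + dy).-tuple bool, count id t == dx & a < weight xi u t w.
    case/orP: h => [h|/hasP[t]]; first by exists s0.
    by rewrite mem_enum => ct; exists t.
  exists t; last by rewrite -weightE.
  rewrite endpE (eqP ct); congr (_, _ + Posz _).
  have := count_predC id t; rewrite size_tuple (eqP ct) => /addnI cdy.
  by rewrite -[RHS]cdy; apply: eq_count.
move=> [s]; rewrite endpE => -[/addrI [c1] /addrI [c2]] us.
have sz : size s == (dx + dy)%N.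
  by rewrite -(count_predC id s) c1 -c2; apply/eqP; congr (_ + _)%N; apply: eq_count.
apply/orP; right; apply/hasP; exists (Tuple sz); first by rewrite mem_enum inE /= c1.
by rewrite weightE.
Qed.

End LppLink.

(** * Mean and lower tail *)

(** Telescoping: [1 / (y + 1) ^ 2 <= 1 / y - 1 / (y + 1)]. *)
Lemma sum_inv_sq (R : realType) (M N : nat) : (0 < M)%N ->
  \sum_(M.+1 <= n < N) (n%:R ^+ 2)^-1 <= (M%:R^-1 : R).
Proof.
move=> M0; have [NM|MN] := leqP N M.+1.
  by rewrite big_geq// invr_ge0.
suff h k : (0 < k)%N -> \sum_(M.+1 <= n < M.+1 + k) (n%:R ^+ 2)^-1 <= M%:R^-1 - (M + k)%:R^-1 :> R.
  rewrite -(subnKC (ltnW MN)); apply: (le_trans (h _ _)); first by rewrite subn_gt0.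
  by rewrite gerBl invr_ge0.
elim: k => // k IH _.
have MR : (0 : R) < M%:R by rewrite ltr0n.
rewrite addnS big_nat_recr ?leq_addr//=.
have step : ((M.+1 + k)%:R ^+ 2)^-1 <= (M + k)%:R^-1 - (M + k.+1)%:R^-1 :> R.
  rewrite addnS addSn -natr1; have : (0 : R) < (M + k)%:R by rewrite natrD ltr_wpDr.
  move: (M + k)%:R => y y0.
  rewrite -subr_ge0 (_ : _ - _ = (y * (y + 1) ^+ 2)^-1).
    by rewrite invr_ge0 mulr_ge0 ?exprn_ge0 ?addr_ge0 ?ltW.
  by field; apply/andP; split; apply: lt0r_neq0; lra.
case: k IH step => [|k] IH step.
  by rewrite big_geq ?addn0// add0r; move: step; rewrite !addn0.
have := IH isT; lra.
Qed.

Section MeanLower.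
Context {R : realType} {d : measure_display} {Omega : measurableType d}.
Variables (P : probability Omega R) (f : Omega -> R) (e c D t0 : R).
Hypotheses (mf : measurable_fun setT f) (f0 : forall w, 0 <= f w).
Hypothesis fe : (\int[P]_w (f w)%:E)%E = e%:E.
Hypotheses (c0 : 0 < c) (D0 : 0 <= D).
Hypothesis tail : forall t, t0 < t -> fine (P [set w | f w <= e - t * c]) <= D / t ^+ 2.

Let mle (b : R) : measurable [set w | f w <= b].
Proof.
rewrite (_ : [set w | _] = setT `&` f @^-1` `]-oo, b]); first exact: mf.
by rewrite setTI; apply/seteqP; split=> w; rewrite /= in_itv.
Qed.

(** If [f] were above [e + a * c] with probability too close to 1, its mean could equal [e] only
    through a heavy lower tail. Quantitatively, [e + a * c <= f + g] pointwise, where [g] counts the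
    levels below the mean that [f] misses; integrating, the layers beyond [M] contribute at most
    [c * a / 2], and the rest must come from the event itself. *)
Lemma mean_lower (a : R) (M : nat) : 0 < a -> (0 < M)%N -> t0 < M%:R ->
  D / M%:R <= a / 2 ->
  (a / 2) / (a + M.+1%:R) <= fine (P [set w | f w <= e + a * c]).
Proof.
move=> a0 M0 tM DM.
have e0 : 0 <= e by rewrite -lee_fin -fe; apply: integral_ge0 => w _; rewrite lee_fin.
(* Since [0 <= f], no layer below [e - N * c <= 0] is ever reached, so finitely many layers
   suffice. *)
pose N := maxn M.+1 (Num.truncn (e / c)).+1.
have eN : e <= N%:R * c.
  rewrite -ler_pdivrMr//; apply/ltW/(lt_le_trans (truncnS_gt _)).
  by rewrite ler_nat leq_maxr.
pose B n := [set w | f w <= e - n%:R * c].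
pose A := [set w | f w <= e + a * c].
pose h (k : R) (S : set Omega) w : R := k * \1_S w.
have h0 k S w : 0 <= k -> 0 <= h k S w by move=> k0; rewrite mulr_ge0.
have mh k S : measurable S -> measurable_fun setT (h k S).
  by move=> mS; apply: measurable_funM => //; exact: measurable_indic.
have intk k S : 0 <= k -> measurable S -> (\int[P]_w (h k S w)%:E = (k * fine (P S))%:E)%E.
  move=> k0 mS; under eq_integral do rewrite EFinM.
  rewrite ge0_integralZl_EFin//; last by apply/measurable_EFinP; exact: measurable_indic.
  by rewrite integral_indic// setIT EFinM fineK// fin_num_measure.
have c1 : 0 <= (a + M.+1%:R) * c by rewrite mulr_ge0 ?addr_ge0// ltW.
(* On [A] the first term lifts [f] from [e - M.+1 * c] to [e + a * c]; every deeper level that [f]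
   misses adds one more [c]. *)
pose g w := h ((a + M.+1%:R) * c) A w + \sum_(M.+1 <= n < N) h c (B n) w.
have sB0 w : 0 <= \sum_(M.+1 <= n < N) h c (B n) w.
  by apply: sumr_ge0 => n _; apply: h0; exact: ltW.
have msB : measurable_fun setT (fun w => \sum_(M.+1 <= n < N) h c (B n) w).
  by apply: measurable_sum => n; exact/mh/mle.
have mg : measurable_fun setT g by apply: measurable_funD => //; exact/mh/mle.
have g0 w : 0 <= g w by rewrite addr_ge0// h0.
have intg : (\int[P]_w (g w)%:E =
    ((a + M.+1%:R) * c * fine (P A) + \sum_(M.+1 <= n < N) c * fine (P (B n)))%:E)%E.
  under eq_integral do rewrite EFinD.
  rewrite ge0_integralD//; first last.
  - exact/measurable_EFinP.
  - by move=> w _; rewrite lee_fin.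
  - by apply/measurable_EFinP; exact/mh/mle.
  - by move=> w _; rewrite lee_fin h0.
  rewrite (intk _ _ c1 (mle _)) EFinD; congr (_ + _)%E.
  under eq_integral do rewrite -sumEFin.
  rewrite ge0_integral_sum//; first last.
  - by move=> n w _; rewrite lee_fin h0// ltW.
  - by move=> n; apply/measurable_EFinP; exact/mh/mle.
  by rewrite -sumEFin; apply: eq_bigr => n _; exact: (intk _ _ (ltW c0) (mle _)).
have key w : e + a * c <= f w + g w.
  have [hf|hf] := leP (f w) (e + a * c); last by rewrite (le_trans (ltW hf))// lerDl.
  have hE (S : set Omega) : S w -> h c S w = c.
    by move=> Sw; rewrite /h indicE mem_set// mulr1.
  suff ind k : e - (M.+1 + k)%:R * c <= f w ->
      e - M.+1%:R * c <= f w + \sum_(M.+1 <= n < M.+1 + k) h c (B n) w.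
    have h1 : e - N%:R * c <= f w by apply: le_trans (f0 w); rewrite subr_le0.
    have := ind (N - M.+1)%N; rewrite subnKC ?leq_maxl// => /(_ h1).
    have -> : g w = (a + M.+1%:R) * c + \sum_(M.+1 <= n < N) h c (B n) w.
      by rewrite /g {1}/h indicE mem_set// mulr1.
    lra.
  elim: k => [|k IH]; first by rewrite addn0 big_geq// addr0.
  rewrite addnS big_nat_recr ?leq_addr//=.
  have [/IH h1 _|hk hk'] := leP (e - (M.+1 + k)%:R * c) (f w).
    by have := h0 c (B (M.+1 + k)%N) w (ltW c0); lra.
  rewrite hE; last exact: ltW.
  rewrite (eq_big_nat _ _ (F2 := fun=> c)); last first.
    move=> n /andP[_ nk]; apply: hE; apply: (le_trans (ltW hk)).
    by rewrite lerD2l lerN2 ler_pM2r// ler_nat ltnW.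
  rewrite sumr_const_nat addKn -[c *+ k]mulr_natl.
  by move: hk'; rewrite -natr1 natrD !mulrDl mul1r; lra.
have : (\int[P]_w (e + a * c)%:E <= \int[P]_w ((f w)%:E + (g w)%:E))%E.
  apply: ge0_le_integral => //.
  - by move=> w _; rewrite lee_fin addr_ge0// mulr_ge0// ltW.
  - by apply: emeasurable_funD; exact/measurable_EFinP.
  - by move=> w _; rewrite -EFinD lee_fin.
rewrite ge0_integralD//; first last.
- exact/measurable_EFinP.
- by move=> w _; rewrite lee_fin.
- exact/measurable_EFinP.
- by move=> w _; rewrite lee_fin.
rewrite intg fe integral_cst// [X in (_ * X)%E](_ : _ = 1%E); last exact: probability_setT.
rewrite mule1 -EFinD lee_fin lerD2l.
have sumB : \sum_(M.+1 <= n < N) c * fine (P (B n)) <= c * (a / 2).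
  rewrite -mulr_sumr ler_pM2l//.
  apply: (@le_trans _ _ (D * \sum_(M.+1 <= n < N) (n%:R ^+ 2)^-1)).
    rewrite mulr_sumr !big_nat; apply: ler_sum => n /andP[Mn _].
    by apply: tail; apply: (lt_trans tM); rewrite ltr_nat.
  by apply: le_trans DM; rewrite ler_wpM2l//; exact: sum_inv_sq.
move=> H; rewrite ler_pdivrMr ?ltr_wpDr// mulrC -(ler_pM2r c0).
rewrite mulrAC; move: H sumB; rewrite /A; lra.
Qed.
End MeanLower.

(** * Point-to-point passage times *)

Section CubeRoot.
Context {R : realType}.
Implicit Types x y : R.

Lemma cube_root_ge0 x : 0 <= cube_root x.
Proof. exact: powR_ge0. Qed.

Lemma cube_rootK x : 0 <= x -> cube_root x ^+ 3 = x.
Proof.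
by move=> x0; rewrite /cube_root -powR_mulrn ?powR_ge0// -powRrM mulVf ?powRr1 ?pnatr_eq0.
Qed.

Lemma cube_root_le x y : 0 <= x -> 0 <= y -> x <= y ^+ 3 -> cube_root x <= y.
Proof.
move=> x0 y0 xy; rewrite -(@ler_pXn2r _ 3) ?nnegrE ?cube_root_ge0//.
by rewrite cube_rootK.
Qed.

Lemma cube_root_ge x y : 0 <= x -> 0 <= y -> y ^+ 3 <= x -> y <= cube_root x.
Proof.
move=> x0 y0 xy; rewrite -(@ler_pXn2r _ 3) ?nnegrE ?cube_root_ge0//.
by rewrite cube_rootK.
Qed.

Lemma cube_root_gt0 x : 0 < x -> 0 < cube_root x.
Proof. exact: powR_gt0. Qed.

End CubeRoot.

(** With [Z * n] in the role of z^2, a displacement 2z over length [u * n] costs 4Gz^2/(un), while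
    its final part of length [(u - 1) * n] and displacement z costs only about Gz^2/((u-1)n). For
    [u > 2] more than Gz^2/(un) is left, and the excess pays for the quartic error because [Z <= n]
    and [8 * H <= G * u]. *)
Lemma parabola_gap (R : realFieldType) (G H u Z n : R) :
  0 < G -> 0 < H -> 2 < u -> 8 * H <= G * u -> 0 < n -> 0 <= Z -> Z <= n ->
  G / u * (Z * n) / n + G * (Z * n) / ((u - 1) * n) +
    H * (Z * n) ^+ 2 / ((u - 1) * n) ^+ 3 <= G * (4 * (Z * n)) / (u * n).
Proof.
move=> G0 H0 u2 uG n0 Z0 Zle; have u0 : 0 < u by lra.
have u1 : 0 < u - 1 by lra.
have p0 : 0 < u * (u - 1) ^+ 3 by rewrite mulr_gt0// exprn_gt0.
rewrite -subr_ge0.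
have -> : G * (4 * (Z * n)) / (u * n) - (G / u * (Z * n) / n +
     G * (Z * n) / ((u - 1) * n) + H * (Z * n) ^+ 2 / ((u - 1) * n) ^+ 3) =
   Z / n * ((n * G * (2 * u - 3) * (u - 1) ^+ 2 - H * Z * u) / (u * (u - 1) ^+ 3)).
  by field; rewrite !gt_eqF.
rewrite mulr_ge0 ?divr_ge0 ?(ltW n0)//; last exact: ltW.
rewrite subr_ge0; apply: (@le_trans _ _ (H * n * u)).
  by rewrite ler_pM2r// ler_pM2l.
have -> : H * n * u = n * (H * u) by ring.
rewrite -!mulrA ler_pM2l//.
have k1 : 8 * (H * u) <= G * (u * u) by rewrite !mulrA ler_pM2r.
have k2 : G * (u * u) <= G * (8 * ((2 * u - 3) * (u - 1) ^+ 2)).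
  rewrite ler_pM2l//; have : 0 <= (u - 2) ^+ 2 * u by rewrite mulr_ge0 ?sqr_ge0// ltW.
  nra.
lra.
Qed.

Section Model.
Context {R : realType} {d : measure_display} {Omega : measurableType d}.
Variables (P : probability Omega R) (xi : (int * int) -> Omega -> R).

Definition tailp n (z : int) a := pr P xi (fun x => above x (1, 1) (n%:Z - z, n%:Z + z) a).

(** Working form of the assumptions: weights nonnegative at every sample point, means given by a
    real function [e], both tails weakened to [D / t ^+ 2], and in [lb_med] a uniform positive
    probability of lying below the mean plus a small multiple of the fluctuation scale. *)
Record lpp_bounds (nu : probability R R) (mu rho G H g1 g2 D t0 : R) (n0 : nat)
    (e : nat -> int -> R) : Prop := LppBounds {
  lb_iid : iid_law P xi nu;
  lb_ge0 : forall i w, 0 <= xi i w;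
  lb_rho : 0 < rho < 1;
  lb_G : 0 < G; lb_H : 0 < H; lb_g1 : 0 < g1; lb_g2 : 0 < g2; lb_D : 0 < D; lb_t0 : 0 < t0;
  lb_mean_lo : forall n (z : int), (n0 < n)%N -> `|z%:~R| <= rho * n%:R ->
    mu * n%:R - G * z%:~R ^+ 2 / n%:R - H * z%:~R ^+ 4 / n%:R ^+ 3 - g1 * cube_root n%:R <= e n z;
  lb_mean_up : forall n (z : int), (n0 < n)%N -> `|z%:~R| <= rho * n%:R ->
    e n z <= mu * n%:R - G * z%:~R ^+ 2 / n%:R - g2 * cube_root n%:R;
  lb_up : forall n (z : int) t, (n0 < n)%N -> `|z%:~R| <= rho * n%:R -> t0 < t ->
    tailp n z (e n z + t * cube_root n%:R) <= D / t ^+ 2;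
  lb_lo : forall n (z : int) t, (n0 < n)%N -> `|z%:~R| <= rho * n%:R -> t0 < t ->
    1 - tailp n z (e n z - t * cube_root n%:R) <= D / t ^+ 2;
  lb_med : forall a, 0 < a -> exists2 delta, 0 < delta &
    forall n (z : int), (n0 < n)%N -> `|z%:~R| <= rho * n%:R ->
      delta <= 1 - tailp n z (e n z + a * cube_root n%:R) }.

(** * Translation invariance and upper tails for all slopes *)

Section Consequences.
Variables (nu : probability R R) (mu rho G H g1 g2 D t0 : R) (n0 : nat)
  (e : nat -> int -> R).
Hypothesis B : lpp_bounds nu mu rho G H g1 g2 D t0 n0 e.

Lemma iid_shift c : iid_law P (fun i => xi (i.1 + c.1, i.2 + c.2)) nu.
Proof.
have [mxi law supp indep] := lb_iid B.
split => [i|i A mA||s A us mA]; [exact: mxi|exact: law|by []|].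
pose f (i : int * int) : int * int := (i.1 + c.1, i.2 + c.2).
pose g (i : int * int) : int * int := (i.1 - c.1, i.2 - c.2).
have fK : cancel f g by move=> [a b]; rewrite /f /g /= !addrK.
have := indep [seq f i | i <- s] (fun i => A (g i)).
rewrite (map_inj_uniq (can_inj fK)) => /(_ us (fun i => mA _)).
rewrite !big_map; under eq_bigr do rewrite fK.
by under [in RHS]eq_bigr do rewrite fK.
Qed.

Lemma pr_gt_shift c u v a :
  pr P xi (fun x => above x (u.1 + c.1, u.2 + c.2) (v.1 + c.1, v.2 + c.2) a) =
  pr P xi (fun x => above x u v a).
Proof.
transitivity (pr P (fun i => xi (i.1 + c.1, i.2 + c.2)) (fun x => above x u v a)).
  by rewrite /pr /evset; congr (fine (P _)); apply/seteqP; split => w /=; rewrite gt_shift.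
apply: (pr_law (iid_shift c) (lb_iid B) _ (lb_ge0 B) (open_gt u v a)) => i w.
exact: (lb_ge0 B).
Qed.

Lemma mev_gt u v a : measurable_event xi (fun x => above x u v a).
Proof. exact: (mev_open (lb_ge0 B) (lb_iid B) (open_gt u v a)). Qed.

Lemma tailp_le n z a b : b <= a -> tailp n z a <= tailp n z b.
Proof.
move=> ba; apply: (le_pr P (lb_ge0 B)) => [||x _]; try exact: mev_gt.
exact: le_gt.
Qed.

(** A large first piece forces a large total unless the continuation is too small; a union bound
    suffices, without independence. *)
Lemma tailp_concat n m (z y : int) a b :
  tailp n z a <= tailp (n + m) (z + y) (a + b) + (1 - tailp m y b).
Proof.
have x0 := lb_ge0 B.
set F2 := fun x : int * int -> R => above x (n%:Z - z + 1, n%:Z + z + 1)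
  ((n + m)%N%:Z - (z + y), (n + m)%N%:Z + (z + y)) b.
have E : pr P xi F2 = tailp m y b.
  rewrite -[RHS](pr_gt_shift (n%:Z - z, n%:Z + z)); apply: eq_pr => w /=.
  rewrite /F2 /=; congr above; congr pair; lia.
have mF2 : measurable_event xi F2 by exact: mev_gt.
rewrite -E -pr_neg//.
apply: le_trans (pr_or_le P x0 (mev_gt _ _ _) (mev_neg mF2)).
apply: le_pr => //; [exact: mev_gt|exact/mev_or/mev_neg/mF2/mev_gt|].
move=> x nx h; case h2: (F2 x) => /=; rewrite ?orbT// orbF.
exact: gt_concat nx _ h h2.
Qed.

(** For steep [z] the path is continued over a length [m] with the same displacement, chosen so long
    that both the continuation and the whole path fall in the range of (LS). An excess of the first
    piece then becomes an excess of the whole path or a deficit of the continuation, and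
    [parabola_gap] leaves a parabola with coefficient [G / N]. *)
Lemma upper_tail_all_slopes : exists cU D1 t1, [/\ 0 < cU, 0 < D1, 0 < t1 &
  forall n (z : int) t, (n0 < n)%N -> `|z%:~R| <= n%:R :> R -> t1 < t ->
    tailp n z (mu * n%:R - cU * z%:~R ^+ 2 / n%:R + t * cube_root n%:R) <= D1 / t ^+ 2].
Proof.
have /andP[rho0 rho1] := lb_rho B; have G0 := lb_G B; have H0 := lb_H B.
have g10 := lb_g1 B; have D0 := lb_D B; have t00 := lb_t0 B.
(* The term [2 / rho] brings the total displacement, at most [2 * n], below [rho * N * n]; the term
   [8 * H / G] absorbs the quartic error; the final 2 gives [2 < N]. *)
pose N := ((Num.truncn (2 / rho + 8 * H / G)).+1 + 2)%N.
have Ngt : 2 / rho + 8 * H / G + 2 < N%:R.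
  by rewrite /N natrD ltrD2r; exact: truncnS_gt.
have h1 : 0 < 2 / rho by rewrite divr_gt0.
have h2 : 0 < 8 * H / G by rewrite divr_gt0 ?mulr_gt0.
have N2 : 2 < N%:R :> R by lra.
have Nrho : 2 < rho * N%:R by rewrite mulrC -ltr_pdivrMr//; lra.
have NG : 8 * H <= G * N%:R by rewrite [leRHS]mulrC -ler_pdivrMr//; lra.
exists (G / N%:R), (32 * N%:R ^+ 2 * D), (2 * g1 * N%:R + 4 * N%:R * t0).
have N0 : 0 < N%:R :> R by lra.
split.
- by rewrite divr_gt0.
- by rewrite !mulr_gt0 ?exprn_gt0.
- by rewrite addr_gt0 ?mulr_gt0.
move=> n z t nn0 zn tt1.
have n1 : (0 < n)%N by apply: leq_ltn_trans nn0.
have nR : 0 < n%:R :> R by rewrite ltr0n.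
pose m := (N.-1 * n)%N.
have mE : m%:R = (N%:R - 1) * n%:R :> R
  by rewrite natrM; congr (_ * _); rewrite -[in RHS]natr1 addrK.
have nmE : (n + m)%:R = N%:R * n%:R :> R by rewrite natrD mE; ring.
(* Both cube roots are at most [N * n^(1/3)], so the two tail deviations use up half of [t]; the
   other half covers the error [g1] of the mean. *)
pose t' := t / (4 * N%:R).
have tE : t = t' * (4 * N%:R) by rewrite /t' divfK// gt_eqF// mulr_gt0.
have t't0 : t0 < t'.
  rewrite /t' ltr_pdivlMr ?mulr_gt0//; have : 0 < 2 * g1 * N%:R by rewrite !mulr_gt0.
  lra.
have nm0 : (n0 < m)%N by apply: (leq_trans nn0); rewrite /m leq_pmull// /N addn2.
have nnm0 : (n0 < n + m)%N by apply: (leq_trans nn0); rewrite leq_addr.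
have zm : `|z%:~R| <= rho * m%:R.
  by apply: (le_trans zn); rewrite mE mulrA ler_peMl ?ltW//; lra.
have zz : `|(z + z)%:~R| <= rho * (n + m)%:R.
  rewrite intrD; apply: (le_trans (ler_normD _ _)); rewrite nmE mulrA.
  have : 2 * n%:R <= rho * N%:R * n%:R by rewrite ler_pM2r// ltW.
  by move: zn; lra.
apply: (le_trans (tailp_concat n m z z _ (e m z - t' * cube_root m%:R))).
have lo := lb_lo B nm0 zm t't0.
have up := lb_up B nnm0 zz t't0.
have : D / t' ^+ 2 + D / t' ^+ 2 = 32 * N%:R ^+ 2 * D / t ^+ 2.
  rewrite tE; field; rewrite !gt_eqF//; lra.
move=> <-; apply: lerD => //; apply: le_trans up; apply: tailp_le.
have ml := lb_mean_lo B nm0 zm; have mu_ := lb_mean_up B nnm0 zz.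
set y := cube_root n%:R.
have y0 : 0 < y by exact: cube_root_gt0.
have yn : y ^+ 3 = n%:R by rewrite cube_rootK// ltW.
have NN : N%:R <= N%:R ^+ 3 :> R.
  have N1 : 1 <= N%:R :> R by lra.
  by rewrite exprS ler_peMr ?exprn_ege1//; lra.
have cnm : cube_root (n + m)%:R <= N%:R * y.
  apply: cube_root_le => //; first by rewrite mulr_ge0// ltW.
  by rewrite nmE exprMn yn ler_pM2r.
have cm : cube_root m%:R <= N%:R * y.
  apply: cube_root_le => //; first by rewrite mulr_ge0// ltW.
  rewrite mE exprMn yn ler_pM2r//; lra.
have q0 : 0 <= g2 * cube_root (n + m)%:R by rewrite mulr_ge0 ?cube_root_ge0 ?(ltW (lb_g2 B)).
have c1 : t' * cube_root (n + m)%:R <= t' * (N%:R * y) by rewrite ler_pM2l//; lra.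
have c2 : t' * cube_root m%:R <= t' * (N%:R * y) by rewrite ler_pM2l//; lra.
have c3 : g1 * cube_root m%:R <= g1 * (N%:R * y) by rewrite ler_pM2l//; lra.
have c4 : 2 * (g1 * (N%:R * y)) <= t * y.
  rewrite !mulrA ler_pM2r//; have : 0 < 4 * N%:R * t0 by rewrite !mulr_gt0.
  lra.
have c5 : t * y = 4 * (t' * (N%:R * y)) by rewrite tE; ring.
pose Z : R := z%:~R ^+ 2 / n%:R.
have Z0 : 0 <= Z by rewrite divr_ge0 ?sqr_ge0// ltW.
have Zn : Z * n%:R = z%:~R ^+ 2 by rewrite /Z divfK// gt_eqF.
have Zle : Z <= n%:R.
  by rewrite /Z ler_pdivrMr// -expr2 -[leLHS]real_normK ?num_real// lerXn2r ?nnegrE// ltW.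
have par : G / N%:R * z%:~R ^+ 2 / n%:R + G * z%:~R ^+ 2 / m%:R + H * z%:~R ^+ 4 / m%:R ^+ 3
    <= G * (z + z)%:~R ^+ 2 / (n + m)%:R.
  have z4 : z%:~R ^+ 4 = (Z * n%:R) ^+ 2 by rewrite Zn -exprM.
  rewrite nmE mE intrD z4.
  have -> : (z%:~R + z%:~R) ^+ 2 = 4 * (Z * n%:R) by rewrite Zn; ring.
  rewrite -[z%:~R ^+ 2]Zn.
  exact: parabola_gap.
have muE : mu * (n + m)%:R = mu * n%:R + mu * m%:R by rewrite natrD mulrDr.
move: ml mu_ par; rewrite muE.
move: (G / N%:R * z%:~R ^+ 2 / n%:R) (G * z%:~R ^+ 2 / m%:R) (H * z%:~R ^+ 4 / m%:R ^+ 3).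
move: (G * (z + z)%:~R ^+ 2 / (n + m)%:R) => p4 p1 p2 p3.
lra.
Qed.

End Consequences.
End Model.

(** * Backing up *)

(** Antidiagonal coordinates: [i] is the level and [z] the transverse offset. The origin [pt 0 0] is
    (1,1), so [X_r^z] runs from [pt 0 0] to [pt (r - 1) z]; this is the source of the shifts by one
    below. *)
Definition pt (i z : int) : int * int := (1 + i - z, 1 + i + z).

Lemma pt_next i z : pt (i + 1) z = ((pt i z).1 + 1, (pt i z).2 + 1).
Proof. by rewrite /pt /=; congr pair; lia. Qed.

Lemma back_step (i : int) (L : nat) : (0 < L)%N -> i - L%:Z + L.-1%:Z + 1 = i.
Proof. by lia. Qed.

Lemma backing_level (i : int) (s L : nat) : (0 < L)%N ->
  i - L%:Z + (s + L + L)%N%:Z = i + s%:Z + 1 + L.-1%:Z.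
Proof. by lia. Qed.

Definition cell_pairs (w : nat) : seq (nat * nat) := [seq (k, k') | k <- iota 0 w, k' <- iota 0 w].

Definition cellgt {R : realType} (i : int) (s w : nat) (c : int * int) (a : R)
    (x : int * int -> R) : bool :=
  has (fun k : nat * nat =>
    above x (pt i (w%:Z * c.1 + k.1%:Z)) (pt (i + s%:Z) (w%:Z * c.2 + k.2%:Z)) a) (cell_pairs w).

Lemma mem_cell_pairs w k k' : ((k, k') \in cell_pairs w) = (k < w)%N && (k' < w)%N.
Proof.
apply/allpairsP/andP => [[[a b] /= [+ + [-> ->]]]|[kw kw']].
  by rewrite !mem_iota.
by exists (k, k'); rewrite !mem_iota.
Qed.

Section FirstHit.
Context {R : realType} {d : measure_display} {Omega : measurableType d}.
Variables (P : probability Omega R) (xi : (int * int) -> Omega -> R) (nu : probability R R).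
Hypotheses (xi0 : forall i w, 0 <= xi i w) (iid : iid_law P xi nu).

Lemma pr_sub_and F G : measurable_event xi F -> measurable_event xi G ->
  pr P xi (fun x => F x && ~~ G x) = pr P xi F - pr P xi (fun x => F x && G x).
Proof.
move=> mF mG; apply/eqP; rewrite eq_sym subr_eq; apply/eqP.
rewrite -pr_or_disjoint; [|exact/mev_and/mev_neg|exact: mev_and|].
  by apply: eq_pr => w; case: (F _); case: (G _).
by move=> x; case: (F x); case: (G x).
Qed.

(* Conditioning on the first index for which [M] holds decouples [L] from the
   (random) choice of that index. *)
Lemma pr_first_hit (I : eqType) (l : seq I) (M L : I -> (int * int -> R) -> bool)
    S S' (kappa : R) :
  {in l, forall i, open_event_on S (M i)} -> {in l, forall i, open_event_on S' (L i)} ->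
  {in S, forall i, i \notin S'} -> {in l, forall i, kappa <= pr P xi (L i)} ->
  kappa * pr P xi (fun x => has (M^~ x) l) <=
  pr P xi (fun x => has (fun i => M i x && L i x) l).
Proof.
move=> oM oL SS'; elim: l oM oL => [|i l IH] oM oL kL.
  rewrite /= [X in _ * X](_ : _ = 0) ?mulr0 ?pr_ge0//.
  by rewrite /pr (_ : evset _ _ = set0) ?measure0//; apply/seteqP; split.
have oMi : open_event_on S (M i) by apply: oM; rewrite mem_head.
have oLi : open_event_on S' (L i) by apply: oL; rewrite mem_head.
have oMl : {in l, forall j, open_event_on S (M j)}.
  by move=> j jl; apply: oM; rewrite in_cons jl orbT.
have oLl : {in l, forall j, open_event_on S' (L j)}.
  by move=> j jl; apply: oL; rewrite in_cons jl orbT.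
have IHl : kappa * pr P xi (fun x => has (M^~ x) l) <=
    pr P xi (fun x => has (fun i => M i x && L i x) l).
  by apply: IH => // j jl; apply: kL; rewrite in_cons jl orbT.
pose U x := has (M^~ x) l.
have oU : open_event_on S U by exact: open_ev_has.
have mU := mev_open xi0 iid oU; have mM := mev_open xi0 iid oMi.
have mL := mev_open xi0 iid oLi.
have mG : measurable_event xi (fun x => has (fun i => M i x && L i x) l).
  have SU j : open_event_on S j -> open_event_on (S ++ S') j.
    by apply: open_ev_sub => k; rewrite mem_cat => ->.
  have SU' j : open_event_on S' j -> open_event_on (S ++ S') j.
    by apply: open_ev_sub => k; rewrite mem_cat => ->; rewrite orbT.
  apply: (mev_open (S := S ++ S') xi0 iid); apply: open_ev_has => j jl.
  by apply: open_ev_and; [exact/SU/oMl|exact/SU'/oLl].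
have mMU : measurable_event xi (fun x => M i x && ~~ U x) by exact/mev_and/mev_neg.
have mMUL : measurable_event xi (fun x => (M i x && ~~ U x) && L i x) by exact: mev_and.
(* The event [M i && ~~ U] is not increasing, but its probability is a difference of probabilities
   of increasing events supported on [S], each independent of [L i]. *)
have ind : pr P xi (fun x => (M i x && ~~ U x) && L i x) =
    pr P xi (fun x => M i x && ~~ U x) * pr P xi (L i).
  rewrite (pr_sub_and mM mU) mulrBl -(pr_indep xi0 iid oMi oLi SS').
  rewrite -(pr_indep xi0 iid (open_ev_and oMi oU) oLi SS').
  rewrite -[X in _ - X](@eq_pr _ _ _ _ _ (fun x => (M i x && L i x) && U x)); last first.
    by move=> w; rewrite /= -!andbA; congr (_ && _); exact: andbC.
  rewrite -(pr_sub_and (mev_and mM mL) mU).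
  by apply: eq_pr => w; rewrite -!andbA; congr (_ && _); exact: andbC.
have split_has : pr P xi (fun x => has (M^~ x) (i :: l)) =
    pr P xi U + pr P xi (fun x => M i x && ~~ U x).
  rewrite -pr_or_disjoint//; last by move=> x /= Ux; rewrite Ux andbF.
  by apply: eq_pr => w; rewrite /= -/(U _) orbC; case: (U _) => /=; rewrite ?andbT// orbF.
rewrite split_has mulrDr.
apply: (@le_trans _ _ (pr P xi (fun x => has (fun i => M i x && L i x) l) +
    pr P xi (fun x => (M i x && ~~ U x) && L i x))).
  rewrite lerD// ind mulrC ler_wpM2l ?pr_ge0//.
  by apply: kL; rewrite mem_head.
rewrite -pr_or_disjoint//.
  apply: (le_pr P xi0) => [|/=|x _ /orP[gx|/andP[/andP[Mx _] Lx]]]; first exact: mev_or.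
  - by apply: mev_or => //; exact: mev_and.
  - by rewrite /= gx orbT.
  - by rewrite /= Mx Lx.
move=> x /hasP[j jl /andP[Mj _]]; apply/negP => /andP[/andP[_ /negP]]; case.
by apply/hasP; exists j.
Qed.

End FirstHit.

Section Backing.
Context {R : realType} {d : measure_display} {Omega : measurableType d}.
Variables (P : probability Omega R) (xi : (int * int) -> Omega -> R).
Variables (nu : probability R R) (mu rho G H g1 g2 D t0 : R) (n0 : nat)
  (e : nat -> int -> R).
Hypothesis B : lpp_bounds P xi nu mu rho G H g1 g2 D t0 n0 e.

(** At length of order [b ^+ 3] and displacement at most [b ^+ 2], the quadratic, quartic and
    cube-root corrections to the mean are all O(b): they contribute the terms [2 * G], [8 * H] and
    [g1] of [K1]. *)
Lemma lower_tail_diag : exists2 K1, 0 < K1 & forall n (z : int) t b, (n0 < n)%N ->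
  1 <= b -> 2 / rho <= b -> n%:R <= b ^+ 3 -> b ^+ 3 <= 2 * n%:R -> `|z%:~R| <= b ^+ 2 ->
  t0 < t -> 1 - tailp P xi n z (mu * n%:R - (K1 + t) * b) <= D / t ^+ 2.
Proof.
have /andP[rho0 rho1] := lb_rho B; have G0 := lb_G B; have H0 := lb_H B.
have g10 := lb_g1 B; have D0 := lb_D B; have t00 := lb_t0 B.
exists (2 * G + 8 * H + g1); first by lra.
move=> n z t b nn0 b1 brho nb bn zb tt0.
have b0 : 0 < b by lra.
have nR : 0 < n%:R :> R by rewrite ltr0n; apply: leq_ltn_trans nn0.
have zn : `|z%:~R| <= rho * n%:R.
  apply: (le_trans zb); rewrite -ler_pdivrMl//.
  have : 2 / rho * b ^+ 2 <= b * b ^+ 2 by rewrite ler_pM2r// exprn_gt0.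
  rewrite -exprS => h; have : 2 * (rho^-1 * b ^+ 2) <= 2 * n%:R by rewrite mulrA (le_trans h).
  by rewrite ler_pM2l.
apply: le_trans (lb_lo B nn0 zn tt0); rewrite lerD2l lerN2.
apply: (tailp_le B); have ml := lb_mean_lo B nn0 zn.
have cb : cube_root n%:R <= b by apply: cube_root_le; lra.
have c1 : g1 * cube_root n%:R <= g1 * b by rewrite ler_pM2l.
have c2 : t * cube_root n%:R <= t * b by rewrite ler_pM2l//; lra.
have z2 : z%:~R ^+ 2 <= b ^+ 4.
  rewrite -[leLHS]real_normK ?num_real// (exprM b 2 2).
  by rewrite lerXn2r ?nnegrE// ?sqr_ge0.
have c3 : G * z%:~R ^+ 2 / n%:R <= 2 * G * b.
  rewrite ler_pdivrMr// (_ : 2 * G * b * n%:R = G * (b * (2 * n%:R))); last by ring.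
  by rewrite ler_pM2l//; apply: (le_trans z2); rewrite exprS ler_pM2l.
have z4 : z%:~R ^+ 4 <= b ^+ 8.
  rewrite (exprM _ 2 2) (exprM b 4 2).
  by rewrite lerXn2r ?nnegrE// ?sqr_ge0// exprn_ge0// ltW.
have c4 : H * z%:~R ^+ 4 / n%:R ^+ 3 <= 8 * H * b.
  rewrite ler_pdivrMr ?exprn_gt0// (_ : 8 * H * b * n%:R ^+ 3 = H * (b * (2 * n%:R) ^+ 3)).
    rewrite ler_pM2l//; apply: (le_trans z4).
    apply: (@le_trans _ _ (1 * (b ^+ 3) ^+ 3)).
      by rewrite mul1r -exprM ler_weXn2l.
    apply: ler_pM => //; first by rewrite exprn_ge0// exprn_ge0// ltW.
    by rewrite lerXn2r ?nnegrE ?exprn_ge0 ?mulr_ge0// ltW.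
  by ring.
lra.
Qed.

Lemma pr_gt_pt (i z z' : int) (m : nat) a :
  pr P xi (fun x => above x (pt i z) (pt (i + m%:Z) z') a) = tailp P xi m.+1 (z' - z) a.
Proof.
rewrite -[RHS](pr_gt_shift B (i - z, i + z)); apply: eq_pr => w.
by rewrite /pt /=; congr above; congr pair; lia.
Qed.

(** Whatever pair of points of the two cells realizes the large passage time, it is extended
    backwards and forwards to the fixed corners of these cells, [L] levels away. The extensions use
    levels outside those of the middle part, so [pr_first_hit] decouples them, and each succeeds
    with probability at least [1 - beta]. What remains is a union over the cell pairs [K], not over
    the points inside the cells. *)
Lemma backing (i : int) (s w L : nat) (K : seq (int * int)) (a : int * int -> R) (b beta : R) :
  (0 < L)%N -> 0 <= beta <= 1 ->
  (forall k : nat, (k < w)%N -> 1 - tailp P xi L k%:Z b <= beta) ->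
  (forall k : nat, (k < w)%N -> 1 - tailp P xi L (- k%:Z) b <= beta) ->
  (1 - beta) ^+ 2 * pr P xi (fun x => has (fun c => cellgt i s w c (a c) x) K) <=
  \sum_(c <- K) tailp P xi (s + L + L).+1 (w%:Z * (c.2 - c.1)) (b + a c + b).
Proof.
move=> L0 /andP[beta0 beta1] left right; have x0 := lb_ge0 B; have iid := lb_iid B.
pose I := ((int * int) * (nat * nat))%type.
pose l : seq I := [seq (c, k) | c <- K, k <- cell_pairs w].
pose u (q : I) := w%:Z * q.1.1 + q.2.1%:Z; pose v (q : I) := w%:Z * q.1.2 + q.2.2%:Z.
pose M (q : I) x := above x (pt i (u q)) (pt (i + s%:Z) (v q)) (a q.1).
pose L1 (q : I) x := above x (pt (i - L%:Z) (w%:Z * q.1.1)) (pt (i - L%:Z + L.-1%:Z) (u q)) b.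
pose L2 (q : I) x :=
  above x (pt (i + s%:Z + 1) (v q)) (pt (i + s%:Z + 1 + L.-1%:Z) (w%:Z * q.1.2)) b.
pose S := flatten [seq psites (pt i (u q)) (pt (i + s%:Z) (v q)) | q <- l].
pose S' := flatten [seq psites (pt (i - L%:Z) (w%:Z * q.1.1)) (pt (i - L%:Z + L.-1%:Z) (u q)) ++
  psites (pt (i + s%:Z + 1) (v q)) (pt (i + s%:Z + 1 + L.-1%:Z) (w%:Z * q.1.2)) | q <- l].
have lP q : q \in l -> (q.2.1 < w)%N && (q.2.2 < w)%N.
  by move=> /allpairsP[[c [k k']] /= [_ + ->]]; rewrite mem_cell_pairs.
have oM : {in l, forall q, open_event_on S (M q)}.
  move=> q ql; apply: open_ev_sub (open_gt _ _ _) => j js.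
  by apply/flattenP; exists (psites (pt i (u q)) (pt (i + s%:Z) (v q))) => //; exact: map_f.
have oL1 : {in l, forall q, open_event_on S' (L1 q)}.
  move=> q ql; apply: open_ev_sub (open_gt _ _ _) => j js.
  apply/flattenP; eexists; first by apply/mapP; exists q.
  by rewrite mem_cat js.
have oL2 : {in l, forall q, open_event_on S' (L2 q)}.
  move=> q ql; apply: open_ev_sub (open_gt _ _ _) => j js.
  apply/flattenP; eexists; first by apply/mapP; exists q.
  by rewrite mem_cat js orbT.
have SS' : {in S, forall j, j \notin S'}.
  move=> j /flattenP[_ /mapP[q _ ->]] /psites_lev jq; apply/negP.
  move=> /flattenP[_ /mapP[q' _ ->]]; rewrite mem_cat => /orP[] /psites_lev.
    by move: jq; rewrite /lev /pt /=; lia.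
  by move: jq; rewrite /lev /pt /=; lia.
have hit := pr_first_hit x0 iid (L := fun q x => L1 q x && L2 q x) (kappa := (1 - beta) ^+ 2)
  oM _ SS' _.
have {}hit : (1 - beta) ^+ 2 * pr P xi (fun x => has (M^~ x) l) <=
    pr P xi (fun x => has (fun q => M q x && (L1 q x && L2 q x)) l).
  apply: hit => [q ql|q ql]; first by apply: open_ev_and; [exact: oL1|exact: oL2].
  have /andP[kw kw'] := lP q ql.
  apply: le_trans (pr_harris x0 iid (oL1 q ql) (oL2 q ql)).
  rewrite /L1 /L2 !pr_gt_pt prednK// expr2.
  have -> : u q - w%:Z * q.1.1 = q.2.1%:Z by rewrite /u addrAC subrr add0r.
  have -> : w%:Z * q.1.2 - v q = - q.2.2%:Z by rewrite /v opprD addrA subrr add0r.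
  have := left _ kw; have := right _ kw' => h1 h2.
  by apply: ler_pM; lra.
have cellE x : has (fun c => cellgt i s w c (a c) x) K = has (M^~ x) l.
  apply/hasP/hasP => [[c cK /hasP[k kw ck]]|[q /allpairsP[[c k] /= [cK kw ->]] Mq]].
    by exists (c, k) => //; apply/allpairsP; exists (c, k).
  by exists c => //; apply/hasP; exists k.
rewrite (eq_pr _ (G := fun x => has (M^~ x) l)); last by move=> ?; exact: cellE.
apply: (le_trans hit).
pose Q (c : int * int) x := above x (pt (i - L%:Z) (w%:Z * c.1))
  (pt (i - L%:Z + (s + L + L)%N%:Z) (w%:Z * c.2)) (b + a c + b).
have -> : \sum_(c <- K) tailp P xi (s + L + L).+1 (w%:Z * (c.2 - c.1)) (b + a c + b) =
    \sum_(c <- K) pr P xi (Q c).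
  by apply: eq_bigr => c _; rewrite /Q pr_gt_pt mulrBr.
apply: (le_trans _ (pr_has_le P x0 K (F := Q) _)); last by move=> c; exact: mev_gt B _ _ _.
have oMS q : q \in l -> open_event_on (S ++ S') (fun x => M q x && (L1 q x && L2 q x)).
  move=> ql; apply: open_ev_and.
    by apply: open_ev_sub (oM q ql) => j; rewrite mem_cat => ->.
  apply: open_ev_and.
    by apply: open_ev_sub (oL1 q ql) => j; rewrite mem_cat => ->; rewrite orbT.
  by apply: open_ev_sub (oL2 q ql) => j; rewrite mem_cat => ->; rewrite orbT.
apply: (le_pr P x0).
- exact: (mev_open x0 iid (open_ev_has oMS)).
- by apply: mev_has => c; exact: mev_gt B _ _ _.
move=> x nx /hasP[q ql /andP[Mq /andP[L1q L2q]]].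
have /allpairsP[[c k] /= [cK _ qE]] := ql; apply/hasP; exists c => //.
rewrite /Q; move: Mq L1q L2q; rewrite /M /L1 /L2 qE /= => Mq L1q L2q.
have -> : pt (i - L%:Z + (s + L + L)%N%:Z) (w%:Z * c.2) =
    pt (i + s%:Z + 1 + L.-1%:Z) (w%:Z * c.2) by congr pt; rewrite backing_level.
apply: (gt_concat nx _ _ L2q); last apply: (gt_concat nx _ L1q Mq).
  exact: pt_next.
by rewrite -pt_next back_step.
Qed.

End Backing.

(** * Passage times between cells *)

Lemma sum_subseq_le (R : realDomainType) (T : eqType) (l r : seq T) (f : T -> R) :
  (forall a, 0 <= f a) -> uniq l -> uniq r -> {subset l <= r} ->
  \sum_(a <- l) f a <= \sum_(a <- r) f a.
Proof.
move=> f0 ul ur lr.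
have pl : perm_eq l [seq a <- r | a \in l].
  apply: uniq_perm => //; first exact: filter_uniq.
  by move=> a; rewrite mem_filter; case al: (a \in l) => //; rewrite lr.
rewrite (perm_big _ pl) big_filter [leRHS](bigID (mem l))/= lerDl.
by apply: sumr_ge0.
Qed.

(** Each sign contributes at most 1 + 1/2 + 1, the last term bounding the tail from 2 on. *)
Lemma sum_inv_succ_sq (R : realType) (l : seq int) : uniq l ->
  \sum_(j <- l) (1 + (j%:~R : R) ^+ 2)^-1 <= 6.
Proof.
move=> ul.
pose f (n : nat) : R := (1 + n%:R ^+ 2)^-1.
have f0 n : 0 <= f n by rewrite invr_ge0 addr_ge0 ?sqr_ge0.
have bound (r : seq nat) : uniq r -> \sum_(n <- r) f n <= 3.
  move=> ur; pose N := (\max_(n <- r) n).+1.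
  apply: (@le_trans _ _ (\sum_(n <- iota 0 (2 + N)) f n)).
    apply: sum_subseq_le => //; first exact: iota_uniq.
    move=> n nr; rewrite mem_iota /= add0n /N ltnS ltnW// ltnW// ltnS.
    exact: leq_bigmax_seq.
  rewrite big_cons big_cons.
  have -> : f 0 + (f 1 + \sum_(j <- iota 2 N) f j) = 1 + (1 / 2 + \sum_(2 <= j < 2 + N) f j).
    by rewrite /index_iota addKn /f expr0n /= addr0 invr1 expr1n div1r.
  suff : \sum_(2 <= j < 2 + N) f j <= 1 by lra.
  apply: le_trans (_ : _ <= 1%:R^-1) _; last by rewrite invr1.
  apply: le_trans (sum_inv_sq R (2 + N) (isT : (0 < 1)%N)).
  rewrite !big_nat; apply: ler_sum => n /andP[n2 _].
  have n0 : 0 < n%:R ^+ 2 :> R by rewrite exprn_gt0// ltr0n; apply: leq_trans n2.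
  by rewrite /f lef_pV2 ?posrE ?addr_gt0// lerDr.
rewrite (bigID (fun j : int => 0 <= j)) /=.
have part (p : pred int) : {in p &, injective absz} ->
    \sum_(j <- l | p j) (1 + (j%:~R : R) ^+ 2)^-1 <= 3.
  move=> pinj; rewrite -big_filter.
  have -> : \sum_(j <- [seq j <- l | p j]) (1 + (j%:~R : R) ^+ 2)^-1 =
      \sum_(n <- [seq absz j | j <- [seq j <- l | p j]]) f n.
    rewrite big_map; apply: eq_bigr => j _; rewrite /f; congr (1 + _)^-1.
    by rewrite natr_absz intr_norm real_normK ?num_real.
  apply: bound; rewrite map_inj_in_uniq ?filter_uniq//.
  by move=> a b; rewrite !mem_filter => /andP[pa _] /andP[pb _]; exact: pinj.
rewrite (_ : 6 = 3 + 3); last by ring.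
by apply: lerD; apply: part => a b; rewrite /in_mem /=; lia.
Qed.

Lemma backing_length (s L w n0 : nat) : (0 < L)%N -> (n0 < L)%N -> (w <= 2 * L)%N -> (L <= s)%N ->
  [/\ (s <= (s + L + L).+1)%N, ((s + L + L).+1 <= 4 * s)%N, (n0 < (s + L + L).+1)%N &
    (s + w <= (s + L + L).+1)%N].
Proof. by move=> *; split; lia. Qed.

Section ParabolaTerm.
Context {R : realFieldType}.
Variables (A k cU y s z2 t : R).
Hypotheses (A0 : 0 < A) (cU0 : 0 < cU) (y1 : 1 <= y) (ys : y ^+ 3 = s) (z20 : 0 <= z2).
Hypothesis tE : t = (A + cU / 8 * (z2 / s / y)) / 2.

Let y0 : 0 < y. Proof. exact: lt_le_trans y1. Qed.
Let s0 : 0 < s. Proof. by rewrite -ys exprn_gt0. Qed.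
Let q0 : 0 <= cU / 8 * (z2 / s / y).
Proof. by rewrite mulr_ge0 ?divr_ge0 ?(ltW cU0) ?(ltW s0) ?(ltW y0). Qed.

Lemma parabola_term_ge : A / 2 <= t.
Proof. by rewrite tE ler_pM2r ?invr_gt0// lerDl. Qed.

(** As [n <= 4 * s], the upper tail bound offers the parabola [cU * z2 / (4 * s)]. One half of it is
    kept in the conclusion; the other half is spent on raising the deviation [t], which therefore
    grows with the displacement. *)
Lemma parabola_threshold mu n cn K : 0 < n -> n <= 4 * s -> cn <= 2 * y ->
  mu * n - cU * z2 / n + t * cn <=
  mu * n - mu + (mu * s + (A + `|mu| + K) * y - cU / 8 * z2 / s - mu * s) - K * y.
Proof.
move=> n0 n4 cn2.
have t0 : 0 <= t by apply: le_trans parabola_term_ge; rewrite divr_ge0// ltW.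
have c1 : t * cn <= t * (2 * y) by exact: ler_wpM2l.
have c2 : t * (2 * y) = A * y + cU / 8 * z2 / s by rewrite tE; field; rewrite !gt_eqF.
have c3 : cU / 4 * z2 / s <= cU * z2 / n.
  rewrite (_ : cU / 4 * z2 / s = cU * z2 * (4 * s)^-1).
    by apply: ler_wpM2l; [rewrite mulr_ge0// ltW|rewrite lef_pV2 ?posrE ?mulr_gt0].
  by field; rewrite gt_eqF.
have c4 : mu <= `|mu| * y by apply: (le_trans (ler_norm _)); rewrite ler_peMr.
have c5 : cU / 4 * z2 / s = 2 * (cU / 8 * z2 / s) by field; rewrite gt_eqF.
by move: c1 c2 c3 c4; rewrite c5; move: (cU / 8 * z2 / s) (cU * z2 / n) => p q; lra.
Qed.

(** In the product [(2 * t) * (2 * t)] one factor is bounded below by [A] and the other by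
    [k * (1 + j2)], which is summable decay in the displacement with a constant that is small for
    large [A]. *)
Lemma parabola_tail D j2 : 0 < D -> 0 < k -> k <= A -> 0 <= j2 ->
  k * j2 <= cU / 8 * (z2 / s / y) -> D / t ^+ 2 <= 4 * D / (A * k) * (1 + j2)^-1.
Proof.
move=> D0 k0 kA j20 kj.
have j0 : 0 < 1 + j2 by rewrite ltr_pwDl.
have tge : A + k * j2 <= 2 * t by rewrite tE [leRHS]mulrC divfK ?lerD2l// pnatr_eq0.
have kj0 : 0 <= k * j2 by rewrite mulr_ge0// ltW.
have t0 : 0 < t by apply: lt_le_trans parabola_term_ge; rewrite divr_gt0.
have Akj : A * (k * (1 + j2)) <= 4 * t ^+ 2.
  have -> : 4 * t ^+ 2 = (2 * t) * (2 * t) by ring.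
  apply: ler_pM; [exact: ltW|by apply: mulr_ge0; exact: ltW|by rewrite (le_trans _ tge)// lerDl|].
  by apply: le_trans tge; rewrite mulrDr mulr1 lerD2r.
rewrite ler_pdivrMr ?exprn_gt0//.
have -> : 4 * D / (A * k) * (1 + j2)^-1 * t ^+ 2 = D *
    (4 * t ^+ 2 / (A * (k * (1 + j2)))) by field; rewrite !gt_eqF.
by rewrite ler_peMr ?(ltW D0)// ler_pdivlMr ?mul1r// !mulr_gt0.
Qed.

End ParabolaTerm.

Lemma probability_gap (R : realFieldType) (dl beta p : R) : 0 < dl -> dl <= 1 / 2 ->
  0 <= beta -> beta <= dl / 4 -> 0 <= p -> (1 - beta) ^+ 2 * p <= 1 - dl -> p <= 1 - dl / 2.
Proof.
move=> dl0 dl1 b0 b1 p0 hp; rewrite leNgt; apply/negP => pd.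
have b2 : (1 - dl / 4) ^+ 2 <= (1 - beta) ^+ 2 by rewrite lerXn2r ?nnegrE; lra.
have h1 : (1 - dl / 4) ^+ 2 * p <= 1 - dl by apply: le_trans hp; rewrite ler_wpM2r.
have h2 : 0 < (1 - dl / 4) ^+ 2 by rewrite exprn_gt0//; lra.
have : (1 - dl / 4) ^+ 2 * (1 - dl / 2) < (1 - dl / 4) ^+ 2 * p by rewrite ltr_pM2l.
nra.
Qed.

Lemma half_bound (R : realFieldType) (beta p : R) : 0 <= beta -> beta <= 1 / 4 -> 0 <= p ->
  (1 - beta) ^+ 2 * p <= 1 / 4 -> p <= 1 / 2.
Proof.
move=> b0 b1 p0 hp.
have b2 : (3 / 4) ^+ 2 <= (1 - beta) ^+ 2 by rewrite lerXn2r ?nnegrE; lra.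
have : (3 / 4) ^+ 2 * p <= 1 / 4 by apply: le_trans hp; rewrite ler_wpM2r.
lra.
Qed.

Lemma le_of_sum3 (R : realDomainType) (a b c x : R) : 0 <= a -> 0 <= b -> 0 <= c ->
  a + b + c <= x -> [/\ a <= x, b <= x & c <= x].
Proof. by move=> *; split; lra. Qed.

Section Cells.
Context {R : realType} {d : measure_display} {Omega : measurableType d}.
Variables (P : probability Omega R) (xi : (int * int) -> Omega -> R).
Variables (nu : probability R R) (mu rho G H g1 g2 D t0 : R) (n0 : nat)
  (e : nat -> int -> R).
Hypothesis B : lpp_bounds P xi nu mu rho G H g1 g2 D t0 n0 e.

(** With b = eps s^(1/3), cells of width about b^2 go with connecting stretches of length about b^3:
    this is the scale on which a displacement across a cell costs O(b). *)
Definition width (eps : R) (s : nat) : nat := Num.truncn ((eps * cube_root s%:R) ^+ 2).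

Lemma le_width eps s : (width eps s)%:R <= (eps * cube_root s%:R) ^+ 2.
Proof. by rewrite truncn_le sqr_ge0. Qed.

Lemma width_ge eps s : 2 <= eps * cube_root s%:R ->
  (eps * cube_root s%:R) ^+ 2 <= 2 * (width eps s)%:R.
Proof.
set b := eps * _ => b2; have := truncnS_gt (b ^+ 2); rewrite -/(width eps s).
have : 2 * 2 <= b ^+ 2 by rewrite expr2 ler_pM//; lra.
by rewrite -natr1; lra.
Qed.

Lemma backing_scale eps s : 0 < eps -> eps <= 1 -> 2 <= eps * cube_root s%:R ->
  n0%:R + 2 <= eps * cube_root s%:R ->
  exists L : nat, [/\ (0 < L)%N, (n0 < L)%N, L%:R <= (eps * cube_root s%:R) ^+ 3,
    (eps * cube_root s%:R) ^+ 3 <= 2 * L%:R & (width eps s <= 2 * L)%N /\ (L <= s)%N].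
Proof.
move=> eps0 eps1; set b := eps * _ => b2 bn.
have bs : b ^+ 3 <= s%:R.
  rewrite /b exprMn cube_rootK// ler_piMl// exprn_ile1// ltW//.
have b1 : 1 <= b by lra.
have bb : b <= b ^+ 3 by rewrite exprS ler_peMr ?exprn_ege1//; lra.
have bb2 : b ^+ 2 <= b ^+ 3 by rewrite [leRHS]exprS ler_peMl ?sqr_ge0.
exists (Num.truncn (b ^+ 3)); have := truncnS_gt (b ^+ 3).
have b30 : 0 <= b ^+ 3 by lra.
have Lle : (Num.truncn (b ^+ 3))%:R <= b ^+ 3 by rewrite truncn_le.
move: (Num.truncn _) Lle => L Lle; rewrite -natr1 => Lgt.
have Ln : (n0 < L)%N by rewrite -(ltr_nat R); lra.
have bL : b ^+ 3 <= 2 * L%:R by lra.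
split => //; first exact: leq_ltn_trans Ln.
split; rewrite -(ler_nat R) ?natrM; last lra.
by apply: (le_trans (le_width _ _)); rewrite -/b; lra.
Qed.

(** The connections lose at most [2 * (K1 + M) * eps * s^(1/3)], a small fraction of the fluctuation
    scale when [eps] is small, while [M] alone governs their success probability. The isolated
    [- mu] corrects for [n] being one more than [s + L + L]. *)
Lemma backing_estimate : exists2 K1, 0 < K1 &
  forall (eps M : R) (i : int) (s : nat) (K : seq (int * int)) (a : int * int -> R),
  0 < eps -> eps <= 1 -> t0 < M -> D / M ^+ 2 <= 1 ->
  2 <= eps * cube_root s%:R -> n0%:R + 2 <= eps * cube_root s%:R ->
  2 / rho <= eps * cube_root s%:R ->
  exists n : nat, [/\ (s <= n)%N, n%:R <= 4 * s%:R :> R, (n0 < n)%N, (s + width eps s <= n)%N &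
  (1 - D / M ^+ 2) ^+ 2 *
    pr P xi (fun x => has (fun c => cellgt i s (width eps s) c (a c) x) K) <=
  \sum_(c <- K) tailp P xi n ((width eps s)%:Z * (c.2 - c.1))
    (mu * n%:R - mu + (a c - mu * s%:R) - 2 * (K1 + M) * (eps * cube_root s%:R))].
Proof.
have [K1 K10 lo] := lower_tail_diag B; exists K1 => //.
move=> eps M i s K a eps0 eps1 tM DM b2 bn brho.
have [L [L0 nL Lb bL [wL Ls]]] := backing_scale eps0 eps1 b2 bn.
set b := eps * _ in b2 bn brho Lb bL *.
have s1 : (0 < s)%N by apply: leq_trans Ls.
have [h1 h2 h3 h4] := backing_length L0 nL wL Ls.
exists (s + L + L).+1; split => //; first by rewrite -natrM ler_nat.
have DM0 : 0 <= D / M ^+ 2 by rewrite divr_ge0 ?sqr_ge0// ltW// (lb_D B).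
have tail k : (k < width eps s)%N -> `|k%:R| <= b ^+ 2.
  move=> kw; rewrite normr_nat (le_trans _ (le_width eps s))// ler_nat ltnW//.
have le1 k : (k < width eps s)%N -> 1 - tailp P xi L k%:Z (mu * L%:R - (K1 + M) * b) <= D / M ^+ 2.
  by move=> /tail kb; apply: lo => //; lra.
have le2 k : (k < width eps s)%N ->
    1 - tailp P xi L (- k%:Z) (mu * L%:R - (K1 + M) * b) <= D / M ^+ 2.
  by move=> /tail kb; apply: lo => //; [lra|rewrite mulrNz normrN].
have := @backing _ _ _ P xi _ _ _ _ _ _ _ _ _ _ _ B i s (width eps s) L K a
  (mu * L%:R - (K1 + M) * b) (D / M ^+ 2) L0 _ le1 le2.
rewrite DM0 DM => /(_ isT) h; apply: (le_trans h).
apply: ler_sum => c _; apply: (tailp_le B).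
by rewrite -[(s + L + L).+1%:R]natr1 !natrD !mulrDr; lra.
Qed.

(** A union bound over cell pairs with distinct displacements: the deviation allowed at displacement
    index j grows like 1 + j^2, so the tails sum to a small number once [A] is large. Distinctness
    covers both uses, a common starting cell and a common final cell. *)
Lemma cell_parabola (eps : R) : 0 < eps -> eps <= 1 -> exists A kap Y : R, [/\ 0 < A, 0 < kap &
  forall (i : int) (s : nat) (K : seq (int * int)),
  Y <= cube_root s%:R -> uniq [seq c.2 - c.1 | c <- K] ->
  {in K, forall c : int * int,
    (absz ((width eps s)%:Z * (c.2 - c.1))%R <= s + width eps s)%N} ->
  pr P xi (fun x => has (fun c => cellgt i s (width eps s) c
    (mu * s%:R + A * cube_root s%:R
      - kap * ((width eps s)%:Z * (c.2 - c.1))%:~R ^+ 2 / s%:R) x) K) <= 1 / 2].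
Proof.
move=> eps0 eps1; have [K1 K10 back] := backing_estimate.
have [cU [D1 [t1 [cU0 D10 t10 upper]]]] := upper_tail_all_slopes B.
have /andP[rho0 rho1] := lb_rho B; have D0 := lb_D B; have t00 := lb_t0 B.
pose M := t0 + 1 + 4 * D.
have tM : t0 < M by rewrite /M; lra.
have M0 : 0 < M ^+ 2 by rewrite exprn_gt0//; lra.
have DM : D / M ^+ 2 <= 1 / 4.
  rewrite ler_pdivrMr//; apply: (@le_trans _ _ (1 / 4 * M)); first by rewrite /M; lra.
  by rewrite ler_pM2l ?expr2 ?ler_peMl ?divr_gt0//; rewrite /M; lra.
have DM1 : D / M ^+ 2 <= 1 by lra.
(* A cell has width at least [(eps * y) ^+ 2 / 2], so z^2 is at least [eps ^+ 4 * y ^+ 4 / 4] times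
   the squared cell displacement. *)
pose k := cU * eps ^+ 4 / 32.
have k0 : 0 < k by rewrite divr_gt0// mulr_gt0// exprn_gt0.
(* The first term keeps the deviation above [t1], the second gives [k <= A'], and the third brings
   the union bound [6 * (4 * D1 / (A' * k))] below 1/4. *)
pose A' := 2 * t1 + k + 96 * D1 / k.
have kD : 0 < 96 * D1 / k by rewrite divr_gt0// mulr_gt0.
have A'0 : 0 < A' by rewrite /A'; lra.
have A't1 : t1 < A' / 2 by rewrite /A'; lra.
have kA' : k <= A' by rewrite /A'; lra.
have A'96 : 96 * D1 <= A' * k by rewrite -ler_pdivrMr// /A'; lra.
have KM : 0 < 2 * (K1 + M) * eps by rewrite mulr_gt0// mulr_gt0//; lra.
exists (A' + `|mu| + 2 * (K1 + M) * eps), (cU / 8), ((2 + (n0%:R + 2) + 2 / rho) / eps + 1).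
split; [by have := normr_ge0 mu; lra|by rewrite divr_gt0|].
move=> i s K; set y := cube_root s%:R => yY uK sK.
have r0 : 0 < 2 / rho by rewrite divr_gt0.
have n00 : 0 <= n0%:R :> R by [].
have Y0 : 0 <= (2 + (n0%:R + 2) + 2 / rho) / eps by rewrite divr_ge0 ?(ltW eps0)//; lra.
have ey : 2 + (n0%:R + 2) + 2 / rho <= eps * y by rewrite -ler_pdivrMl// mulrC; lra.
have y1 : 1 <= y by lra.
have y0 : 0 < y := lt_le_trans ltr01 y1.
set a := fun c : int * int => mu * s%:R + (A' + `|mu| + 2 * (K1 + M) * eps) * y -
   cU / 8 * ((width eps s)%:Z * (c.2 - c.1))%:~R ^+ 2 / s%:R.
have [b2' bn bro] := le_of_sum3 (ler0n _ 2) (addr_ge0 n00 (ler0n _ 2)) (ltW r0) ey.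
have [n [sn n4 nn0 swn]] := back eps M i s K a eps0 eps1 tM DM1 b2' bn bro.
set b := eps * _; set p := pr _ _ _ => bk.
have b0 : 2 <= b by [].
have ys : y ^+ 3 = s%:R by rewrite cube_rootK.
have s0 : 0 < s%:R :> R by rewrite -ys exprn_gt0.
have n00' : 0 < n%:R :> R by apply: (lt_le_trans s0); rewrite ler_nat.
have term c : c \in K -> tailp P xi n ((width eps s)%:Z * (c.2 - c.1))
     (mu * n%:R - mu + (a c - mu * s%:R) - 2 * (K1 + M) * b) <=
     4 * D1 / (A' * k) * (1 + (c.2 - c.1)%:~R ^+ 2)^-1.
  move=> cK; have := sK c cK; rewrite /a; move: (c.2 - c.1) => j.
  set z := (width eps s)%:Z * j => zsw.
  pose t := (A' + cU / 8 * (z%:~R ^+ 2 / s%:R / y)) / 2.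
  have tt1 : t1 < t by apply: (lt_le_trans A't1); exact: (parabola_term_ge cU0 y1 ys (sqr_ge0 _) (erefl t)).
  have zn : `|z%:~R| <= n%:R :> R.
    by rewrite -intr_norm -natr_absz ler_nat (leq_trans zsw).
  apply: le_trans (_ : D1 / t ^+ 2 <= _).
    apply: le_trans (upper n z t nn0 zn tt1); apply: (tailp_le B).
    have cn : cube_root n%:R <= 2 * y.
      apply: cube_root_le => //; first by rewrite mulr_ge0// ltW.
      by rewrite exprMn ys (le_trans n4)// ler_pM2r// -natrX ler_nat.
    rewrite (_ : 2 * (K1 + M) * b = 2 * (K1 + M) * eps * y); last by rewrite /b -/y mulrA.
    exact: (parabola_threshold A'0 cU0 y1 ys (sqr_ge0 z%:~R) (erefl t) _ _ n00' n4 cn).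
  apply: (parabola_tail A'0 cU0 y1 ys (sqr_ge0 z%:~R) (erefl t) D10 k0 kA' (sqr_ge0 _)).
  have wb := width_ge b0.
  have -> : cU / 8 * (z%:~R ^+ 2 / s%:R / y) =
      cU / 8 * ((width eps s)%:R ^+ 2 / y ^+ 4) * j%:~R ^+ 2.
    by rewrite /z intrM -ys exprMn; field; rewrite gt_eqF.
  rewrite ler_wpM2r ?sqr_ge0//.
  have -> : k = cU / 8 * (eps ^+ 4 / 4) by rewrite /k; field.
  rewrite ler_pM2l ?divr_gt0//.
  rewrite ler_pdivlMr ?exprn_gt0// mulrAC -exprMn -/y -/b.
  rewrite ler_pdivrMr// mulrC (_ : 4 = 2 ^+ 2); last by ring.
  by rewrite -exprMn (exprM b 2 2) lerXn2r ?nnegrE ?sqr_ge0 ?mulr_ge0.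
have sum_le : (1 - D / M ^+ 2) ^+ 2 * p <= 1 / 4.
  apply: (le_trans bk).
  apply: (@le_trans _ _ (\sum_(c <- K) 4 * D1 / (A' * k) * (1 + (c.2 - c.1)%:~R ^+ 2)^-1)).
    by rewrite big_seq [leRHS]big_seq; apply: ler_sum.
  rewrite -mulr_sumr -(big_map (fun c : int * int => c.2 - c.1) xpredT
    (fun j : int => (1 + j%:~R ^+ 2)^-1)).
  apply: (@le_trans _ _ (4 * D1 / (A' * k) * 6)).
    by rewrite ler_wpM2l ?sum_inv_succ_sq// divr_ge0 ?mulr_ge0 ?ltW.
  rewrite mulrAC ler_pdivrMr ?mulr_gt0//.
  rewrite (_ : _ * 6 = 96 * D1 / 4); last by field.
  by rewrite -[1 / 4 * _]mulrC mulrA mulr1 ler_pM2r.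
have p0 : 0 <= p by exact: pr_ge0.
by apply: (half_bound _ DM p0 sum_le); rewrite divr_ge0 ?sqr_ge0// ltW.
Qed.

(** The mean lies [g2 * n^(1/3)] below [mu * n]. Half of this is given up to have positive
    probability, and 1/8 each goes to the connections, to the correction [mu] and to the gain [c1]
    that is kept. Only [Y] depends on the range [Kw], so the range may be chosen after [c1] and
    [delta]. *)
Lemma cell_small : exists eps c1 delta : R, [/\ 0 < eps, eps <= 1, 0 < c1, 0 < delta &
  forall Kw : R, exists Y : R, forall (i : int) (s : nat) (c : int * int),
  Y <= cube_root s%:R ->
  `|((width eps s)%:Z * (c.2 - c.1))%:~R| <= Kw * cube_root s%:R ^+ 2 ->
  pr P xi (cellgt i s (width eps s) c (mu * s%:R - c1 * cube_root s%:R)) <= 1 - delta].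
Proof.
have [K1 K10 back] := backing_estimate.
have /andP[rho0 rho1] := lb_rho B; have D0 := lb_D B; have t00 := lb_t0 B.
have g20 := lb_g2 B.
have [|dl dl0 med] := lb_med B (a := g2 / 2); first lra.
pose dm := Num.min dl (1 / 2).
have dm0 : 0 < dm by rewrite lt_min dl0; lra.
have dm1 : dm <= 1 / 2 by rewrite ge_min lexx orbT.
pose M := t0 + 1 + 4 * D / dm.
have M4 : 0 < 4 * D / dm by rewrite divr_gt0// mulr_gt0.
have M0 : 0 < M ^+ 2 by rewrite exprn_gt0// /M; lra.
have DM : D / M ^+ 2 <= dm / 4.
  rewrite ler_pdivrMr// mulrAC ler_pdivlMr// mulrC.
  have hM : 4 * D <= dm * M by rewrite /M -ler_pdivrMl// mulrC; lra.
  apply: (le_trans (y := dm * M)); first lra.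
  by rewrite ler_pM2l// expr2 ler_peMl// /M; lra.
have tM : t0 < M by rewrite /M; lra.
have DM1 : D / M ^+ 2 <= 1 by lra.
(* [M] has been fixed by [dm]; [eps] is chosen after it, so that the loss in the connections is at
   most [g2 / 8] on the scale of [y]. *)
pose eps := Num.min 1 (g2 / (16 * (K1 + M))).
have KM : 0 < 16 * (K1 + M) by rewrite /M; lra.
have eps0 : 0 < eps by rewrite lt_min ltr01 divr_gt0.
have eps1 : eps <= 1 by rewrite ge_min lexx.
have epsg : 16 * (K1 + M) * eps <= g2.
  by rewrite mulrC -ler_pdivlMr// ge_min lexx orbT.
exists eps, (g2 / 8), (dm / 2); split => //; try lra.
move=> Kw; exists ((2 + (n0%:R + 2) + 2 / rho) / eps + 8 * `|mu| / g2 + `|Kw| / rho).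
move=> i s c; set y := cube_root s%:R => yY zy.
have k1 : 0 < 2 / rho by rewrite divr_gt0.
have k2 : 0 <= n0%:R :> R by [].
have k3 : 0 <= (2 + (n0%:R + 2) + 2 / rho) / eps by rewrite divr_ge0 ?ltW//; lra.
have k4 : 0 <= 8 * `|mu| / g2 by rewrite divr_ge0 ?mulr_ge0 ?(ltW g20).
have k5 : 0 <= `|Kw| / rho by rewrite divr_ge0 ?(ltW rho0).
have ey : 2 + (n0%:R + 2) + 2 / rho <= eps * y by rewrite -ler_pdivrMl// mulrC; lra.
have muy : 8 * `|mu| <= g2 * y by rewrite -ler_pdivrMl// mulrC; lra.
have Kwy : `|Kw| <= rho * y by rewrite -ler_pdivrMl// mulrC; lra.
have y0 : 0 < y by rewrite -(pmulr_rgt0 _ eps0); lra.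
have [b2 bn br] := le_of_sum3 (ler0n _ 2) (addr_ge0 k2 (ler0n _ 2)) (ltW k1) ey.
have [n [sn n4 nn0 _]] := back eps M i s [:: c] (fun=> mu * s%:R - g2 / 8 * y)
  eps0 eps1 tM DM1 b2 bn br.
rewrite big_seq1 /= -/y => bk.
rewrite (eq_pr _ (G := cellgt i s (width eps s) c (mu * s%:R - g2 / 8 * y))) in bk; last first.
  by move=> w; rewrite /= orbF.
set z := (width eps s)%:Z * (c.2 - c.1) in zy bk.
have zn : `|z%:~R| <= rho * n%:R.
  apply: (le_trans zy); apply: (@le_trans _ _ (rho * y ^+ 3)).
    rewrite [_ ^+ 3]exprS mulrA ler_pM2r ?exprn_gt0//.
    by apply: le_trans Kwy; exact: ler_norm.
  by rewrite ler_pM2l// cube_rootK// ler_nat.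
have tn : tailp P xi n z (mu * n%:R - mu + (mu * s%:R - g2 / 8 * y - mu * s%:R) -
    2 * (K1 + M) * (eps * y)) <= 1 - dm.
  have := med n z nn0 zn; have : dm <= dl by rewrite ge_min lexx.
  suff : tailp P xi n z (mu * n%:R - mu + (mu * s%:R - g2 / 8 * y - mu * s%:R) -
    2 * (K1 + M) * (eps * y)) <= tailp P xi n z (e n z + g2 / 2 * cube_root n%:R) by lra.
  apply: (tailp_le B); have := lb_mean_up B nn0 zn.
  have yn : y <= cube_root n%:R.
    by apply: cube_root_ge => //; [exact: ltW|rewrite cube_rootK// ler_nat].
  have : g2 * y <= g2 * cube_root n%:R by rewrite ler_pM2l.
  have : 0 <= G * z%:~R ^+ 2 / n%:R.
    by rewrite divr_ge0// mulr_ge0 ?sqr_ge0// ltW// (lb_G B).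
  have : 16 * (K1 + M) * eps * y <= g2 * y by rewrite ler_pM2r.
  have : mu <= `|mu| by exact: ler_norm.
  rewrite (_ : 16 * (K1 + M) * eps * y = 8 * (2 * (K1 + M) * (eps * y))); last by ring.
  move: (2 * (K1 + M) * (eps * y)) (G * z%:~R ^+ 2 / n%:R) muy => T X.
  have := normr_ge0 mu; lra.
have DM0 : 0 <= D / M ^+ 2 by rewrite divr_ge0 ?ltW.
move: bk tn; set p := pr _ _ _; set q := tailp _ _ _ _ _ => bk tn.
have p0 : 0 <= p by exact: pr_ge0.
exact: (probability_gap dm0 dm1 DM0 DM p0 (le_trans bk tn)).
Qed.

End Cells.

(** * The strip argument *)

Definition zrange (N : nat) : seq int := [seq n%:Z - N%:Z | n <- iota 0 (2 * N).+1].

Lemma mem_zrange N t : (t \in zrange N) = (absz t <= N)%N.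
Proof.
apply/mapP/idP => [[n]|tN]; first by rewrite mem_iota => /andP[_ nN] ->; lia.
by exists (absz (t + N%:Z)%R); [rewrite mem_iota; lia|lia].
Qed.

Lemma zrange_uniq N : uniq (zrange N).
Proof. by rewrite map_inj_uniq ?iota_uniq// => a b; lia. Qed.

Lemma size_zrange N : size (zrange N) = (2 * N).+1.
Proof. by rewrite size_map size_iota. Qed.

Section OpenEvents.
Context {R : realType} {d : measure_display} {Omega : measurableType d}.
Variables (P : probability Omega R) (xi : (int * int) -> Omega -> R) (nu : probability R R).
Hypotheses (xi0 : forall i w, 0 <= xi i w) (iid : iid_law P xi nu).
Implicit Types F : (int * int -> R) -> bool.

Definition open_event F := exists S, open_event_on S F.

Lemma opn_common (T : eqType) (l : seq T) (F : T -> (int * int -> R) -> bool) :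
  {in l, forall a, open_event (F a)} -> exists S, {in l, forall a, open_event_on S (F a)}.
Proof.
elim: l => [|a l IH] oF; first by exists [::].
have [S1 h1] := oF a (mem_head _ _).
have [|S2 h2] := IH; first by move=> b bl; apply: oF; rewrite in_cons bl orbT.
exists (S1 ++ S2) => b; rewrite in_cons => /orP[/eqP ->|bl].
  by apply: open_ev_sub h1 => j; rewrite mem_cat => ->.
by apply: open_ev_sub (h2 b bl) => j; rewrite mem_cat => ->; rewrite orbT.
Qed.

Lemma opn_has (T : eqType) (l : seq T) (F : T -> (int * int -> R) -> bool) :
  {in l, forall a, open_event (F a)} -> open_event (fun x => has (F^~ x) l).
Proof. by move=> /opn_common[S oS]; exists S; exact: open_ev_has. Qed.

Lemma opn_or F G : open_event F -> open_event G -> open_event (fun x => F x || G x).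
Proof.
move=> [S oF] [S' oG]; exists (S ++ S'); apply: open_ev_or.
  by apply: open_ev_sub oF => j; rewrite mem_cat => ->.
by apply: open_ev_sub oG => j; rewrite mem_cat => ->; rewrite orbT.
Qed.

Lemma opn_gt u v a : open_event (fun x => above x u v a).
Proof. by eexists; exact: open_gt. Qed.

Lemma opn_cellgt i s w c a : open_event (cellgt i s w c a).
Proof. by apply: opn_has => k _; exact: opn_gt. Qed.

Lemma opn_mev F : open_event F -> measurable_event xi F.
Proof. by move=> [S oF]; exact: (mev_open xi0 iid oF). Qed.

Lemma pr_avoid_all (T : eqType) (l : seq T) (F : T -> (int * int -> R) -> bool) (dl : R) :
  {in l, forall a, open_event (F a)} -> 0 <= dl ->
  {in l, forall a, dl <= pr P xi (fun x => ~~ F a x)} ->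
  dl ^+ size l <= pr P xi (fun x => ~~ has (F^~ x) l).
Proof.
move=> /opn_common[S oS] dl0 dlF; apply: le_trans (pr_harris_all xi0 iid oS).
elim: l dlF {oS} => [|a l IH] dlF; first by rewrite big_nil.
rewrite big_cons exprS; apply: ler_pM; rewrite ?exprn_ge0//.
  by apply: dlF; rewrite mem_head.
by apply: IH => b bl; apply: dlF; rewrite in_cons bl orbT.
Qed.

End OpenEvents.

(** * The deterministic estimate on the intersection of the good events *)

Section Deterministic.
Context {R : realType}.
Implicit Types x : int * int -> R.

Lemma gt_cone x i u v (s : nat) a : above x (pt i u) (pt (i + s%:Z) v) a -> (absz (v - u)%R <= s)%N.
Proof. by move=> /gtP[t]; rewrite endpE /pt /= => -[] h1 h2 _; lia. Qed.

Lemma lev_pt_step (p : int * int) (m u : int) (s : nat) :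
  lev p = lev (pt m u) + (2 * s)%N%:Z -> p = pt (m + s%:Z) (p.2 - 1 - (m + s%:Z)).
Proof. by case: p => a b; rewrite /lev /pt /= => h; congr pair; lia. Qed.

Lemma lev_pt_ge (m s N : nat) (u : int) : (m + s <= N)%N ->
  (2 * s)%N%:Z <= lev (pt N%:Z 0) - lev (pt m%:Z u).
Proof. by rewrite /lev /pt /=; lia. Qed.

(** A path heavier than [T] is followed slab by slab. After [i] slabs its remainder must exceed the
    target by the accumulated gains plus the parabola [c2 * u ^ 2 / (i * s)]. A path that reaches
    slab [kk] inside the strip contradicts [ends] through the gains, and one that leaves it
    contradicts [ends] through the parabola at the exit level. *)
Lemma strip_argument x (mu c1 c2 y E W T : R) (s kk N : nat) :
  nneg_env x -> (0 < s)%N -> (kk * s <= N)%N -> 0 < c1 -> 0 < c2 -> 0 <= y -> 0 <= W ->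
  (forall (i : nat) (u v : int), (i < kk)%N -> `|u%:~R| <= W ->
    ~~ above x (pt (i * s)%N%:Z u) (pt ((i * s)%N%:Z + s%:Z) v)
        (mu * s%:R - c1 * y - c2 * (v - u)%:~R ^+ 2 / s%:R)) ->
  (forall (i : nat) (u : int), (i <= kk)%N ->
    ~~ above x (pt (i * s)%N%:Z u) (pt N%:Z 0) (mu * (N - i * s)%N%:R + E)) ->
  mu * N%:R - kk%:R * (c1 * y) + E <= T ->
  mu * N%:R - c2 * W ^+ 2 / N%:R + E <= T ->
  ~~ above x (pt 0 0) (pt N%:Z 0) T.
Proof.
move=> x0 s0 ksN c10 c20 y0 W0 cells ends T1 T2; apply/negP => g0.
have sR : 0 < s%:R :> R by rewrite ltr0n.
have subE i : (i <= kk)%N -> mu * (N - i * s)%N%:R = mu * N%:R - mu * (i%:R * s%:R).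
  by move=> ik; rewrite natrB ?natrM ?mulrBr// (leq_trans _ ksN)// leq_mul2r ik orbT.
(* For [i = 0] the quotient is 0 by the convention for division by zero, hence the clause forcing
   [u = 0] there. *)
suff main (i : nat) : (i <= kk)%N -> exists u : int, [/\ `|u%:~R| <= W, i = 0%N -> u = 0 &
    above x (pt (i * s)%N%:Z u) (pt N%:Z 0)
      (T - mu * (i%:R * s%:R) + i%:R * (c1 * y) + c2 * u%:~R ^+ 2 / (i%:R * s%:R))].
  have [u [_ _ gu]] := main kk (leqnn _).
  have := ends kk u (leqnn _); rewrite subE// => /negP; apply.
  apply: le_gt gu; have : 0 <= c2 * u%:~R ^+ 2 / (kk%:R * s%:R).
    by apply: divr_ge0; apply: mulr_ge0 => //; [exact: ltW|exact: sqr_ge0].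
  by move: (c2 * u%:~R ^+ 2 / (kk%:R * s%:R)) => q; lra.
elim: i => [_|i IH ik].
  exists 0; split => //; first by rewrite normr0.
  by rewrite mul0n !mul0r mulr0 subr0 addr0 invr0 mulr0 addr0.
have [u [uW u0 gu]] := IH (ltnW ik).
have isN : ((i.+1 * s)%N <= N)%N by rewrite (leq_trans _ ksN)// leq_mul2r ik orbT.
have levE : (2 * s)%N%:Z <= lev (pt N%:Z 0) - lev (pt (i * s)%N%:Z u).
  by apply: lev_pt_ge; rewrite addnC -mulSn.
have [p [t [levp tp gp]]] := gt_split x0 gu levE.
pose v : int := p.2 - 1 - ((i * s)%N%:Z + s%:Z).
have pE : p = pt ((i * s)%N%:Z + s%:Z) v.
  exact: lev_pt_step levp.
have /negP nc := cells i u v ik uW.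
have hb : pw x (pt (i * s)%N%:Z u) t <= mu * s%:R - c1 * y - c2 * (v - u)%:~R ^+ 2 / s%:R.
  rewrite leNgt; apply/negP => hb; apply: nc; apply/gtP; exists t => //.
  by rewrite tp pE.
have := gp _ hb; rewrite pE.
have -> : (i * s)%N%:Z + s%:Z = (i.+1 * s)%N%:Z by rewrite -PoszD mulSn addnC.
move=> gv.
(* Quadratic costs are superadditive along the path: the defect is a multiple of the square of
   [u - i * (v - u)]. *)
have conv : v%:~R ^+ 2 / (i.+1%:R * s%:R) <=
    u%:~R ^+ 2 / (i%:R * s%:R) + (v - u)%:~R ^+ 2 / s%:R :> R.
  have [i0|i0] := posnP i.
    by rewrite u0// i0 mul1r mul0r invr0 mulr0 add0r subr0.
  have iR : 0 < i%:R :> R by rewrite ltr0n.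
  rewrite intrB -natr1 -subr_ge0.
  have -> : u%:~R ^+ 2 / (i%:R * s%:R) + (v%:~R - u%:~R) ^+ 2 / s%:R -
      v%:~R ^+ 2 / ((i%:R + 1) * s%:R) =
      (u%:~R - i%:R * (v%:~R - u%:~R)) ^+ 2 / (i%:R * (i%:R + 1) * s%:R) :> R.
    by field; rewrite !gt_eqF// addr_gt0.
  by rewrite divr_ge0 ?sqr_ge0// !mulr_ge0 ?addr_ge0// ltW.
have {}gv : above x (pt (i.+1 * s)%N%:Z v) (pt N%:Z 0)
   (T - mu * (i.+1%:R * s%:R) + i.+1%:R * (c1 * y) + c2 * v%:~R ^+ 2 / (i.+1%:R * s%:R)).
  apply: le_gt gv; have := ler_wpM2l (ltW c20) conv; rewrite mulrDr !mulrA.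
  move: (c2 * v%:~R ^+ 2 / i.+1%:R / s%:R) (c2 * u%:~R ^+ 2 / i%:R / s%:R) => q1 q2.
  move: (c2 * (v - u)%:~R ^+ 2 / s%:R) => q3; rewrite -natr1; lra.
exists v; split => //; rewrite leNgt; apply/negP => Wv.
have /negP := ends i.+1 v ik; apply; apply: le_gt gv; rewrite subE//.
have N0 : 0 < N%:R :> R by rewrite ltr0n; apply: leq_trans isN; rewrite muln_gt0.
have : c2 * W ^+ 2 / N%:R <= c2 * v%:~R ^+ 2 / (i.+1%:R * s%:R).
  rewrite -[c2 * W ^+ 2 / _]mulrA -[c2 * _ ^+ 2 / _]mulrA ler_pM2l//.
  apply: ler_pM; rewrite ?sqr_ge0 ?invr_ge0//.
    by rewrite -[leRHS]real_normK ?num_real// lerXn2r ?nnegrE// ltW.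
  by rewrite lef_pV2 ?posrE ?mulr_gt0// -natrM ler_nat.
have : 0 <= i.+1%:R * (c1 * y) by rewrite !mulr_ge0// ltW.
move: T2; move: (c2 * W ^+ 2 / N%:R) (c2 * v%:~R ^+ 2 / (i.+1%:R * s%:R)) => q1 q2.
lra.
Qed.

End Deterministic.

(** * Near and far displacements; [V] is the true displacement and [T] that of the cell corners *)

Section CellInequalities.
Context {R : realFieldType}.
Variables (c1 c2 T V y s : R).
Hypotheses (c10 : 0 < c1) (c20 : 0 < c2) (y0 : 0 < y) (ys : y ^+ 3 = s).
Hypothesis VT : V ^+ 2 <= 2 * T ^+ 2 + 2 * y ^+ 4.

Let s0 : 0 < s. Proof. by rewrite -ys exprn_gt0. Qed.

Let y4s : y ^+ 4 / s = y. Proof. by rewrite -ys; field; rewrite gt_eqF. Qed.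

Let VTs : V ^+ 2 / s <= 2 * (T ^+ 2 / s) + 2 * y.
Proof.
rewrite -[in leRHS]y4s (_ : _ + _ = (2 * T ^+ 2 + 2 * y ^+ 4) / s); last by ring.
by rewrite ler_pM2r// invr_gt0.
Qed.

(** On a bounded range of displacements a parabola with small coefficient costs at most half the
    gain, so a bound without any parabola is enough there. *)
Lemma near_inequality Km : 0 <= Km -> c2 * (4 * (Km ^+ 2 + 1)) <= c1 -> `|T| <= Km * y ^+ 2 ->
  c2 * V ^+ 2 / s <= c1 / 2 * y.
Proof.
move=> Km0 c2c TK.
have TKs : T ^+ 2 / s <= Km ^+ 2 * y.
  rewrite -[X in _ <= _ * X]y4s mulrA ler_pM2r ?invr_gt0// -[leLHS]real_normK ?num_real//.
  rewrite (exprM y 2 2) -exprMn lerXn2r ?nnegrE ?mulr_ge0// ?exprn_ge0// ltW//.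
rewrite -mulrA; apply: (@le_trans _ _ (c2 * (2 * (Km ^+ 2 * y) + 2 * y))).
  by rewrite ler_pM2l//; apply: (le_trans VTs); lra.
rewrite (_ : c2 * _ = c2 * (4 * (Km ^+ 2 + 1)) / 2 * y); last by field.
by rewrite ler_pM2r// ler_pM2r.
Qed.

(** Beyond [Kw * y ^+ 2] the parabola with coefficient [kap] outweighs the positive constant [A] and
    still leaves the gain and the flatter parabola [c2]. *)
Lemma far_inequality A kap Kw : 0 < A -> 0 < kap -> c2 <= kap / 4 -> 1 <= Kw ->
  kap * Kw = kap + 2 * (A + c1 + kap) -> Kw * y ^+ 2 <= `|T| ->
  A * y - kap * T ^+ 2 / s <= - (c1 / 2 * y) - c2 * V ^+ 2 / s.
Proof.
move=> A0 kap0 c2k Kw1 kapK KT.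
have TKs : Kw * y <= T ^+ 2 / s.
  apply: (@le_trans _ _ (Kw ^+ 2 * y)).
    by rewrite ler_pM2r// expr2 ler_peMl//; lra.
  rewrite -[X in _ * X <= _]y4s mulrA ler_pM2r ?invr_gt0// -[leRHS]real_normK ?num_real//.
  rewrite (exprM y 2 2) -exprMn; apply: lerXn2r; rewrite ?nnegrE//.
  by apply: mulr_ge0; [lra|exact: sqr_ge0].
have hk : (kap + 2 * (A + c1 + kap)) * y <= kap * (T ^+ 2 / s).
  by rewrite -kapK -mulrA ler_pM2l.
have hV : c2 * (V ^+ 2 / s) <= kap / 4 * (2 * (T ^+ 2 / s) + 2 * y).
  apply: ler_pM => //; first exact: ltW.
  by rewrite divr_ge0 ?sqr_ge0// ltW.
rewrite -!(mulrA _ (_ ^+ 2)).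
have h1 : 0 < c1 * y by rewrite mulr_gt0.
have h2 : 0 < kap * y by rewrite mulr_gt0.
have h3 : 0 < A * y by rewrite mulr_gt0.
move: hk hV; move: (T ^+ 2 / s) (V ^+ 2 / s) => q q'; lra.
Qed.

End CellInequalities.

(** * Good events attached to a cell and to a final stretch *)

Section GoodCells.
Context {R : realType} {d : measure_display} {Omega : measurableType d}.
Variables (P : probability Omega R) (xi : (int * int) -> Omega -> R).
Variables (nu : probability R R) (mu rho G H g1 g2 D t0 : R) (n0 : nat)
  (e : nat -> int -> R).
Hypothesis B : lpp_bounds P xi nu mu rho G H g1 g2 D t0 n0 e.

Lemma cell_digits (w : nat) (v : int) : (0 < w)%N ->
  exists (j : int) (k : nat), (k < w)%N /\ v = w%:Z * j + k%:Z.
Proof.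
move=> w0; exists (v %/ w%:Z)%Z, (absz (v %% w%:Z)%Z).
have h : w%:Z != 0 by rewrite eqz_nat -lt0n.
have m0 := modz_ge0 v h; have m1 := ltz_mod v h.
by split; [lia|rewrite {1}(divz_eq v w%:Z); lia].
Qed.

Lemma cell_offset (w s k k' : nat) (j t : int) : (k < w)%N -> (k' < w)%N ->
  (absz (w%:Z * (j + t) + k'%:Z - (w%:Z * j + k%:Z))%R <= s)%N ->
  (absz (w%:Z * t)%R <= s + w)%N.
Proof. by rewrite mulrDr; lia. Qed.

Lemma endpoint_bound : exists A Y : R, [/\ 0 < A, 0 < Y &
  exists bad : int -> nat -> (int * int -> R) -> bool,
  forall (i : int) (n : nat), Y <= cube_root n%:R ->
  [/\ open_event (bad i n), 1 / 2 <= pr P xi (fun x => ~~ bad i n x) &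
  forall x u, ~~ bad i n x ->
    ~~ above x (pt i u) (pt (i + n%:Z) 0) (mu * n%:R + A * cube_root n%:R)]].
Proof.
have [A [kap [Y [A0 kap0 par]]]] := cell_parabola B ltr01 (lexx 1).
exists A, (`|Y| + 2); split => //.
pose w n := width (1 : R) n.
pose K (n : nat) : seq (int * int) :=
  [seq (t, 0) | t <- zrange (n + w n) & (absz ((w n)%:Z * (0 - t))%R <= n + w n)%N].
exists (fun i n x => has (fun c => cellgt i n (w n) c (mu * n%:R + A * cube_root n%:R
    - kap * ((w n)%:Z * (c.2 - c.1))%:~R ^+ 2 / n%:R) x) (K n)).
move=> i n Yn.
have oB : open_event (fun x => has (fun c => cellgt i n (w n) c (mu * n%:R + A * cube_root n%:R
    - kap * ((w n)%:Z * (c.2 - c.1))%:~R ^+ 2 / n%:R) x) (K n)).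
  by apply: opn_has => c _; exact: opn_cellgt.
have Yn' : Y <= cube_root n%:R by have := ler_norm Y; lra.
split => //.
  rewrite pr_neg; last exact: (opn_mev (lb_ge0 B) (lb_iid B)).
  have uK : uniq [seq c.2 - c.1 | c <- K n].
    rewrite -map_comp map_inj_in_uniq ?filter_uniq ?zrange_uniq//.
    by move=> a b _ _ /=; lia.
  have sK : {in K n, forall c : int * int, (absz ((w n)%:Z * (c.2 - c.1))%R <= n + w n)%N}.
    by move=> c /mapP[t]; rewrite mem_filter => /andP[+ _] ->.
  by have := par i n (K n) Yn' uK sK; rewrite -/(w n); lra.
move=> x u /negP nb; apply/negP => g.
have y2 : 2 <= 1 * cube_root (n%:R : R).
  by rewrite mul1r; apply: le_trans Yn; rewrite lerDr.
have w0 : (0 < w n)%N.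
  rewrite -(ltr_nat R); have := width_ge y2; rewrite -/(w n).
  have : 2 ^+ 2 <= (1 * cube_root (n%:R : R)) ^+ 2 by rewrite lerXn2r ?nnegrE//; lra.
  lra.
have [j [k [kw uE]]] := cell_digits u w0.
have un := gt_cone g.
apply: nb; apply/hasP; exists (j, 0).
  apply/mapP; exists j => //; rewrite mem_filter mem_zrange.
  have h1 : (absz ((w n)%:Z * (0 - j))%R <= n + w n)%N by rewrite sub0r mulrN; lia.
  rewrite h1 /=; apply: leq_trans h1; rewrite sub0r mulrN abszN abszM /=.
  by rewrite leq_pmull.
apply/hasP; exists (k, 0%N); first by rewrite mem_cell_pairs kw.
rewrite /= mulr0 addr0 -uE; apply: le_gt g; rewrite gerBl.
by apply: divr_ge0 => //; apply: mulr_ge0; [exact: ltW|exact: sqr_ge0].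
Qed.

(** The far displacements are avoided together with probability at least 1/2, by a union bound; the
    [2 * m0 + 1] near ones separately with probability at least [dm]. Harris' inequality multiplies
    these bounds. Half of the gain from [cell_small] is sacrificed for the parabola. *)
Lemma cell_bound : exists eps c1 c2 dl Y : R,
  [/\ 0 < eps /\ eps <= 1, 0 < c1, 0 < c2, 0 < dl <= 1 & 0 < Y] /\
  exists bad : int -> nat -> int -> (int * int -> R) -> bool,
  forall (i : int) (s : nat) (j : int), Y <= cube_root s%:R ->
  [/\ (0 < width eps s)%N, open_event (bad i s j), dl <= pr P xi (fun x => ~~ bad i s j x) &
  forall x (k : nat) u v, ~~ bad i s j x -> (k < width eps s)%N ->
    u = (width eps s)%:Z * j + k%:Z ->
    ~~ above x (pt i u) (pt (i + s%:Z) v)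
      (mu * s%:R - c1 * cube_root s%:R - c2 * (v - u)%:~R ^+ 2 / s%:R)].
Proof.
have [eps [c1 [dl [eps0 eps1 c10 dl0 small]]]] := cell_small B.
have [A [kap [Y1 [A0 kap0 par]]]] := cell_parabola B eps0 eps1.
have eps2 : 0 < eps ^+ 2 by rewrite exprn_gt0.
(* This solves the equation [kap * Kw = kap + 2 * (A + c1 + kap)] asked for by [far_inequality]. *)
pose Kw := 1 + 2 * (A + c1 + kap) / kap.
have Kw1 : 1 <= Kw by rewrite lerDl divr_ge0 ?(ltW kap0)// mulr_ge0//; lra.
(* Beyond [m0] cells of width at least [eps ^+ 2 * y ^+ 2 / 2], the displacement is at least
   [Kw * y ^+ 2]. *)
pose m0 := (Num.truncn (2 * Kw / eps ^+ 2)).+1.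
have m0gt : 2 * Kw <= m0%:R * eps ^+ 2.
  by rewrite -ler_pdivrMr//; apply/ltW; exact: truncnS_gt.
have [Y2 {}small] := small (m0%:R * eps ^+ 2).
pose Km := m0%:R * eps ^+ 2.
have Km0 : 0 < Km by rewrite mulr_gt0.
pose c2 := Num.min (kap / 4) (c1 / (4 * (Km ^+ 2 + 1))).
have Km1 : 0 < 4 * (Km ^+ 2 + 1) by rewrite mulr_gt0// addr_gt0// exprn_gt0.
have c20 : 0 < c2 by rewrite lt_min !divr_gt0.
have c2k : c2 <= kap / 4 by rewrite ge_min lexx.
have c2c : c2 * (4 * (Km ^+ 2 + 1)) <= c1.
  by rewrite -ler_pdivlMr// ge_min lexx orbT.
pose dm := Num.min dl 1.
have dm0 : 0 < dm by rewrite lt_min dl0 ltr01.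
have dm1 : dm <= 1 by rewrite ge_min lexx orbT.
pose w s := width eps s.
pose K (s : nat) (j : int) : seq (int * int) :=
  [seq (j, j + t) | t <- zrange (s + w s) & (absz ((w s)%:Z * t)%R <= s + w s)%N].
pose far i s j x := has (fun c => cellgt i s (w s) c (mu * s%:R + A * cube_root s%:R
    - kap * ((w s)%:Z * (c.2 - c.1))%:~R ^+ 2 / s%:R) x) (K s j).
pose near i s j x := has (fun t => cellgt i s (w s) (j, j + t)
  (mu * s%:R - c1 * cube_root s%:R) x) (zrange m0).
exists eps, (c1 / 2), c2, (1 / 2 * dm ^+ (2 * m0).+1), (`|Y1| + `|Y2| + 2 / eps).
have e20 : 0 < 2 / eps by rewrite divr_gt0.
have nY1 : 0 <= `|Y1| by []. have nY2 : 0 <= `|Y2| by [].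
split; first split => //; try lra.
- apply/andP; split; first by rewrite mulr_gt0// exprn_gt0.
  have : dm ^+ (2 * m0).+1 <= 1 by rewrite exprn_ile1// ltW.
  lra.
exists (fun i s j x => far i s j x || near i s j x).
move=> i s j; set y := cube_root s%:R => yY.
have yY1 : Y1 <= y by have := ler_norm Y1; lra.
have yY2 : Y2 <= y by have := ler_norm Y2; lra.
have ey : 2 <= eps * y by rewrite -ler_pdivrMl// mulrC; lra.
have y0 : 0 < y by rewrite -(pmulr_rgt0 _ eps0); lra.
have wge := width_ge ey; have wle := le_width eps s; rewrite -/y -/(w s) exprMn in wge wle.
have ey2 : 2 * 2 <= eps ^+ 2 * y ^+ 2 by rewrite -exprMn expr2 ler_pM.
have w0 : (0 < w s)%N by rewrite -(ltr_nat R); lra.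
have s0 : 0 < s%:R :> R by rewrite -[s%:R]cube_rootK// exprn_gt0.
have ys : y ^+ 3 = s%:R by rewrite cube_rootK.
have ofar : open_event (far i s j) by apply: opn_has => c _; exact: opn_cellgt.
have onear : open_event (near i s j) by apply: opn_has => c _; exact: opn_cellgt.
have xi0 := lb_ge0 B; have iid := lb_iid B.
split => //.
- exact: opn_or.
- have pfar : 1 / 2 <= pr P xi (fun x => ~~ far i s j x).
    rewrite pr_neg; last exact: (opn_mev xi0 iid).
    have uK : uniq [seq c.2 - c.1 | c <- K s j].
      rewrite -map_comp map_inj_in_uniq ?filter_uniq ?zrange_uniq//.
      by move=> a b _ _ /=; rewrite [j + a]addrC [j + b]addrC !addrK.
    have sK : {in K s j, forall c : int * int, (absz ((w s)%:Z * (c.2 - c.1))%R <= s + w s)%N}.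
      by move=> c /mapP[t]; rewrite mem_filter => /andP[+ _] -> /=; rewrite addrAC subrr add0r.
    by have := par i s (K s j) yY1 uK sK; rewrite -/(w s) -/(far i s j); lra.
  have pnear : dm ^+ (2 * m0).+1 <= pr P xi (fun x => ~~ near i s j x).
    rewrite -size_zrange; apply: (pr_avoid_all xi0 iid); [|exact: ltW|].
      by move=> t _; exact: opn_cellgt.
    move=> t; rewrite mem_zrange => tm.
    rewrite pr_neg; last exact/(opn_mev xi0 iid)/opn_cellgt.
    have : dm <= dl by rewrite ge_min lexx.
    have := small i s (j, j + t) yY2; rewrite /= -/(w s) => h.
    suff : pr P xi (cellgt i s (w s) (j, j + t) (mu * s%:R - c1 * y)) <= 1 - dl by lra.
    apply: h; rewrite (_ : j + t - j = t); last by rewrite addrAC subrr add0r.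
    rewrite intrM normrM normr_nat -/y mulrC -mulrA.
    apply: ler_pM => //.
    by rewrite -intr_norm -natr_absz ler_nat.
  have [[S1 o1] [S2 o2]] := (ofar, onear).
  have o1' : open_event_on (S1 ++ S2) (far i s j).
    by apply: open_ev_sub o1 => q; rewrite mem_cat => ->.
  have o2' : open_event_on (S1 ++ S2) (near i s j).
    by apply: open_ev_sub o2 => q; rewrite mem_cat => ->; rewrite orbT.
  rewrite (eq_pr _ (G := fun x => ~~ far i s j x && ~~ near i s j x)); last first.
    by move=> ?; rewrite negb_or.
  apply: le_trans (pr_harris_neg xi0 iid o1' o2').
  by apply: ler_pM => //; rewrite exprn_ge0// ltW.
move=> x k u v; rewrite negb_or => /andP[/negP nfar /negP nnear] kw uE; apply/negP => g.
have vs := gt_cone g.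
have [j' [k' [k'w vE]]] := cell_digits v w0.
pose t := j' - j.
have j'E : j' = j + t by rewrite /t addrC subrK.
have zt : `|(v - u)%:~R - (w s)%:R * t%:~R| <= (w s)%:R :> R.
  have -> : (v - u)%:~R - (w s)%:R * t%:~R = k'%:R - k%:R :> R.
    by rewrite vE uE j'E !(intrD, intrM, intrB) -/(w s); ring.
  have : k%:R <= (w s)%:R :> R by rewrite ler_nat ltnW.
  have : k'%:R <= (w s)%:R :> R by rewrite ler_nat ltnW.
  have : 0 <= k%:R :> R by []. have : 0 <= k'%:R :> R by [].
  by rewrite ler_norml; lra.
have kk : (k, k') \in cell_pairs (w s) by rewrite mem_cell_pairs kw.
have wy : (w s)%:R <= y ^+ 2.
  by apply: (le_trans wle); rewrite ler_piMl ?sqr_ge0// exprn_ile1// ltW.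
pose V : R := (v - u)%:~R; pose T : R := (w s)%:R * t%:~R.
have VT : V ^+ 2 <= 2 * T ^+ 2 + 2 * y ^+ 4.
  have h : (V - T) ^+ 2 <= y ^+ 4.
    rewrite -[leLHS]real_normK ?num_real// (exprM y 2 2) lerXn2r ?nnegrE ?sqr_ge0//.
    exact: le_trans wy.
  by have := sqr_ge0 (V - 2 * T); move: h; nra.
have [tm|tm] := leqP (absz t) m0.
  apply: nnear; apply/hasP; exists t; first by rewrite mem_zrange.
  apply/hasP; exists (k, k') => //=; rewrite -j'E -vE -uE.
  apply: le_gt g; rewrite -/V -/y.
  have TK : `|T| <= Km * y ^+ 2.
    rewrite /T normrM normr_nat mulrC /Km -mulrA; apply: ler_pM => //.
    by rewrite -intr_norm -natr_absz ler_nat.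
  have := near_inequality c20 y0 ys VT (ltW Km0) c2c TK.
  move: (c2 * V ^+ 2 / s%:R) => q; lra.
apply: nfar; apply/hasP; exists (j, j + t).
  apply/mapP; exists t => //; rewrite mem_filter mem_zrange.
  have h1 : (absz ((w s)%:Z * t)%R <= s + w s)%N.
    by apply: (cell_offset (j := j) kw k'w); rewrite -j'E -vE -uE.
  rewrite h1 /=; apply: leq_trans h1; rewrite abszM /=.
  by rewrite leq_pmull.
apply/hasP; exists (k, k') => //=; rewrite -j'E -vE -uE.
apply: le_gt g; rewrite -/V -/y.
rewrite -/t intrM -/T.
have TK : Kw * y ^+ 2 <= `|T|.
  rewrite /T normrM normr_nat.
  have tmR : m0%:R <= `|t%:~R| :> R by rewrite -intr_norm -natr_absz ler_nat ltnW.
  apply: (@le_trans _ _ ((w s)%:R * m0%:R)); last by rewrite ler_wpM2l.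
  have : eps ^+ 2 * y ^+ 2 * m0%:R <= 2 * (w s)%:R * m0%:R by rewrite ler_wpM2r.
  have : 2 * Kw * y ^+ 2 <= m0%:R * eps ^+ 2 * y ^+ 2 by rewrite ler_wpM2r ?sqr_ge0.
  rewrite (_ : m0%:R * eps ^+ 2 * y ^+ 2 = eps ^+ 2 * y ^+ 2 * m0%:R); last by ring.
  lra.
have kapK : kap * Kw = kap + 2 * (A + c1 + kap) by rewrite /Kw; field; rewrite gt_eqF.
have := far_inequality c10 c20 y0 ys VT A0 kap0 c2k Kw1 kapK TK.
move: (c2 * V ^+ 2 / s%:R) (kap * T ^+ 2 / s%:R) => q1 q2; lra.
Qed.

End GoodCells.

(** * Assembling the slabs *)

Section ScaleInequalities.
Context {R : realFieldType}.
Variables (b tau C eps x y : R).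
Hypotheses (b1 : 1 <= b) (tau1 : 1 <= tau) (C1 : 1 <= C) (eps0 : 0 < eps) (x0 : 0 < x).
Hypothesis xy : x / (2 * b * tau) <= y.

Let b0 : 0 < b. Proof. exact: lt_le_trans b1. Qed.
Let tau0 : 0 < tau. Proof. exact: lt_le_trans tau1. Qed.
Let C0 : 0 < C. Proof. exact: lt_le_trans C1. Qed.
Let bt0 : 0 < 2 * b * tau. Proof. by rewrite !mulr_gt0. Qed.
Let y0 : 0 < y. Proof. by apply: lt_le_trans xy; rewrite divr_gt0. Qed.

(** Here [x] and [y] are the cube roots of [r] and [s]. At least [(b * tau) ^+ 3 / 4] slabs, each
    gaining [c1 * x / (2 * b * tau)], give [c1 * b ^+ 2 / 8] times [theta * x]: refining the slabs
    increases the total gain, which determines [b]. *)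
Lemma gain_inequality kk c1 : 0 < c1 -> 16 <= c1 * b ^+ 2 -> (b * tau) ^+ 3 / 4 <= kk ->
  2 * (tau ^+ 2 * x) <= kk * (c1 * y).
Proof.
move=> c10 cb kkb.
apply: (@le_trans _ _ ((b * tau) ^+ 3 / 4 * (c1 * (x / (2 * b * tau))))).
  rewrite (_ : _ / 4 * _ = c1 * b ^+ 2 / 8 * (tau ^+ 2 * x)); last first.
    by field; rewrite !gt_eqF.
  by rewrite ler_pM2r ?mulr_gt0 ?exprn_gt0//; lra.
apply: ler_pM => //; last by rewrite ler_pM2l.
  by rewrite divr_ge0// exprn_ge0// mulr_ge0// ltW.
by rewrite mulr_ge0 ?divr_ge0// ltW.
Qed.

Lemma exit_inequality c2 N : 0 < c2 -> 2 <= c2 * C ^+ 2 -> 0 < N -> N <= x ^+ 3 ->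
  2 * (tau ^+ 2 * x) <= c2 * (C * tau * x ^+ 2) ^+ 2 / N.
Proof.
move=> c20 cC N0 Nx; rewrite ler_pdivlMr//.
rewrite (_ : c2 * _ = c2 * C ^+ 2 * (tau ^+ 2 * x) * x ^+ 3); last by ring.
apply: ler_pM => //; first by rewrite !mulr_ge0 ?sqr_ge0// ltW.
- exact: ltW.
- by rewrite ler_pM2r ?mulr_gt0 ?exprn_gt0.
Qed.

Lemma strip_cells w : (eps * y) ^+ 2 <= 2 * w ->
  C * tau * x ^+ 2 / w <= 8 * C * b ^+ 2 * tau ^+ 3 / eps ^+ 2.
Proof.
move=> wy; have ey0 : 0 < (eps * y) ^+ 2 by rewrite exprn_gt0// mulr_gt0.
have w0 : 0 < w by lra.
have xby : x ^+ 2 <= (2 * b * tau * y) ^+ 2.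
  have h : x <= 2 * b * tau * y by rewrite mulrC -ler_pdivrMr.
  by rewrite lerXn2r ?nnegrE ?(ltW x0)// (le_trans (ltW x0)).
rewrite ler_pdivrMr//.
apply: (@le_trans _ _ (C * tau * (2 * b * tau * y) ^+ 2)).
  by rewrite ler_pM2l// mulr_gt0.
rewrite (_ : _ * _ = 4 * C * b ^+ 2 * tau ^+ 3 / eps ^+ 2 * (eps * y) ^+ 2); last first.
  by field; rewrite gt_eqF.
rewrite (_ : _ / _ * w = 4 * C * b ^+ 2 * tau ^+ 3 / eps ^+ 2 * (2 * w)); last first.
  by field; rewrite gt_eqF.
by rewrite ler_pM2l// divr_gt0 ?exprn_gt0// !mulr_gt0// exprn_gt0.
Qed.

(** There are O(tau^3) slabs with O(tau^3) starting cells each, hence O(theta^3) cell events; the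
    [kk + 1] endpoint events are of lower order. *)
Lemma count_bound kk J : 0 <= kk -> 0 <= J -> kk <= 2 * (b * tau) ^+ 3 ->
  J <= 8 * C * b ^+ 2 * tau ^+ 3 / eps ^+ 2 + 2 ->
  kk * (2 * J + 1) + (kk + 1) <=
    (32 * C * b ^+ 5 / eps ^+ 2 + 12 * b ^+ 3 + 1) * (tau ^+ 2) ^+ 3.
Proof.
move=> kk0 J0 kkb Jb.
apply: (@le_trans _ _ (2 * (b * tau) ^+ 3 *
    (2 * (8 * C * b ^+ 2 * tau ^+ 3 / eps ^+ 2 + 2) + 2) + 1)).
  rewrite (_ : _ + _ = kk * (2 * J + 2) + 1); last by ring.
  by rewrite lerD2r; apply: ler_pM => //; lra.
have t36 : tau ^+ 3 <= (tau ^+ 2) ^+ 3.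
  by rewrite -exprM; apply: ler_weXn2l.
have t06 : 1 <= (tau ^+ 2) ^+ 3 by rewrite -exprM exprn_ege1.
rewrite (_ : 2 * (b * tau) ^+ 3 * _ =
    32 * C * b ^+ 5 / eps ^+ 2 * (tau ^+ 2) ^+ 3 + 12 * b ^+ 3 * tau ^+ 3); last first.
  by field; rewrite gt_eqF.
rewrite [leRHS]mulrDl [X in _ <= X + _]mulrDl mul1r; apply: lerD => //; apply: lerD => //.
by rewrite ler_pM2l// mulr_gt0// exprn_gt0.
Qed.

End ScaleInequalities.

(** Explains the factor 2 in the gain and exit bounds: one [th * x] is the deviation to be proved,
    the other pays for the error of the mean, the shift by one in the length and the endpoint
    bound. *)
Lemma target_inequality (R : realFieldType) (mu m a A x th g E q : R) :
  mu * m - g * x <= E -> - mu <= a * x -> (g + a + A) * x <= th * x -> 2 * (th * x) <= q ->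
  mu * m - mu - q + A * x <= E - th * x.
Proof. lra. Qed.

Lemma natr_count (R : realFieldType) (k J : nat) :
  (k * (2 * J).+1 + k.+1)%:R = k%:R * (2 * J%:R + 1) + (k%:R + 1) :> R.
Proof. by rewrite natrD natrM -2!natr1 natrM. Qed.

Section Assembly.
Context {R : realType} {d : measure_display} {Omega : measurableType d}.
Variables (P : probability Omega R) (xi : (int * int) -> Omega -> R).
Variables (nu : probability R R) (mu rho G H g1 g2 D t0 : R) (n0 : nat)
  (e : nat -> int -> R).
Hypothesis B : lpp_bounds P xi nu mu rho G H g1 g2 D t0 n0 e.

Lemma strip_index (w : nat) (W : R) (j : int) (k : nat) : (k < w)%N ->
  `|(w%:Z * j + k%:Z)%:~R| <= W -> (absz j <= (Num.truncn (W / w%:R)).+2)%N.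
Proof.
move=> kw hW; have wR : 0 < w%:R :> R by rewrite ltr0n; apply: leq_ltn_trans kw.
have kR : k%:R <= w%:R :> R by rewrite ler_nat ltnW.
have k0 : 0 <= k%:R :> R by [].
rewrite -(ler_nat R) natr_absz intr_norm.
have : `|j%:~R| * w%:R <= W + w%:R :> R.
  rewrite -[w%:R in leLHS]normr_nat -normrM mulrC.
  have -> : w%:R * j%:~R = (w%:Z * j + k%:Z)%:~R - k%:R :> R by rewrite intrD intrM; ring.
  by apply: (le_trans (ler_normB _ _)); rewrite normr_nat; lra.
have -> : W + w%:R = (W / w%:R + 1) * w%:R by field; rewrite gt_eqF.
rewrite ler_pM2r// => h; apply: (le_trans h); rewrite -natr1 lerD2r.
exact/ltW/truncnS_gt.
Qed.

(* Scales: [tau ^+ 2] is [theta]; there are of order [(b tau)^3] steps of length [s]. *)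
Lemma step_scale (b tau Y : R) (r : nat) : 1 <= b -> 2 <= tau -> 1 <= Y ->
  4 * b * Y * tau <= cube_root r%:R -> (1 < r)%N ->
  exists s kk : nat, [/\ (0 < s)%N, ((kk.+1) * s <= r.-1)%N,
    Y <= cube_root s%:R, cube_root r%:R / (2 * b * tau) <= cube_root s%:R &
    (b * tau) ^+ 3 / 4 <= kk%:R /\ kk%:R <= 2 * (b * tau) ^+ 3].
Proof.
move=> b1 tau2 Y1 xY r1; set x := cube_root _ in xY *.
have b0 : 0 < b by lra.
have tau0 : 0 < tau by lra.
have bt : 2 <= b * tau by rewrite -[X in X <= _]mul1r ler_pM.
set q := (b * tau) ^+ 3.
have q8 : 8 <= q by rewrite (_ : 8 = 2 ^+ 3); [rewrite lerXn2r ?nnegrE//; lra|ring].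
have q0 : 0 < q by lra.
have xr : x ^+ 3 = r%:R by rewrite cube_rootK.
have bt0 : 0 < b * tau by lra.
have x4 : 4 * Y <= x / (b * tau).
  by rewrite ler_pdivlMr//; move: xY; rewrite (_ : 4 * b * Y * tau = 4 * Y * (b * tau)); last ring.
have rq : r%:R / q = (x / (b * tau)) ^+ 3 by rewrite -xr /q; field; rewrite !gt_eqF.
have rq64 : 64 <= r%:R / q.
  rewrite rq (_ : 64 = 4 ^+ 3); last by ring.
  by rewrite lerXn2r ?nnegrE//; lra.
pose s := Num.truncn (r%:R / q).
have sle : s%:R <= r%:R / q by rewrite truncn_le; lra.
have sgt : r%:R / q < s%:R + 1 by rewrite natr1 truncnS_gt.
have s0 : (0 < s)%N by rewrite -(ltr_nat R); lra.
have sR : 0 < s%:R :> R by rewrite ltr0n.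
pose k1 := (r.-1 %/ s)%N.
have k1s : (k1 * s <= r.-1)%N := leq_divM _ _.
have rk1 : (r.-1 < k1.+1 * s)%N := ltn_ceil _ s0.
have rR : r.-1%:R = r%:R - 1 :> R by rewrite -[in RHS](prednK (ltnW r1)) -natr1 addrK.
have r2 : 2 <= r%:R :> R by rewrite ler_nat.
have sq : s%:R * q <= r%:R by rewrite -ler_pdivlMr.
have qs : r%:R <= 2 * s%:R * q by rewrite -ler_pdivrMr//; lra.
have hk1 : q / 2 < k1%:R + 1.
  have : r.-1%:R < (k1%:R + 1) * s%:R :> R by rewrite natr1 -natrM ltr_nat.
  rewrite rR => h; rewrite -(ltr_pM2r sR); lra.
have hk2 : k1%:R <= 2 * q.
  have : k1%:R * s%:R <= r.-1%:R :> R by rewrite -natrM ler_nat.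
  rewrite rR => h; rewrite -(ler_pM2r sR); lra.
have k10 : (0 < k1)%N by rewrite -(ltr_nat R); lra.
(* One slab is given up so that a stretch of length at least [s] remains after the last level, long
   enough for [endpoint_bound]. *)
exists s, k1.-1; have kR : k1.-1%:R = k1%:R - 1 :> R.
  by rewrite -[in RHS](prednK k10) -natr1 addrK.
have xs : x / (2 * b * tau) <= cube_root s%:R.
  have x0 : 0 <= x by exact: cube_root_ge0.
  apply: cube_root_ge => //; first by rewrite divr_ge0// !mulr_ge0//; lra.
  have -> : (x / (2 * b * tau)) ^+ 3 = r%:R / q / 8.
    by rewrite rq; field; rewrite !gt_eqF.
  lra.
split => //.
- by rewrite prednK.
- apply: le_trans xs; rewrite (_ : x / (2 * b * tau) = x / (b * tau) / 2).
    lra.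
  by field; rewrite !gt_eqF.
- by rewrite kR -/q; split; lra.
Qed.

Lemma model_lower_tail : exists (c eta theta0 : R) (r0 : nat), 0 < c /\ 0 < eta /\
  forall (r : nat) (theta : R), (r0 < r)%N -> theta0 < theta ->
    theta < eta * cube_root r%:R ^+ 2 ->
    expR (- c * theta ^+ 3) <= 1 - tailp P xi r 0 (e r 0 - theta * cube_root r%:R).
Proof.
have [eps [c1 [c2 [dl [Y1 [[[eps0 eps1] c10 c20 /andP[dl0 dl1] Y10] [bad1 hbad1]]]]]]] :=
  cell_bound B.
have [A [Y2 [A0 Y20 [bad2 hbad2]]]] := endpoint_bound B.
have g10 := lb_g1 B; have xi0 := lb_ge0 B; have iid := lb_iid B.
have /andP[rho0 rho1] := lb_rho B.
pose b := 1 + 16 / c1; pose C := 1 + 2 / c2.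
have b16 : 0 < 16 / c1 by rewrite divr_gt0.
have C2 : 0 < 2 / c2 by rewrite divr_gt0.
have b1 : 1 <= b by rewrite lerDl ltW.
have C1 : 1 <= C by rewrite lerDl ltW.
have b0 : 0 < b := lt_le_trans ltr01 b1.
have C0 : 0 < C := lt_le_trans ltr01 C1.
have cb : 16 <= c1 * b ^+ 2.
  have : 16 <= c1 * b by rewrite mulrC -ler_pdivrMr// /b; lra.
  by move=> h; apply: (le_trans h); rewrite ler_pM2l// expr2 ler_peMl//; lra.
have cC : 2 <= c2 * C ^+ 2.
  have : 2 <= c2 * C by rewrite mulrC -ler_pdivrMr// /C; lra.
  by move=> h; apply: (le_trans h); rewrite ler_pM2l// expr2 ler_peMl//; lra.
have e20 : 0 < 2 / eps by rewrite divr_gt0.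
pose Y := Y1 + Y2 + 1 + 2 / eps; have Yge : 1 <= Y by rewrite /Y; lra.
have Y1Y : Y1 <= Y by rewrite /Y; lra.
have Y2Y : Y2 <= Y by rewrite /Y; lra.
have epsY : 2 <= eps * Y by rewrite mulrC -ler_pdivrMr// /Y; lra.
pose dm := Num.min dl (1 / 2).
have dm0 : 0 < dm by rewrite lt_min dl0; lra.
have dm1 : dm <= 1 / 2 by rewrite ge_min lexx orbT.
have lam0 : 0 <= - ln dm by rewrite oppr_ge0 ln_le0//; lra.
pose hc := 4 * b * Y.
have Y0 : 0 < Y := lt_le_trans ltr01 Yge.
have hc0 : 0 < hc by rewrite !mulr_gt0.
pose Q := 32 * C * b ^+ 5 / eps ^+ 2 + 12 * b ^+ 3 + 1.
(* At most [Q * theta ^+ 3] events, each avoided with probability at least [dm], give the exponent;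
   the 1 makes it positive. The value of [eta] ensures that the slabs are high enough for the cell
   estimates, and [theta0] gives [2 <= tau] and covers the errors in [target_inequality]. *)
exists (- ln dm * Q + 1), (hc ^+ 2)^-1, (4 + g1 + `|mu| + A), n0.+1.
have Q0 : 0 < Q.
  by rewrite /Q ltr_wpDl// addr_ge0 ?divr_ge0 ?mulr_ge0 ?exprn_ge0 ?(ltW b0) ?(ltW C0) ?(ltW eps0).
split; first by rewrite ltr_wpDl// mulr_ge0// ltW.
split; first by rewrite invr_gt0 exprn_gt0.
move=> r theta rn thetan; set x := cube_root _ => thx.
have nmu : 0 <= `|mu| by [].
have theta4 : 4 <= theta by lra.
have thetaA : g1 + `|mu| + A <= theta by lra.
pose tau := Num.sqrt theta.
have tau2 : tau ^+ 2 = theta by rewrite sqr_sqrtr//; lra.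
have tau0 : 0 <= tau by exact: sqrtr_ge0.
have taug : 2 <= tau by rewrite -(@ler_pXn2r _ 2) ?nnegrE// tau2; lra.
have x0 : 0 <= x by exact: cube_root_ge0.
have hx : hc * tau <= x.
  have h : (hc * tau) ^+ 2 <= x ^+ 2.
    rewrite exprMn tau2; move: thx; rewrite [ltRHS]mulrC ltr_pdivlMr ?exprn_gt0// => /ltW.
    by rewrite mulrC.
  by rewrite -(@ler_pXn2r _ 2) ?nnegrE// mulr_ge0// ltW.
have r1 : (1 < r)%N by apply: leq_trans rn.
have [s [kk [s0 kks Ys xs [kk1 kk2]]]] := step_scale b1 taug Yge hx r1.
set y := cube_root s%:R in Ys xs.
have tau1 : 1 <= tau by apply: le_trans taug; rewrite ler1n.
have x1 : 1 <= x.
  apply: le_trans hx; rewrite -[X in X <= _]mulr1; apply: ler_pM => //.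
  by rewrite /hc -[X in X <= _]mulr1 ler_pM// -[X in X <= _]mulr1 ler_pM// ler1n.
have x0' : 0 < x := lt_le_trans ltr01 x1.
have xr : x ^+ 3 = r%:R by rewrite cube_rootK.
have y0 : 0 < y := lt_le_trans Y0 Ys.
(* [W] is the half-width of the strip. Of the extra 2 in [J], one unit covers the offset inside a
   cell and one the truncation. *)
pose w := width eps s; pose W := C * tau * x ^+ 2; pose J := (Num.truncn (W / w%:R)).+2.
have W0 : 0 <= W by rewrite !mulr_ge0 ?exprn_ge0 ?(ltW C0).
pose N := r.-1.
pose T := (nat * int + nat)%type.
pose F (t : T) := match t with
  | inl p => bad1 (p.1 * s)%N%:Z s p.2
  | inr i => bad2 (i * s)%N%:Z (N - i * s)%N
  end.
(* One event per slab and starting cell of the strip, each already covering all final cells, and one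
   event for each of the levels 0 to [kk]. *)
pose l : seq T := [seq inl (i, j) | i <- iota 0 kk, j <- zrange J] ++ [seq inr i | i <- iota 0 kk.+1].
have Y1y : Y1 <= y := le_trans Y1Y Ys.
have Y2y (i : nat) : (i <= kk)%N -> Y2 <= cube_root (N - i * s)%:R.
  move=> ik; apply: (le_trans (le_trans Y2Y Ys)); apply: cube_root_ge => //; first exact: ltW.
  rewrite cube_rootK// ler_nat leq_subRL.
    by apply: leq_trans kks; rewrite addnC -mulSn leq_mul2r ltnS ik orbT.
  by apply: leq_trans kks; rewrite leq_mul2r leqW ?orbT.
have lP (t : T) : t \in l -> open_event (F t) /\ dm <= pr P xi (fun x => ~~ F t x).
  rewrite mem_cat => /orP[/allpairsP[[i j] /= [_ _ ->]]|/mapP[i]].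
    have [_ o1 p1 _] := hbad1 (i * s)%N%:Z s j Y1y; split => //.
    by apply: le_trans p1; rewrite ge_min lexx.
  rewrite mem_iota /= add0n ltnS => ik ->.
  have [op2 p2 _] := hbad2 (i * s)%N%:Z _ (Y2y i ik); split => //.
  by apply: le_trans p2; rewrite ge_min lexx orbT.
have avoid := pr_avoid_all xi0 iid (l := l) (F := F) (dl := dm)
  (fun t tl => (lP t tl).1) (ltW dm0) (fun t tl => (lP t tl).2).
have rE : r = N.+1 by rewrite /N prednK// ltnW.
have NR : N%:R = r%:R - 1 :> R by rewrite [in RHS]rE -natr1 addrK.
have NR_mul : mu * N%:R = mu * r%:R - mu by rewrite NR mulrBr mulr1.
have N0 : (0 < N)%N by rewrite -ltnS -rE.
have goal1 : 1 - tailp P xi r 0 (e r 0 - theta * x) =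
    pr P xi (fun z => ~~ above z (pt 0 0) (pt N%:Z 0) (e r 0 - theta * x)).
  rewrite pr_neg; last exact: mev_gt B _ _ _.
  have := pr_gt_pt B 0 0 0 N (e r 0 - theta * x); rewrite subr0 -rE add0r.
  by move=> ->.
rewrite goal1; apply: (@le_trans _ _ (dm ^+ size l)).
  have -> : dm ^+ size l = expR (- (- ln dm * (size l)%:R)).
    by rewrite mulNr opprK mulrC expRM_natl lnK ?posrE.
  have sl : (size l)%:R = kk%:R * (2 * J%:R + 1) + (kk%:R + 1) :> R.
    rewrite size_cat size_allpairs size_zrange size_map !size_iota.
    exact: natr_count.
  have Jle : J%:R <= 8 * C * b ^+ 2 * tau ^+ 3 / eps ^+ 2 + 2.
    have ey : 2 <= eps * y by rewrite (le_trans epsY)// ler_pM2l.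
    have := strip_cells b1 tau1 C1 eps0 x0' xs (width_ge ey); rewrite -/w -/W => h.
    have : (Num.truncn (W / w%:R))%:R <= W / w%:R by rewrite truncn_le divr_ge0.
    rewrite /J -addn2 natrD => h2; apply: lerD => //; exact: le_trans h.
  rewrite ler_expR mulNr lerN2 mulrDl mul1r sl -tau2.
  have h : kk%:R * (2 * J%:R + 1) + (kk%:R + 1) <= Q * (tau ^+ 2) ^+ 3.
    exact: count_bound.
  rewrite -mulrA; apply: (@le_trans _ _ (- ln dm * (Q * (tau ^+ 2) ^+ 3))).
    exact: ler_wpM2l.
  by rewrite lerDl !exprn_ge0.
apply: (le_trans avoid); apply: (le_pr P xi0).
- by apply/mev_neg/(opn_mev xi0 iid)/opn_has => t /lP[].
- exact/mev_neg/(mev_gt B).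
move=> z nz /hasPn nb.
have e_lo : mu * r%:R - g1 * x <= e r 0.
  have := lb_mean_lo B (n := r) (z := 0) (ltnW rn).
  rewrite normr0 mulr_ge0 ?(ltW rho0)// => /(_ isT).
  by rewrite !expr0n /= !mulr0 !mul0r !subr0.
have muabs : - mu <= `|mu| * x.
  by apply: (@le_trans _ _ `|mu|); [rewrite -normrN ler_norm|rewrite ler_peMr].
have thA : (g1 + `|mu| + A) * x <= theta * x by rewrite ler_wpM2r.
apply: (strip_argument (mu := mu) (c1 := c1) (c2 := c2) (y := y) (E := A * x) (W := W)
    (s := s) (kk := kk)) => //.
- by apply: leq_trans kks; rewrite leq_mul2r leqnSn orbT.
- exact: ltW.
- move=> i u v ik uW.
  have w0 : (0 < w)%N by have [] := hbad1 0 s 0 Y1y.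
  have [j [k [kw uE]]] := cell_digits u w0.
  have [_ _ _ +] := hbad1 (i * s)%N%:Z s j Y1y.
  move=> /(_ z k u v); apply => //.
  apply: (nb (inl (i, j))); rewrite mem_cat; apply/orP; left; apply/allpairsP.
  exists (i, j); split => //=; first by rewrite mem_iota.
  by rewrite mem_zrange; apply: (strip_index kw); rewrite -uE.
- move=> i u ik.
  have iN : (i * s <= N)%N.
    by apply: leq_trans kks; rewrite leq_mul2r leqW ?orbT.
  have [_ _ +] := hbad2 (i * s)%N%:Z _ (Y2y i ik).
  move=> /(_ z u); rewrite (_ : (i * s)%N%:Z + (N - i * s)%N%:Z = N%:Z); last by rewrite -PoszD subnKC.
  have il : inr i \in l.
    by rewrite mem_cat; apply/orP; right; apply/mapP; exists i => //; rewrite mem_iota.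
  move=> /(_ (nb _ il)); apply: contra; apply: le_gt; rewrite lerD2l ler_pM2l//; apply: cube_root_le => //.
  by rewrite xr ler_nat /N (leq_trans (leq_subr _ _))// leq_pred.
- rewrite NR_mul; apply: target_inequality e_lo muabs thA _.
  by rewrite -tau2; exact: (gain_inequality (b := b)).
rewrite NR_mul; apply: target_inequality e_lo muabs thA _.
rewrite -tau2; apply: exit_inequality => //; first by rewrite ltr0n.
by rewrite xr ler_nat leq_pred.
Qed.
End Assembly.

(** * Reduction to nonnegative weights *)

(** A single term of the exponential series suffices, the one of degree [m.+1] with
    [2 <= alpha * m.+1]. *)
Lemma expR_powR_le (R : realType) (c alpha : R) : 0 < c -> 0 < alpha ->
  exists2 D, 0 < D & forall t, 1 <= t -> expR (- c * t `^ alpha) <= D / t ^+ 2.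
Proof.
move=> c0 alpha0.
pose m := Num.truncn (2 / alpha).
have hm : 2 <= alpha * m.+1%:R.
  by rewrite mulrC -ler_pdivrMr//; apply/ltW/truncnS_gt.
have fact0 : 0 < (m.+1)`!%:R :> R by rewrite ltr0n fact_gt0.
exists ((m.+1)`!%:R / c ^+ m.+1); first by rewrite divr_gt0// exprn_gt0.
move=> t t1; have t0 : 0 < t by exact: lt_le_trans t1.
set x := c * t `^ alpha; have x0 : 0 < x by rewrite mulr_gt0// powR_gt0.
rewrite mulNr -/x expRN.
have xm : x ^+ m.+1 / (m.+1)`!%:R <= expR x.
  by apply: le_trans (expR_ge1Dxn m (ltW x0)); rewrite lerDr.
have tm : t ^+ 2 <= (t `^ alpha) ^+ m.+1.
  by rewrite -[leRHS]powR_mulrn ?powR_ge0// -powRrM -powR_mulrn ?(ltW t0)// ler_powR.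
apply: (@le_trans _ _ (x ^+ m.+1 / (m.+1)`!%:R)^-1).
  by rewrite lef_pV2 ?posrE ?expR_gt0 ?divr_gt0 ?exprn_gt0.
rewrite invf_div /x exprMn -mulrA ler_pM2l// -invfM lef_pV2 ?posrE.
- by rewrite ler_pM2l// exprn_gt0.
- by rewrite mulr_gt0// exprn_gt0// powR_gt0.
- by rewrite mulr_gt0// exprn_gt0.
Qed.

Section Truncation.
Context {R : realType} {d : measure_display} {Omega : measurableType d}.
Variables (P : probability Omega R) (xi : (int * int) -> Omega -> R) (nu : probability R R).

Lemma ae_eq_measure (A A' : set Omega) : measurable A -> measurable A' ->
  {ae P, forall w, A w <-> A' w} -> P A = P A'.
Proof.
move=> mA mA' AA'; rewrite -(setIT A) -(setIT A') -!integral_indic//.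
apply: ae_eq_integral => //.
- by apply/measurable_EFinP; exact: measurable_indic.
- by apply/measurable_EFinP; exact: measurable_indic.
apply: filterS AA' => w AA' _; rewrite !indicE; congr (_%:R%:E).
by congr nat_of_bool; apply/idP/idP; rewrite !inE => /AA'.
Qed.

(** [iid_law] makes the weights nonnegative only almost surely, whereas the path arguments use
    nonnegativity at every sample point. *)
Definition pospart (i : int * int) (w : Omega) : R := Num.max (xi i w) 0.

Hypothesis iid : iid_law P xi nu.

Let maxr0 (x : R) := Num.max x 0.

Let mmax : measurable_fun setT maxr0.
Proof. exact: measurable_maxr. Qed.

Let mpre (A : set R) : measurable A -> measurable (maxr0 @^-1` A).
Proof. by move=> mA; rewrite -[X in measurable X]setTI; exact: mmax. Qed.

Let mpos : measurable [set x : R | 0 <= x].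
Proof.
rewrite (_ : [set x : R | 0 <= x] = `[0, +oo[%classic)//.
by apply/seteqP; split => x; rewrite /= in_itv/= andbT.
Qed.

Lemma measurable_xi i (A : set R) : measurable A -> measurable (xi i @^-1` A).
Proof. by have [mxi _ _ _] := iid; move=> mA; rewrite -[X in measurable X]setTI; exact: mxi. Qed.

Lemma xi_ge0_ae i : {ae P, forall w, 0 <= xi i w}.
Proof.
have [mxi lawE pos _] := iid.
exists (xi i @^-1` (~` [set x | 0 <= x])); split => //.
- by apply: measurable_xi; exact: measurableC.
- rewrite lawE; last exact: measurableC.
  by rewrite probability_setC// pos subee.
Qed.

Lemma xi_pospart_ae : {ae P, forall w, forall i, xi i w = pospart i w}.
Proof.
(* The lattice is countable, so the exceptional null sets are gathered along its enumeration by
   [pickle]. *)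
have h : {ae P, forall w, forall n : nat, forall i : int * int, pickle i = n -> 0 <= xi i w}.
  apply: ae_foralln => n; case E : (unpickle n) => [i|].
    apply: filterS (xi_ge0_ae i) => w wi j jn; suff -> : j = i by [].
    by move: E; rewrite -jn pickleK => -[].
  by apply: nearW => w j jn; move: E; rewrite -jn pickleK.
apply: filterS h => w hw i; rewrite /pospart max_l//; exact: hw (erefl _).
Qed.

Lemma pospart_ge0 i w : 0 <= pospart i w.
Proof. by rewrite le_max lexx orbT. Qed.

Lemma iid_pospart : iid_law P pospart nu.
Proof.
have [mxi lawE pos indep] := iid; split=> [i|i A mA||s A us mA] //.
- exact: measurable_maxr.
- have mA' : measurable (pospart i @^-1` A).
    by rewrite (_ : pospart i @^-1` A = xi i @^-1` (maxr0 @^-1` A))//; exact: (measurable_xi i (mpre mA)).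
  rewrite -(lawE i A mA); apply: ae_eq_measure => //; first exact: measurable_xi.
  by apply: filterS xi_pospart_ae => w E; rewrite /= E.
- exact: (indep s (fun i => maxr0 @^-1` A i) us (fun i => mpre (mA i))).
Qed.

Lemma measurable_lpp u dx dy : measurable_fun setT (lpp xi u dx dy).
Proof.
have [mxi _ _ _] := iid.
have mw n (s : n.-tuple bool) : measurable_fun setT (weight xi u s).
  by apply: measurable_sum => k; exact: mxi.
rewrite /lpp; elim: (index_enum _) => [|s l IH].
  by under eq_fun do rewrite big_nil; exact: mw.
case cs: (count id s == dx); under eq_fun do rewrite big_cons cs; last by [].
by apply: measurable_maxr.
Qed.

Lemma lpp_pospart : {ae P, forall w, forall u dx dy, lpp xi u dx dy w = lpp pospart u dx dy w}.
Proof.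
apply: filterS xi_pospart_ae => w E u dx dy.
have W n (s : n.-tuple bool) : weight xi u s w = weight pospart u s w.
  by apply: eq_bigr => k _; exact: E.
by rewrite /lpp W; apply: eq_bigr => s _; exact: W.
Qed.

End Truncation.

Lemma measurable_ray_le {R : realType} (b : R) : measurable [set x : R | x <= b].
Proof.
rewrite (_ : [set x | _] = `]-oo, b]%classic); first exact: measurable_itv.
by apply/seteqP; split => x; rewrite /= in_itv.
Qed.

Lemma measurable_ray_lt {R : realType} (b : R) : measurable [set x : R | x < b].
Proof.
rewrite (_ : [set x | _] = `]-oo, b[%classic); first exact: measurable_itv.
by apply/seteqP; split => x; rewrite /= in_itv.
Qed.

Section TruncationLpp.
Context {R : realType} {d : measure_display} {Omega : measurableType d}.
Variables (P : probability Omega R) (xi : (int * int) -> Omega -> R) (nu : probability R R).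
Hypothesis iid : iid_law P xi nu.

Let X r z := Xrz (pospart xi) r z.

Let mX r z : measurable_fun setT (X r z).
Proof. exact: (measurable_lpp (iid_pospart iid)). Qed.

Lemma EX_pospart r z : EX P xi r z = (\int[P]_w (X r z w)%:E)%E.
Proof.
apply: ae_eq_integral => //.
- by apply/measurable_EFinP; exact: (measurable_lpp iid).
- exact/measurable_EFinP.
- by apply: filterS (lpp_pospart iid) => w E _; rewrite /X /Xrz E.
Qed.

Let mB (f : Omega -> R) (B : set R) : measurable_fun setT f -> measurable B ->
  measurable (f @^-1` B).
Proof. by move=> mf mB; rewrite -[X in measurable X]setTI; exact: mf. Qed.

Let mgt (a : R) : measurable [set x : R | a < x].
Proof.
rewrite (_ : [set x | _] = `]a, +oo[%classic); first exact: measurable_itv.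
by apply/seteqP; split => x; rewrite /= in_itv/= andbT.
Qed.

Lemma measurable_Xrz r z (B : set R) : measurable B -> measurable [set w | B (Xrz xi r z w)].
Proof. exact: (mB (measurable_lpp iid _ _ _)). Qed.

Lemma P_pospart r z (B : set R) : measurable B ->
  P [set w | B (Xrz xi r z w)] = P [set w | B (X r z w)].
Proof.
move=> mB'; apply: ae_eq_measure.
- exact: (mB (measurable_lpp iid _ _ _) mB').
- exact: (mB (mX r z) mB').
- by apply: filterS (lpp_pospart iid) => w E; rewrite /X /Xrz /= E.
Qed.

Lemma Xrz_gt r z w a : `|z%:~R| < r%:R :> R ->
  (a < X r z w) = above (fun i => pospart xi i w) (1, 1) (r%:Z - z, r%:Z + z) a.
Proof.
rewrite -intr_norm -natr_absz ltr_nat => zr.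
by rewrite /X /Xrz lpp_gt /=; congr above; congr pair; lia.
Qed.

Lemma P_gt_tailp r z a : `|z%:~R| < r%:R :> R ->
  P [set w | a < Xrz xi r z w] = (tailp P (pospart xi) r z a)%:E.
Proof.
move=> zr; rewrite (@P_pospart r z [set x | a < x]); last exact: mgt.
rewrite /tailp -prE; last exact: (opn_mev (@pospart_ge0 _ _ _ xi) (iid_pospart iid) (opn_gt _ _ _)).
by congr (P _); apply/seteqP; split => w; rewrite /evset /= (Xrz_gt _ _ zr).
Qed.

Lemma P_le_tailp r z a : `|z%:~R| < r%:R :> R ->
  P [set w | Xrz xi r z w <= a] = (1 - tailp P (pospart xi) r z a)%:E.
Proof.
move=> zr; rewrite EFinB -(P_gt_tailp _ zr) -probability_setC.
  by congr (P _); apply/seteqP; split => w /=; rewrite leNgt => /negP.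
exact: (mB (measurable_lpp iid _ _ _) (mgt a)).
Qed.

Lemma X_ge0 r z w : 0 <= X r z w.
Proof.
have W u n (s : n.-tuple bool) : 0 <= weight (pospart xi) u s w.
  by apply: sumr_ge0 => k _; exact: pospart_ge0.
rewrite /X /Xrz /lpp; elim/big_ind: _ => // a b a0 b0.
by rewrite le_max a0.
Qed.

End TruncationLpp.

(** * From the assumptions to the working bounds *)

Section Hypotheses.
Context {R : realType} {d : measure_display} {Omega : measurableType d}.
Variables (P : probability Omega R) (xi : (int * int) -> Omega -> R) (nu : probability R R).
Variables (mu alpha : R).
Hypotheses (iid : iid_law P xi nu) (alpha0 : 0 < alpha).
Hypothesis LS : exists rho G H g1 g2 : R,
     [/\ 0 < rho < 1, 0 < G, 0 < H, 0 < g1 & 0 < g2] /\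
     exists r1 : nat, forall (r : nat) (z : int), (r1 < r)%N ->
       `|z%:~R| <= rho * r%:R ->
       ((mu * r%:R - G * z%:~R ^+ 2 / r%:R - H * z%:~R ^+ 4 / r%:R ^+ 3
          - g1 * cube_root r%:R)%:E <= EX P xi r z)%E /\
       (EX P xi r z <= (mu * r%:R - G * z%:~R ^+ 2 / r%:R - g2 * cube_root r%:R)%:E)%E.
Hypothesis UTLT : forall eps : R, 0 < eps ->
     exists (c theta0 : R) (r0 : nat), [/\ 0 < c, 0 < theta0 & (0 < r0)%N] /\
     forall (r : nat) (theta : R) (z : int), (r0 < r)%N -> theta0 < theta ->
       `|z%:~R| <= (1 - eps) * r%:R ->
       (P [set w | ((Xrz xi r z w)%:E - EX P xi r z > (theta * cube_root r%:R)%:E)%E]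
          <= (expR (- c * theta `^ alpha))%:E)%E /\
       (P [set w | ((Xrz xi r z w)%:E - EX P xi r z < (- (theta * cube_root r%:R))%:E)%E]
          <= (expR (- c * theta `^ alpha))%:E)%E.

Lemma lpp_bounds_pospart : exists rho G H g1 g2 D t0 n0,
  let e r z := fine (EX P xi r z) in
  lpp_bounds P (pospart xi) nu mu rho G H g1 g2 D t0 n0 e /\
  forall r (z : int), (n0 < r)%N -> `|z%:~R| <= rho * r%:R -> EX P xi r z = (e r z)%:E.
Proof.
have [rho [G [H [g1 [g2 [[/andP[rho0 rho1] G0 H0 g10 g20] [r1 mean]]]]]]] := LS.
(* With this choice the range of slopes in the tail bounds is exactly that of (LS). *)
have [|c [th0 [r0 [[c0 th00 r00] tails]]]] := UTLT (eps := 1 - rho); first by rewrite subr_gt0.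
have [D1 D10 poly] := expR_powR_le c0 alpha0.
(* The lower tail is assumed for a strict inequality but wanted for a weak one: a deviation of at
   least [t] is strictly more than [t / 2], whence the factors 2 in [t0] and 4 in [D]. *)
pose n0 := (r0 + r1)%N; pose t0 := 2 * (th0 + 1); pose D := 4 * D1.
exists rho, G, H, g1, g2, D, t0, n0 => e.
have D0 : 0 < D by rewrite mulr_gt0.
have t00 : 0 < t0 by rewrite mulr_gt0// addr_gt0.
have EXe r (z : int) : (n0 < r)%N -> `|z%:~R| <= rho * r%:R -> EX P xi r z = (e r z)%:E.
  move=> nr zr; have [|lo up] := mean r z _ zr; first by apply: leq_ltn_trans nr; exact: leq_addl.
  rewrite /e; move: lo up; case: (EX P xi r z) => [x _ _ //|_|]; first by rewrite leye_eq.
  by rewrite leeNy_eq.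
have rpos r : (n0 < r)%N -> 0 < r%:R :> R by move=> nr; rewrite ltr0n; apply: leq_ltn_trans nr.
have zlt r (z : int) : (n0 < r)%N -> `|z%:~R| <= rho * r%:R -> `|z%:~R| < r%:R :> R.
  by move=> nr zr; apply: (le_lt_trans zr); rewrite gtr_pMl// rpos.
have upper r (z : int) t : (n0 < r)%N -> `|z%:~R| <= rho * r%:R -> th0 + 1 < t ->
    tailp P (pospart xi) r z (e r z + t * cube_root r%:R) <= D1 / t ^+ 2.
  move=> nr zr tt; have t1 : 1 <= t by lra.
  have [||//|up _] := tails r t z.
  - by apply: leq_ltn_trans nr; exact: leq_addr.
  - lra.
  - by rewrite opprB addrC subrK.
  apply: le_trans (poly t t1); rewrite -lee_fin -(P_gt_tailp iid _ (zlt _ _ nr zr)).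
  apply: le_trans up; rewrite le_eqVlt; apply/orP; left; apply/eqP; congr (P _).
  by apply/seteqP; split => w /=; rewrite (EXe r z nr zr) -EFinB lte_fin ltrBrDl.
have lower r (z : int) t : (n0 < r)%N -> `|z%:~R| <= rho * r%:R -> t0 < t ->
    1 - tailp P (pospart xi) r z (e r z - t * cube_root r%:R) <= D / t ^+ 2.
  move=> nr zr tt; have t1 : 1 <= t / 2 by rewrite /t0 in tt; lra.
  have [||//|_ lo] := tails r (t / 2) z.
  - by apply: leq_ltn_trans nr; exact: leq_addr.
  - rewrite /t0 in tt; lra.
  - by rewrite opprB addrC subrK.
  have -> : D / t ^+ 2 = D1 / (t / 2) ^+ 2.
    by rewrite /D; field; rewrite gt_eqF//; lra.
  apply: le_trans (poly _ t1); rewrite -lee_fin -(P_le_tailp iid _ (zlt _ _ nr zr)).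
  apply: le_trans lo.
  rewrite [X in (_ <= P X)%E](_ : _ = [set w | Xrz xi r z w < e r z - t / 2 * cube_root r%:R]).
    apply: le_measure; rewrite ?inE.
    - exact: (measurable_Xrz iid r z (measurable_ray_le _)).
    - exact: (measurable_Xrz iid r z (measurable_ray_lt _)).
    move=> w /=; have : 0 < t * cube_root r%:R by rewrite mulr_gt0 ?cube_root_gt0 ?rpos//; lra.
    lra.
  apply/seteqP; split => w /=; rewrite (EXe r z nr zr) -EFinB lte_fin; lra.
split => //; split => //.
- exact: iid_pospart.
- exact: pospart_ge0.
- by rewrite rho0.
- move=> r z nr zr; have [|lo _] := mean r z _ zr.
    by apply: leq_ltn_trans nr; exact: leq_addl.
  by rewrite -lee_fin -EXe.
- move=> r z nr zr; have [|_ up] := mean r z _ zr.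
    by apply: leq_ltn_trans nr; exact: leq_addl.
  by rewrite -lee_fin -EXe.
- move=> r z t nr zr tt; apply: (le_trans (upper r z t nr zr _)); first by rewrite /t0 in tt; lra.
  rewrite ler_pM2r ?invr_gt0 ?exprn_gt0//; last lra.
  by rewrite /D; lra.
(* Large enough for [mean_lower]: past the threshold [t0], and with the remaining layers bounded by
   [D / M <= a / 2]. *)
- move=> a a0; pose M := (Num.truncn (t0 + 2 * D / a)).+1.
  have DMa : 0 < 2 * D / a by rewrite divr_gt0// mulr_gt0.
  have Mgt : t0 + 2 * D / a < M%:R by exact: truncnS_gt.
  exists (a / 2 / (a + M.+1%:R)); first by rewrite divr_gt0// ?divr_gt0// addr_gt0.
  move=> r z nr zr; have zr' := zlt r z nr zr.
  have Ple b : P [set w | Xrz (pospart xi) r z w <= b] = (1 - tailp P (pospart xi) r z b)%:E.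
    rewrite -(P_le_tailp iid _ zr'); apply/esym.
    exact: (P_pospart iid r z (measurable_ray_le b)).
  have M1 : D / M%:R <= a / 2.
    rewrite ler_pdivrMr ?ltr0n// mulrC -ler_pdivrMr ?divr_gt0//.
    rewrite (_ : D / (a / 2) = 2 * D / a); last by field; rewrite gt_eqF.
    lra.
  have := @mean_lower _ _ _ P (Xrz (pospart xi) r z) (e r z) (cube_root r%:R) D t0
    _ (X_ge0 xi r z) _ (cube_root_gt0 (rpos r nr)) (ltW D0) _ a M a0 isT _ M1.
  rewrite Ple /=; apply.
  + exact: (measurable_lpp (iid_pospart iid)).
  + by rewrite -(EX_pospart iid) EXe.
  + by move=> t tt; rewrite Ple; exact: lower.
  + lra.
Qed.

End Hypotheses.

Unset Implicit Arguments.

Theorem theorem4 (R : realType) (d : measure_display) (Omega : measurableType d)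
  (P : probability Omega R) (xi : (int * int)%type -> Omega -> R)
  (nu : probability R R) (mu : R) :
  iid_law P xi nu ->
  (* mu = lim_{r -> oo} r^{-1} E[X_r] < oo *)
  ((fun r : nat => ((r%:R)^-1)%:E * EX P xi r 0)%E @ \oo --> mu%:E) ->
  (* (LS) *)
  (exists rho G H g1 g2 : R,
     [/\ 0 < rho < 1, 0 < G, 0 < H, 0 < g1 & 0 < g2] /\
     exists r1 : nat, forall (r : nat) (z : int), (r1 < r)%N ->
       `|z%:~R| <= rho * r%:R ->
       ((mu * r%:R - G * z%:~R ^+ 2 / r%:R - H * z%:~R ^+ 4 / r%:R ^+ 3
          - g1 * cube_root r%:R)%:E <= EX P xi r z)%E /\
       (EX P xi r z <= (mu * r%:R - G * z%:~R ^+ 2 / r%:R - g2 * cube_root r%:R)%:E)%E) ->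
  (* (UT) and (LT) with a common exponent alpha *)
  forall alpha : R, 0 < alpha ->
  (forall eps : R, 0 < eps ->
     exists (c theta0 : R) (r0 : nat), [/\ 0 < c, 0 < theta0 & (0 < r0)%N] /\
     forall (r : nat) (theta : R) (z : int), (r0 < r)%N -> theta0 < theta ->
       `|z%:~R| <= (1 - eps) * r%:R ->
       (P [set w | ((Xrz xi r z w)%:E - EX P xi r z > (theta * cube_root r%:R)%:E)%E]
          <= (expR (- c * theta `^ alpha))%:E)%E /\
       (P [set w | ((Xrz xi r z w)%:E - EX P xi r z < (- (theta * cube_root r%:R))%:E)%E]
          <= (expR (- c * theta `^ alpha))%:E)%E) ->
  (* (LB) *)
  (exists (delta C : R) (r0 : nat), 0 < delta /\ 0 < C /\
     forall r : nat, (r0 < r)%N ->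
       (delta%:E <= P [set w | (Xrz xi r 0 w - mu * r%:R < - (C * cube_root r%:R))%R])%E) ->
  exists (c eta theta0 : R) (r0 : nat), 0 < c /\ 0 < eta /\
    forall (r : nat) (theta : R), (r0 < r)%N ->
      theta0 < theta -> theta < eta * r%:R `^ (2 / 3) ->
      ((expR (- c * theta ^+ 3))%:E <=
        P [set w | ((Xrz xi r 0 w)%:E - EX P xi r 0 <= (- (theta * cube_root r%:R))%:E)%E])%E.
Proof.
move=> iid _ LS alpha alpha0 UTLT _.
have [rho [G [H [g1 [g2 [D [t0 [n0 [B EXe]]]]]]]]] := lpp_bounds_pospart iid alpha0 LS UTLT.
have [c [eta [theta0 [r0 [c0 [eta0 bound]]]]]] := model_lower_tail B.
have /andP[rho0 rho1] := lb_rho B.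
exists c, eta, theta0, (r0 + n0)%N; split => //; split => // r theta rr thr thu.
have r0r : (r0 < r)%N by apply: leq_ltn_trans rr; exact: leq_addr.
have n0r : (n0 < r)%N by apply: leq_ltn_trans rr; exact: leq_addl.
have rR : 0 < r%:R :> R by rewrite ltr0n; apply: leq_ltn_trans rr.
have z0 : `|(0 : int)%:~R| <= rho * r%:R by rewrite normr0 mulr_ge0// ltW.
have z0' : `|(0 : int)%:~R| < r%:R :> R by rewrite normr0.
have := bound r theta r0r thr; rewrite -powR_mulrn ?cube_root_ge0// /cube_root -powRrM.
rewrite (_ : 3^-1 * 2 = 2 / 3); last by rewrite mulrC.
move=> /(_ thu); rewrite -lee_fin -(P_le_tailp iid _ z0'); move/le_trans; apply.
rewrite le_eqVlt; apply/orP; left; apply/eqP; congr (P _).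
by apply/seteqP; split => w /=; rewrite (EXe r 0 n0r z0) -EFinB lee_fin lerBlDl.
Qed.
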